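(* Let $U_\hbar(\mathfrak g)$ be a QUEA over the Lie bialgebra $\mathfrak g=(\mathfrak g;[\ ,\ ],\delta)$. Let $\mathcal F\in U_\hbar(\mathfrak g)^{\widehat\otimes 2}$ be a twist for $U_\hbar(\mathfrak g)$ such that $\mathcal F\equiv 1\ \big(\mathrm{mod}\ \hbar\,U_\hbar(\mathfrak g)^{\widehat\otimes 2}\big)$; then $\kappa:=\hbar^{-1}\log(\mathcal F)\in U_\hbar(\mathfrak g)^{\widehat\otimes 2}$ and $\mathcal F=\exp(\hbar\,\kappa)$. Set $\kappa_a:=\kappa-\kappa_{2,1}$. Then: (a) $\kappa$ is antisymmetric, i.e. $\kappa_{2,1}=-\kappa$, if and only if $\mathcal F$ is orthogonal, i.e. $\mathcal F_{2,1}=\mathcal F^{-1}$; (b) the element $c:=\kappa_a\ \big(\mathrm{mod}\ \hbar\,U_\hbar(\mathfrak g)^{\widehat\otimes 2}\big)\in U(\mathfrak g)\otimes U(\mathfrak g)$ belongs to $\mathfrak g\otimes\mathfrak g$, and it is an antisymmetric twist for the Lie bialgebra $\mathfrak g$; (c) the deformation $U_\hbar(\mathfrak g)^{\mathcal F}$ of $U_\hbar(\mathfrak g)$ by the twist $\mathcal F$ is a QUEA for the Lie bialgebra $\mathfrak g^{c}=(\mathfrak g;[\ ,\ ],\delta^{c})$, the deformation of $\mathfrak g$ by the twist $c$. In short, $U_\hbar(\mathfrak g)^{\mathcal F}\cong U_\hbar(\mathfrak g^{c})$.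
   Context: $\Bbbk$ is a field of characteristic $0$. A topologically free $\Bbbk[[\hbar]]$-module is one isomorphic to $V[[\hbar]]$ for a $\Bbbk$-vector space $V$, with the $\hbar$-adic topology; $\widehat\otimes$ is the $\hbar$-adically completed tensor product over $\Bbbk[[\hbar]]$. QUEA: a topological Hopf algebra $U_\hbar$ (with respect to $\widehat\otimes$) which is topologically free over $\Bbbk[[\hbar]]$ and such that $U_\hbar/\hbar U_\hbar\cong U(\mathfrak g)$ as Hopf algebras, for some Lie algebra $\mathfrak g$ over $\Bbbk$. Then $\delta(x):=\hbar^{-1}\big(\Delta(x')-\Delta^{\mathrm{op}}(x')\big)\bmod\hbar$, with $x'\in U_\hbar$ any lift of $x\in\mathfrak g$, is a Lie cobracket making $\mathfrak g$ a Lie bialgebra; $U_\hbar$ is called a QUEA over (or for, or a quantization of) the Lie bialgebra $\mathfrak g$, written $U_\hbar(\mathfrak g)$. Hopf twist: for a (topological) Hopf algebra $H$, a twist is an invertible $\mathcal F\in H\otimes H$ (completed tensor product) with $(\epsilon\otimes\mathrm{id})(\mathcal F)=1=(\mathrm{id}\otimes\epsilon)(\mathcal F)$ and $\mathcal F_{12}\,(\Delta\otimes\mathrm{id})(\mathcal F)=\mathcal F_{23}\,(\mathrm{id}\otimes\Delta)(\mathcal F)$. The deformation $H^{\mathcal F}$ is $H$ with the same product, unit and counit, the coproduct $\Delta^{\mathcal F}(x)=\mathcal F\,\Delta(x)\,\mathcal F^{-1}$, and antipode $\mathcal S^{\mathcal F}(x)=v\,\mathcal S(x)\,v^{-1}$,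 where $v=\sum\mathcal S(f'_1)f'_2$ with $\mathcal F^{-1}=\sum f_1'\otimes f_2'$. A subscript $2,1$ denotes the flip of the two tensor factors. Lie twist: for a Lie bialgebra $(\mathfrak g;[\ ,\ ],\delta)$, a twist is $c\in\mathfrak g\otimes\mathfrak g$ such that for all $x\in\mathfrak g$: $\mathrm{ad}_x\big((\delta\otimes\mathrm{id})(c)+\mathrm{c.p.}+[[c,c]]\big)=0$ and $\mathrm{ad}_x(c+c_{2,1})=0$. Here $\mathrm{ad}_x$ is the adjoint action extended to tensor powers, c.p. means adding the cyclic permutations of the tensor factors of the previous summand, and $[[r,s]]=[r_{12},s_{13}]+[r_{12},s_{23}]+[r_{13},s_{23}]$. The deformed Lie bialgebra is $\mathfrak g^{c}=(\mathfrak g;[\ ,\ ],\delta^{c})$ with $\delta^{c}(x)=\delta(x)-\mathrm{ad}_x(c)$.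
   Formalization: The antipode of the deformation is taken to be v^{-1} S(x) v instead of v S(x) v^{-1} (same v = sum S(f'_1) f'_2), since with coproduct F Delta(x) F^{-1} the formula as given is not an antipode in general. *)

(* Defs.v *)
From HB Require Import structures.
From mathcomp Require Import all_boot all_order all_algebra.
From mathcomp Require Import boolp classical_sets.

Set Implicit Arguments.
Unset Strict Implicit.
Unset Printing Implicit Defensive.

Import GRing.Theory.
Local Open Scope ring_scope.
Local Open Scope quotient_scope.

Notation bilinear_map f := (bilinear_for *:%R *:%R f).

(* The structure of an associative unital algebra on a module.  Unlike for
   [algType], the zero algebra is allowed: it may occur as a completion. *)
Record alg_struct (R : comNzRingType) (M : lmodType R) := AlgStruct {
  alg_one : M;
  alg_mul : M -> M -> M;
  alg_mulA : associative alg_mul;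
  alg_mul1 : left_id alg_one alg_mul;
  alg_1mul : right_id alg_one alg_mul;
  alg_bilinear : bilinear_map alg_mul
}.

Fact alg_mulDl (R : comNzRingType) (M : lmodType R) (sM : alg_struct M) :
  left_distributive (alg_mul sM) +%R.
Proof. by move=> x y z; have /= := (alg_bilinear sM).1 z 1 x y; rewrite !scale1r. Qed.
Fact alg_mulDr (R : comNzRingType) (M : lmodType R) (sM : alg_struct M) :
  right_distributive (alg_mul sM) +%R.
Proof. by move=> x y z; have /= := (alg_bilinear sM).2 x 1 y z; rewrite !scale1r. Qed.

Fact mul_bilinear (R : comNzRingType) (A : algType R) :
  bilinear_map (fun x y : A => x * y).
Proof.
split=> [z a x y|z a x y] /=; first by rewrite mulrDl scalerAl.
by rewrite mulrDr scalerAr.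
Qed.

Definition alg_of (R : comNzRingType) (A : algType R) : alg_struct A :=
  AlgStruct (@mulrA A) (@mul1r A) (@mulr1 A) (mul_bilinear A).

(* The two-sided inverse when it exists, [0] otherwise. *)
Definition ring_inv (A : pzRingType) (x : A) : A :=
  xget 0 [set y | x * y = 1 /\ y * x = 1].

(* The list [:: (m1, n1); ...; (mr, nr)] stands for the sum of the mi (x) ni.
   Two lists represent the same tensor iff no bilinear map separates them. *)

Section TensorProduct.
Variables (R : comNzRingType) (M N : lmodType R).
Implicit Types s : seq (M * N).

Definition tsum (P : nmodType) (f : M -> N -> P) s : P :=
  \sum_(p <- s) f p.1 p.2.

Definition tens_eq : rel (seq (M * N)) := fun s1 s2 =>
  `[< forall (P : lmodType R) (f : M -> N -> P),
        bilinear_map f -> tsum f s1 = tsum f s2 >].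

Fact tens_eq_refl : reflexive tens_eq.
Proof. by move=> s; apply/asboolP. Qed.

Fact tens_eq_sym : symmetric tens_eq.
Proof.
by move=> s t; apply/asboolP/asboolP => st P f bf; rewrite st.
Qed.

Fact tens_eq_trans : transitive tens_eq.
Proof.
move=> t s u /asboolP st /asboolP tu; apply/asboolP => P f bf.
by rewrite st // tu.
Qed.

Canonical tens_equiv := EquivRel tens_eq tens_eq_refl tens_eq_sym tens_eq_trans.

Definition tens := {eq_quot tens_eq}.
HB.instance Definition _ := Choice.on tens.
HB.instance Definition _ := EqQuotient.on tens.

Definition tpure (m : M) (n : N) : tens := \pi_tens [:: (m, n)].

(* For bilinear [f] with values in an R-module, [tlift f] is the linear map
   m (x) n |-> f m n. *)
Definition tlift (P : nmodType) (f : M -> N -> P) (t : tens) : P :=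
  tsum f (repr t).

Lemma tliftE (P : lmodType R) (f : M -> N -> P) s :
  bilinear_map f -> tlift f (\pi_tens s) = tsum f s.
Proof.
move=> bf; rewrite /tlift; have : repr (\pi_tens s) = s %[mod tens].
  by rewrite reprK.
by move=> /eqmodP /asboolP; apply.
Qed.

Lemma tens_ext (t u : tens) :
  (forall (P : lmodType R) (f : M -> N -> P), bilinear_map f ->
     tlift f t = tlift f u) -> t = u.
Proof.
move=> tu; rewrite -[t]reprK -[u]reprK; apply/eqmodP/asboolP => P f bf.
exact: tu.
Qed.

Definition tens_add (t u : tens) : tens := \pi_tens (repr t ++ repr u).
Definition tens_zero : tens := \pi_tens [::].
Definition tens_scale (a : R) (t : tens) : tens :=
  \pi_tens [seq (a *: p.1, p.2) | p <- repr t].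
Definition tens_opp (t : tens) : tens := tens_scale (-1) t.

Lemma tlift_add (P : lmodType R) (f : M -> N -> P) t u : bilinear_map f ->
  tlift f (tens_add t u) = tlift f t + tlift f u.
Proof. by move=> bf; rewrite tliftE // /tsum big_cat. Qed.

Lemma tlift_zero (P : lmodType R) (f : M -> N -> P) : bilinear_map f ->
  tlift f tens_zero = 0.
Proof. by move=> bf; rewrite tliftE // /tsum big_nil. Qed.

Lemma tlift_scale (P : lmodType R) (f : M -> N -> P) a t : bilinear_map f ->
  tlift f (tens_scale a t) = a *: tlift f t.
Proof.
move=> bf; rewrite tliftE // /tlift /tsum big_map scaler_sumr.
by apply: eq_bigr => p _ /=; rewrite (scalable_linear (bf.1 _)).
Qed.

Fact tens_addA : associative tens_add.
Proof. by move=> t u v; apply: tens_ext => P f bf; rewrite !tlift_add // addrA. Qed.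
Fact tens_addC : commutative tens_add.
Proof. by move=> t u; apply: tens_ext => P f bf; rewrite !tlift_add // addrC. Qed.
Fact tens_add0 : left_id tens_zero tens_add.
Proof.
by move=> t; apply: tens_ext => P f bf; rewrite tlift_add // tlift_zero // add0r.
Qed.
Fact tens_addN : left_inverse tens_zero tens_opp tens_add.
Proof.
move=> t; apply: tens_ext => P f bf.
by rewrite tlift_add // tlift_scale // tlift_zero // scaleN1r addNr.
Qed.

HB.instance Definition _ :=
  GRing.isZmodule.Build tens tens_addA tens_addC tens_add0 tens_addN.

Fact tens_scaleA a b t : tens_scale a (tens_scale b t) = tens_scale (a * b) t.
Proof. by apply: tens_ext => P f bf; rewrite !tlift_scale // scalerA. Qed.
Fact tens_scale1 : left_id 1 tens_scale.
Proof. by move=> t; apply: tens_ext => P f bf; rewrite tlift_scale // scale1r. Qed.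
Fact tens_scaleDr : right_distributive tens_scale +%R.
Proof.
move=> a t u; apply: tens_ext => P f bf.
by rewrite !(tlift_scale, tlift_add) // scalerDr.
Qed.
Fact tens_scaleDl t : {morph tens_scale^~ t : a b / a + b}.
Proof.
move=> a b; apply: tens_ext => P f bf.
by rewrite !(tlift_scale, tlift_add) // scalerDl.
Qed.

HB.instance Definition _ := GRing.Zmodule_isLmodule.Build R tens
  tens_scaleA tens_scale1 tens_scaleDr tens_scaleDl.

Lemma tlift_is_linear (P : lmodType R) (f : M -> N -> P) :
  bilinear_map f -> linear (tlift f).
Proof. by move=> bf a t u; rewrite tlift_add // tlift_scale. Qed.

Lemma tlift_pure (P : lmodType R) (f : M -> N -> P) m n :
  bilinear_map f -> tlift f (tpure m n) = f m n.
Proof. by move=> bf; rewrite tliftE // /tsum big_seq1. Qed.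

Lemma tpure_bilinear : bilinear_map tpure.
Proof.
split=> [n a m m'|m a n n']; apply: tens_ext => P f bf;
  rewrite tlift_add // tlift_scale // !tlift_pure //.
  exact: bf.1.
exact: bf.2.
Qed.

Lemma tens_pureE (t : tens) : t = \sum_(p <- repr t) tpure p.1 p.2.
Proof.
apply: tens_ext => P f bf; pose h := GRing.isLinear.Build R _ _ _ _ (tlift_is_linear bf).
pose g : {linear tens -> P} := HB.pack (tlift f) h.
rewrite -[RHS]/(g _) linear_sum /tlift /tsum.
by apply: eq_bigr => p _; rewrite /= tlift_pure.
Qed.

End TensorProduct.

Notation "x ⊗ y" := (tpure x y) (at level 40, left associativity).

Lemma tlift_bilinear_map (R : comNzRingType) (M N M' N' : lmodType R)
    (P : lmodType R) (f : M -> N -> M' -> N' -> P) (u : tens M' N') :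
  (forall m n, bilinear_map (f m n)) ->
  (forall m' n', bilinear_map (fun m n => f m n m' n')) ->
  bilinear_map (fun m n => tlift (f m n) u).
Proof.
move=> _ b2; split=> [n a m m'|m a n n'] /=;
  rewrite /tlift /tsum scaler_sumr -big_split /=; apply: eq_bigr => p _.
  exact: (b2 _ _).1.
exact: (b2 _ _).2.
Qed.

Section TensorAlgebra.
Variables (R : comNzRingType) (A B : lmodType R).
Variables (sA : alg_struct A) (sB : alg_struct B).
Local Notation T := (tens A B).
Local Notation "x *a y" := (alg_mul sA x y) (at level 40).
Local Notation "x *b y" := (alg_mul sB x y) (at level 40).

Definition tens_mul (t u : T) : T :=
  tlift (fun a b => tlift (fun a' b' => (a *a a') ⊗ (b *b b')) u) t.

Let mul_bil (P : lmodType R) (f : A -> B -> P) : bilinear_map f ->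
  (forall a b, bilinear_map (fun a' b' => f (a *a a') (b *b b'))) *
  (forall a' b', bilinear_map (fun a b => f (a *a a') (b *b b'))).
Proof.
move=> bf; split=> [a b|a' b']; split=> [y c x x'|x c y y'] /=.
- by rewrite (alg_bilinear sA).2; apply: bf.1.
- by rewrite (alg_bilinear sB).2; apply: bf.2.
- by rewrite (alg_bilinear sA).1; apply: bf.1.
- by rewrite (alg_bilinear sB).1; apply: bf.2.
Qed.

Let mulT := mul_bil (tpure_bilinear A B).

Lemma tlift_mul (P : lmodType R) (f : A -> B -> P) (t u : T) :
  bilinear_map f ->
  tlift f (tens_mul t u)
  = tlift (fun a b => tlift (fun a' b' => f (a *a a') (b *b b')) u) t.
Proof.
move=> bf; pose h := GRing.isLinear.Build R _ _ _ _ (tlift_is_linear bf).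
pose g : {linear T -> P} := HB.pack (tlift f) h.
rewrite -[LHS]/(g _) /tens_mul [in LHS]/tlift /tsum linear_sum /=.
rewrite [RHS]/tlift /tsum; apply: eq_bigr => p _.
rewrite -[LHS]/(g _) /tlift /tsum linear_sum /=.
by apply: eq_bigr => q _; rewrite tlift_pure.
Qed.

Definition tens_one : T := alg_one sA ⊗ alg_one sB.

Fact tens_mulA : associative tens_mul.
Proof.
move=> t u v; apply: tens_ext => P f bf; rewrite !tlift_mul //; last first.
  apply: tlift_bilinear_map => [a b|a' b'].
    exact: (mul_bil bf).1.
  exact: (mul_bil bf).2.
apply: eq_bigr => p _; rewrite tlift_mul; last exact: (mul_bil bf).1.
apply: eq_bigr => q _; apply: eq_bigr => r _.
by rewrite !alg_mulA.
Qed.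

Fact tens_mul1 : left_id tens_one tens_mul.
Proof.
move=> t; apply: tens_ext => P f bf; rewrite tlift_mul // tlift_pure.
  by apply: eq_bigr => p _; rewrite !alg_mul1.
apply: tlift_bilinear_map => [a b|a' b'].
  exact: (mul_bil bf).1.
exact: (mul_bil bf).2.
Qed.

Fact tens_1mul : right_id tens_one tens_mul.
Proof.
move=> t; apply: tens_ext => P f bf; rewrite tlift_mul //.
apply: eq_bigr => p _; rewrite tlift_pure; last exact: (mul_bil bf).1.
by rewrite !alg_1mul.
Qed.

Fact tens_mul_bilinear : bilinear_map tens_mul.
Proof.
split=> [u|t].
  apply: tlift_is_linear; apply: tlift_bilinear_map => [a b|a' b'].
    exact: mulT.1.
  exact: mulT.2.
move=> c u v /=; rewrite /tens_mul /tlift /tsum scaler_sumr -big_split /=.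
by apply: eq_bigr => p _; exact: (tlift_is_linear (mulT.1 p.1 p.2)).
Qed.

Definition tens_alg : alg_struct T :=
  AlgStruct tens_mulA tens_mul1 tens_1mul tens_mul_bilinear.
End TensorAlgebra.

Section TensorMaps.
Variable R : comNzRingType.

Definition tmap (M N M' N' : lmodType R) (f : M -> M') (g : N -> N') :
    tens M N -> tens M' N' :=
  tlift (fun m n => f m ⊗ g n).

Definition tflip (M : lmodType R) : tens M M -> tens M M :=
  tlift (fun m n => n ⊗ m).
End TensorMaps.

Section Lie.
Variables (K : comNzRingType) (g : lmodType K).
Implicit Types (br : g -> g -> g) (delta : g -> tens g g).

Local Notation g2 := (tens g g).
Local Notation g3 := (tens g (tens g g)).

Definition is_lie br : Prop :=
  [/\ bilinear_map br,
      forall x, br x x = 0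
    & forall x y z, br x (br y z) + br y (br z x) + br z (br x y) = 0].

Definition ad2 br (x : g) : g2 -> g2 :=
  tlift (fun a b => br x a ⊗ b + a ⊗ br x b).

Definition ad3 br (x : g) : g3 -> g3 :=
  tlift (fun a u => br x a ⊗ u + a ⊗ ad2 br x u).

(* a (x) (b (x) c) |-> b (x) (c (x) a) *)
Definition cyc3 : g3 -> g3 :=
  tlift (fun a => tlift (fun b c => b ⊗ (c ⊗ a))).

Definition plus_cp (t : g3) : g3 := t + cyc3 t + cyc3 (cyc3 t).

Definition delta_id delta : g2 -> g3 :=
  tlift (fun x y => tlift (fun a b => a ⊗ (b ⊗ y)) (delta x)).

(* [[r, s]] = [r12, s13] + [r12, s23] + [r13, s23] *)
Definition schouten br (r s : g2) : g3 :=
  tlift (fun a b => tlift (fun a' b' =>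
    br a a' ⊗ (b ⊗ b') + a ⊗ (br b a' ⊗ b') + a ⊗ (a' ⊗ br b b')) s) r.

Definition is_lie_bialg br delta : Prop :=
  [/\ is_lie br,
      linear delta,
      forall x, tflip (delta x) = - delta x,
      forall x, plus_cp (delta_id delta (delta x)) = 0
    & forall x y, delta (br x y) = ad2 br x (delta y) - ad2 br y (delta x)].

Definition is_lie_twist br delta (c : g2) : Prop := forall x,
  ad3 br x (plus_cp (delta_id delta c) + schouten br c c) = 0 /\
  ad2 br x (c + tflip c) = 0.

Definition delta_twist br delta (c : g2) : g -> g2 :=
  fun x => delta x - ad2 br x c.
End Lie.

(* The list [:: (a1, w1); ...; (ar, wr)] stands for the linear combination
   a1 w1 + ... + ar wr of words in [g].  Two lists represent the same element
   of U(g) iff no Lie algebra map from [g] to an associative algebra separates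
   them. *)

Section Envelope.
Variables (K : comNzRingType) (g : lmodType K) (br : g -> g -> g).
Local Notation words := (seq (K * seq g)).

Definition lie_to_alg (A : algType K) (f : g -> A) : Prop :=
  linear f /\ forall x y, f (br x y) = f x * f y - f y * f x.

Definition weval (A : algType K) (f : g -> A) (s : words) : A :=
  \sum_(p <- s) p.1 *: \prod_(x <- p.2) f x.

Definition uea_eq : rel words := fun s1 s2 =>
  `[< forall (A : algType K) (f : g -> A),
        lie_to_alg f -> weval f s1 = weval f s2 >].

Fact uea_eq_refl : reflexive uea_eq.
Proof. by move=> s; apply/asboolP. Qed.

Fact uea_eq_sym : symmetric uea_eq.
Proof. by move=> s t; apply/asboolP/asboolP => st A f lf; rewrite st. Qed.

Fact uea_eq_trans : transitive uea_eq.
Proof.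
move=> t s u /asboolP st /asboolP tu; apply/asboolP => A f lf.
by rewrite st // tu.
Qed.

Canonical uea_equiv := EquivRel uea_eq uea_eq_refl uea_eq_sym uea_eq_trans.

Definition uea := {eq_quot uea_eq}.
HB.instance Definition _ := Choice.on uea.
HB.instance Definition _ := EqQuotient.on uea.

(* For a Lie map [f], the algebra map U(g) -> A extending [f]. *)
Definition ulift (A : algType K) (f : g -> A) (u : uea) : A :=
  weval f (repr u).

Lemma uliftE (A : algType K) (f : g -> A) s :
  lie_to_alg f -> ulift f (\pi_uea s) = weval f s.
Proof.
move=> lf; rewrite /ulift; have : repr (\pi_uea s) = s %[mod uea].
  by rewrite reprK.
by move=> /eqmodP /asboolP; apply.
Qed.

Lemma uea_ext (u v : uea) :
  (forall (A : algType K) (f : g -> A), lie_to_alg f ->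
     ulift f u = ulift f v) -> u = v.
Proof.
move=> uv; rewrite -[u]reprK -[v]reprK; apply/eqmodP/asboolP => A f lf.
exact: uv.
Qed.

Definition uea_in (x : g) : uea := \pi_uea [:: (1, [:: x])].
Definition uea_zero : uea := \pi_uea [::].
Definition uea_one : uea := \pi_uea [:: (1, [::])].
Definition uea_add (u v : uea) : uea := \pi_uea (repr u ++ repr v).
Definition uea_scale (a : K) (u : uea) : uea :=
  \pi_uea [seq (a * p.1, p.2) | p <- repr u].
Definition uea_opp (u : uea) : uea := uea_scale (-1) u.
Definition uea_mul (u v : uea) : uea :=
  \pi_uea [seq (p.1 * q.1, p.2 ++ q.2) | p <- repr u, q <- repr v].

Section Lift.
Variables (A : algType K) (f : g -> A).
Hypothesis lf : lie_to_alg f.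

Lemma ulift_zero : ulift f uea_zero = 0.
Proof. by rewrite uliftE // /weval big_nil. Qed.
Lemma ulift_one : ulift f uea_one = 1.
Proof. by rewrite uliftE // /weval big_seq1 big_nil scale1r. Qed.
Lemma ulift_in x : ulift f (uea_in x) = f x.
Proof. by rewrite uliftE // /weval !big_seq1 scale1r. Qed.
Lemma ulift_add u v : ulift f (uea_add u v) = ulift f u + ulift f v.
Proof. by rewrite uliftE // /weval big_cat. Qed.
Lemma ulift_scale a u : ulift f (uea_scale a u) = a *: ulift f u.
Proof.
rewrite uliftE // /ulift /weval big_map scaler_sumr.
by apply: eq_bigr => p _; rewrite scalerA.
Qed.
Lemma ulift_mul u v : ulift f (uea_mul u v) = ulift f u * ulift f v.
Proof.
rewrite uliftE // /ulift /weval big_allpairs_dep /= mulr_suml.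
apply: eq_bigr => p _; rewrite mulr_sumr; apply: eq_bigr => q _.
by rewrite big_cat /= -scalerAl -scalerAr scalerA.
Qed.
End Lift.

Local Ltac uext := apply: uea_ext; let lf := fresh "lf" in intros ? ? lf;
  rewrite ?(ulift_add lf, ulift_scale lf, ulift_mul lf, ulift_zero lf, ulift_one lf).

Fact uea_addA : associative uea_add.
Proof. by move=> u v w; uext; rewrite addrA. Qed.
Fact uea_addC : commutative uea_add.
Proof. by move=> u v; uext; rewrite addrC. Qed.
Fact uea_add0 : left_id uea_zero uea_add.
Proof. by move=> u; uext; rewrite add0r. Qed.
Fact uea_addN : left_inverse uea_zero uea_opp uea_add.
Proof. by move=> u; uext; rewrite scaleN1r addNr. Qed.

HB.instance Definition _ :=
  GRing.isZmodule.Build uea uea_addA uea_addC uea_add0 uea_addN.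

Fact uea_mulA : associative uea_mul.
Proof. by move=> u v w; uext; rewrite mulrA. Qed.
Fact uea_mul1 : left_id uea_one uea_mul.
Proof. by move=> u; uext; rewrite mul1r. Qed.
Fact uea_1mul : right_id uea_one uea_mul.
Proof. by move=> u; uext; rewrite mulr1. Qed.
Fact uea_mulDl : left_distributive uea_mul +%R.
Proof. by move=> u v w; uext; rewrite mulrDl. Qed.
Fact uea_mulDr : right_distributive uea_mul +%R.
Proof. by move=> u v w; uext; rewrite mulrDr. Qed.

Fact uea_1_neq0 : uea_one != uea_zero.
Proof.
have lf : lie_to_alg (fun=> 0 : K^o).
  by split=> [a x y|x y]; rewrite /= ?scaler0 ?mulr0 ?subrr ?addr0.
apply/eqP => /(congr1 (ulift (fun=> 0 : K^o))) /eqP.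
by rewrite (ulift_one lf) (ulift_zero lf) oner_eq0.
Qed.

HB.instance Definition _ := GRing.Zmodule_isNzRing.Build uea
  uea_mulA uea_mul1 uea_1mul uea_mulDl uea_mulDr uea_1_neq0.

Fact uea_scaleA a b u : uea_scale a (uea_scale b u) = uea_scale (a * b) u.
Proof. by uext; rewrite scalerA. Qed.
Fact uea_scale1 : left_id 1 uea_scale.
Proof. by move=> u; uext; rewrite scale1r. Qed.
Fact uea_scaleDr : right_distributive uea_scale +%R.
Proof. by move=> a u v; uext; rewrite scalerDr. Qed.
Fact uea_scaleDl u : {morph uea_scale^~ u : a b / a + b}.
Proof. by move=> a b; uext; rewrite scalerDl. Qed.

HB.instance Definition _ := GRing.Zmodule_isLmodule.Build K uea
  uea_scaleA uea_scale1 uea_scaleDr uea_scaleDl.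

Fact uea_scalerAl (a : K) (u v : uea) : a *: (u * v) = (a *: u) * v.
Proof. by uext; rewrite scalerAl. Qed.
Fact uea_scalerAr (a : K) (u v : uea) : a *: (u * v) = u * (a *: v).
Proof. by uext; rewrite scalerAr. Qed.

HB.instance Definition _ := GRing.Lmodule_isLalgebra.Build K uea uea_scalerAl.
HB.instance Definition _ := GRing.Lalgebra_isAlgebra.Build K uea uea_scalerAr.

Lemma uea_in_lie : lie_to_alg uea_in.
Proof.
split=> [a x y|x y].
  by uext; rewrite !ulift_in // lf.1.
apply: uea_ext => A f lf.
rewrite (ulift_add lf) (ulift_scale lf) !(ulift_mul lf) !ulift_in // scaleN1r.
exact: lf.2.
Qed.

Definition uea_eps : uea -> K^o := ulift (fun=> 0).

(* A name of its own for the tensor square, to carry the algebra instance: a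
   tensor product of non-zero algebras may vanish, that of augmented ones does
   not. *)
Definition uea2 := tens uea uea.
HB.instance Definition _ := GRing.Lmodule.on uea2.

Let uea2_alg : alg_struct uea2 := tens_alg (alg_of uea) (alg_of uea).

Fact uea2_1_neq0 : alg_one uea2_alg != 0.
Proof.
have lf : lie_to_alg (fun=> 0 : K^o).
  by split=> [a x y|x y]; rewrite /= ?scaler0 ?mulr0 ?subrr ?addr0.
have bf : bilinear_map (fun u v : uea => uea_eps u * uea_eps v).
  split=> [v a u u'|u a v v'] /=; rewrite /uea_eps (ulift_add lf) (ulift_scale lf).
    exact: (mul_bilinear K^o).1.
  exact: (mul_bilinear K^o).2.
apply/eqP => /(congr1 (tlift (fun u v : uea => uea_eps u * uea_eps v))) /eqP.
rewrite (tlift_zero bf) tlift_pure // /uea_eps (ulift_one lf) mulr1.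
by rewrite oner_eq0.
Qed.

HB.instance Definition _ := GRing.Zmodule_isNzRing.Build uea2
  (alg_mulA uea2_alg) (alg_mul1 uea2_alg) (alg_1mul uea2_alg)
  (alg_mulDl uea2_alg) (alg_mulDr uea2_alg) uea2_1_neq0.

Fact uea2_scalerAl (a : K) (t u : uea2) : a *: (t * u) = (a *: t) * u.
Proof. exact/esym/(scalable_linear ((alg_bilinear uea2_alg).1 u)). Qed.
Fact uea2_scalerAr (a : K) (t u : uea2) : a *: (t * u) = t * (a *: u).
Proof. exact/esym/(scalable_linear ((alg_bilinear uea2_alg).2 t)). Qed.

HB.instance Definition _ := GRing.Lmodule_isLalgebra.Build K uea2 uea2_scalerAl.
HB.instance Definition _ := GRing.Lalgebra_isAlgebra.Build K uea2 uea2_scalerAr.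

Definition uea_cop : uea -> uea2 :=
  ulift (fun x => uea_in x ⊗ 1 + 1 ⊗ uea_in x : uea2).
Definition uea_antip (u : uea) : uea :=
  \sum_(p <- repr u) p.1 *: \prod_(x <- rev p.2) (- uea_in x).
End Envelope.

Section PowerSeries.
Variable K : comNzRingType.

Definition fscale (V : lmodType K) (a : nat -> K) (v : nat -> V) : nat -> V :=
  fun n => \sum_(i < n.+1) a i *: v (n - i)%N.

Lemma fscale_rev (V : lmodType K) (a : nat -> K) (v : nat -> V) n :
  fscale a v n = \sum_(i < n.+1) a (n - i)%N *: v i.
Proof.
rewrite /fscale (reindex_inj rev_ord_inj) /=; apply: eq_bigr => i _.
by rewrite subSS subKn -1?ltnS.
Qed.

Lemma fscaleA (V : lmodType K) (a b : nat -> K) (v : nat -> V) :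
  fscale a (fscale b v) = fscale (fscale (V := K^o) a b) v.
Proof.
apply/funext => n; rewrite [RHS]fscale_rev /fscale.
pose c3 j k := a j *: (b (n - j - k)%N *: v k).
transitivity (\sum_(j < n.+1) \sum_(k < n.+1 | (k <= n - j)%N) c3 j k).
  apply: eq_bigr => /= j _; rewrite -/(fscale b v _) fscale_rev scaler_sumr.
  by rewrite (big_ord_narrow_leq (leq_subr _ _)).
rewrite (exchange_big_dep predT) //=; apply: eq_bigr => k _.
transitivity (\sum_(j < n.+1 | (j <= n - k)%N) c3 j k).
  apply: eq_bigl => j; rewrite -ltnS -(ltnS j) -!subSn ?leq_ord //.
  by rewrite -subn_gt0 -(subn_gt0 j) -!subnDA addnC.
rewrite (big_ord_narrow_leq (leq_subr _ _)) scaler_suml.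
by apply: eq_bigr => j _; rewrite /c3 -!subnDA addnC scalerA.
Qed.

Definition fps : Type := nat -> K.
HB.instance Definition _ := gen_eqMixin fps.
HB.instance Definition _ := gen_choiceMixin fps.

Definition fpsC (c : K) : fps := fun n => if n is 0%N then c else 0.
Definition hbar : fps := fun n => (n == 1%N)%:R.

Definition fps_add (a b : fps) : fps := fun n => a n + b n.
Definition fps_opp (a : fps) : fps := fun n => - a n.
Definition fps_mul (a b : fps) : fps := fscale (V := K^o) a b.

Fact fps_addA : associative fps_add.
Proof. by move=> a b c; apply/funext => n; apply: addrA. Qed.
Fact fps_addC : commutative fps_add.
Proof. by move=> a b; apply/funext => n; apply: addrC. Qed.
Fact fps_add0 : left_id (fpsC 0) fps_add.
Proof. by move=> a; apply/funext => -[|n]; apply: add0r. Qed.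
Fact fps_addN : left_inverse (fpsC 0) fps_opp fps_add.
Proof. by move=> a; apply/funext => -[|n]; apply: addNr. Qed.

HB.instance Definition _ :=
  GRing.isZmodule.Build fps fps_addA fps_addC fps_add0 fps_addN.

Lemma fscale1 (V : lmodType K) (v : nat -> V) : fscale (fpsC 1) v = v.
Proof.
apply/funext => n; rewrite /fscale big_ord_recl /= subn0 scale1r big1 ?addr0 //.
by move=> i _; rewrite scale0r.
Qed.

Fact fps_mulA : associative fps_mul.
Proof. by move=> a b c; exact: (fscaleA (V := K^o) a b c). Qed.
Fact fps_mulC : commutative fps_mul.
Proof.
move=> a b; apply/funext => n; rewrite /fps_mul /fscale.
rewrite (reindex_inj rev_ord_inj) /=; apply: eq_bigr => i _.
by rewrite subSS subKn -1?ltnS // [LHS]mulrC.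
Qed.
Fact fps_mul1 : left_id (fpsC 1) fps_mul.
Proof. by move=> a; exact: (fscale1 (V := K^o) a). Qed.
Fact fps_mulDl : left_distributive fps_mul +%R.
Proof.
move=> a b c; apply/funext => n; rewrite [RHS]/GRing.add /= /fps_add.
rewrite /fps_mul /fscale -big_split /=; apply: eq_bigr => i _.
exact: mulrDl.
Qed.
Fact fps_1_neq0 : fpsC 1 != fpsC 0.
Proof. by apply/eqP => /(congr1 (fun f => f 0%N)) /eqP; rewrite /= oner_eq0. Qed.

HB.instance Definition _ := GRing.Zmodule_isComNzRing.Build fps
  fps_mulA fps_mulC fps_mul1 fps_mulDl fps_1_neq0.

Section SeriesModule.
Variable V : lmodType K.

Definition vps : Type := nat -> V.
HB.instance Definition _ := gen_eqMixin vps.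
HB.instance Definition _ := gen_choiceMixin vps.

Definition vps_add (v w : vps) : vps := fun n => v n + w n.
Definition vps_opp (v : vps) : vps := fun n => - v n.
Definition vps_zero : vps := fun=> 0.
Definition vps_scale (a : fps) (v : vps) : vps := fscale a v.

Fact vps_addA : associative vps_add.
Proof. by move=> a b c; apply/funext => n; apply: addrA. Qed.
Fact vps_addC : commutative vps_add.
Proof. by move=> a b; apply/funext => n; apply: addrC. Qed.
Fact vps_add0 : left_id vps_zero vps_add.
Proof. by move=> a; apply/funext => n; apply: add0r. Qed.
Fact vps_addN : left_inverse vps_zero vps_opp vps_add.
Proof. by move=> a; apply/funext => n; apply: addNr. Qed.

HB.instance Definition _ :=
  GRing.isZmodule.Build vps vps_addA vps_addC vps_add0 vps_addN.

Fact vps_scaleA a b v : vps_scale a (vps_scale b v) = vps_scale (a * b) v.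
Proof. exact: fscaleA. Qed.
Fact vps_scale1 : left_id 1 vps_scale.
Proof. by move=> v; apply: fscale1. Qed.
Fact vps_scaleDr : right_distributive vps_scale +%R.
Proof.
move=> a v w; apply/funext => n; rewrite [RHS]/GRing.add /= /vps_add.
rewrite /vps_scale /fscale -big_split /=; apply: eq_bigr => i _.
exact: scalerDr.
Qed.
Fact vps_scaleDl v : {morph vps_scale^~ v : a b / a + b}.
Proof.
move=> a b; apply/funext => n; rewrite [RHS]/GRing.add /= /vps_add.
rewrite /vps_scale /fscale -big_split /=; apply: eq_bigr => i _.
exact: scalerDl.
Qed.

HB.instance Definition _ := GRing.Zmodule_isLmodule.Build fps vps
  vps_scaleA vps_scale1 vps_scaleDr vps_scaleDl.
End SeriesModule.
End PowerSeries.
Arguments hbar {K}.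

(* Linear maps over K[[hbar]] are automatically continuous for the hbar-adic
   topologies, so no topology needs to be carried along. *)
Definition top_free (K : comNzRingType) (M : lmodType (fps K)) : Prop :=
  exists (V : lmodType K) (f : M -> vps V), linear f /\ bijective f.

Section HbarAdic.
Variables (K : comNzRingType) (M : lmodType (fps K)).

Definition hcong (n : nat) (x y : M) : Prop := exists z, x - y = hbar ^+ n *: z.

Lemma hcong_refl n x : hcong n x x.
Proof. by exists 0; rewrite subrr scaler0. Qed.
Lemma hcong_sym n x y : hcong n x y -> hcong n y x.
Proof. by case=> z xy; exists (- z); rewrite scalerN -xy opprB. Qed.
Lemma hcong_trans n x y z : hcong n x y -> hcong n y z -> hcong n x z.
Proof.
by case=> u xy [v yz]; exists (u + v); rewrite scalerDr -xy -yz addrA subrK.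
Qed.
Lemma hcong_eq n x x' y y' :
  hcong n x x' -> hcong n y y' -> x' = y' -> hcong n x y.
Proof.
by move=> xx yy e; apply: hcong_trans xx _; rewrite e; apply: hcong_sym.
Qed.
Lemma hcongD n x x' y y' :
  hcong n x x' -> hcong n y y' -> hcong n (x + y) (x' + y').
Proof.
by case=> u xx [v yy]; exists (u + v); rewrite scalerDr -xx -yy opprD addrACA.
Qed.
Lemma hcongZ n a x x' : hcong n x x' -> hcong n (a *: x) (a *: x').
Proof.
by case=> u xx; exists (a *: u); rewrite -scalerBr xx !scalerA mulrC.
Qed.
Lemma hcong_le m n x y : (m <= n)%N -> hcong n x y -> hcong m x y.
Proof.
move=> mn [z xy]; exists (hbar ^+ (n - m) *: z).
by rewrite xy scalerA -exprD subnKC.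
Qed.

(* [s] is the sum of the series of the [u i] in the hbar-adic topology. *)
Definition has_hsum (u : nat -> M) (s : M) : Prop :=
  forall n, exists N, forall m, (N <= m)%N -> hcong n (\sum_(i < m) u i) s.

Definition hsum (u : nat -> M) : M := xget 0 [set s | has_hsum u s].

(* Division by hbar: unique, when possible, on topologically free modules. *)
Definition hbar_div (x : M) : M := xget 0 [set y | hbar *: y = x].
End HbarAdic.

(* [hcompl T] is the inverse limit of the T / hbar^n T; an element is
   represented by a sequence of elements of [T] whose n-th term is only
   meaningful modulo hbar^n. *)
Section Completion.
Variables (K : comNzRingType) (T : lmodType (fps K)).

Definition coherent (x : nat -> T) : Prop := forall n, hcong n (x n.+1) (x n).

Record hseq := HSeq { hterm :> nat -> T; hseq_coherent : coherent hterm }.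
HB.instance Definition _ := gen_eqMixin hseq.
HB.instance Definition _ := gen_choiceMixin hseq.

Definition hseq_eq : rel hseq := fun x y => `[< forall n, hcong n (x n) (y n) >].

Fact hseq_eq_refl : reflexive hseq_eq.
Proof. by move=> x; apply/asboolP => n; apply: hcong_refl. Qed.
Fact hseq_eq_sym : symmetric hseq_eq.
Proof.
by move=> x y; apply/asboolP/asboolP => xy n; apply/hcong_sym/xy.
Qed.
Fact hseq_eq_trans : transitive hseq_eq.
Proof.
move=> y x z /asboolP xy /asboolP yz; apply/asboolP => n.
exact: hcong_trans (xy n) (yz n).
Qed.

Canonical hseq_equiv := EquivRel hseq_eq hseq_eq_refl hseq_eq_sym hseq_eq_trans.

Definition hcompl := {eq_quot hseq_eq}.
HB.instance Definition _ := Choice.on hcompl.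
HB.instance Definition _ := EqQuotient.on hcompl.

(* A representative in [T] of [x] modulo hbar^n. *)
Definition happrox (x : hcompl) (n : nat) : T := repr x n.

Lemma happrox_coherent x : coherent (happrox x).
Proof. exact: hseq_coherent. Qed.

Lemma hseq_cst_coherent (t : T) : coherent (fun=> t).
Proof. by move=> n; apply: hcong_refl. Qed.

Definition hin (t : T) : hcompl := \pi_hcompl (HSeq (hseq_cst_coherent t)).

(* The element with n-th approximation [s n]; junk if [s] is not coherent. *)
Definition hmk (s : nat -> T) : hcompl :=
  if pselect (coherent s) is left cs then \pi_hcompl (HSeq cs) else hin 0.

Lemma happrox_pi (s : hseq) n : hcong n (happrox (\pi_hcompl s) n) (s n).
Proof.
have : repr (\pi_hcompl s) = s %[mod hcompl] by rewrite reprK.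
by move=> /eqmodP /asboolP; apply.
Qed.

Lemma happrox_mk (s : nat -> T) n :
  coherent s -> hcong n (happrox (hmk s) n) (s n).
Proof.
by rewrite /hmk; case: pselect => // cs _; apply: (happrox_pi (HSeq cs)).
Qed.

Lemma happrox_in t n : hcong n (happrox (hin t) n) t.
Proof. exact: happrox_pi. Qed.

Lemma hcompl_ext (x y : hcompl) :
  (forall n, hcong n (happrox x n) (happrox y n)) -> x = y.
Proof. by move=> xy; rewrite -[x]reprK -[y]reprK; apply/eqmodP/asboolP. Qed.

Definition hcompl_add (x y : hcompl) := hmk (fun n => happrox x n + happrox y n).
Definition hcompl_scale (a : fps K) (x : hcompl) :=
  hmk (fun n => a *: happrox x n).
Definition hcompl_opp (x : hcompl) := hcompl_scale (-1) x.

Lemma happrox_add x y n :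
  hcong n (happrox (hcompl_add x y) n) (happrox x n + happrox y n).
Proof.
apply: happrox_mk => m; exact: hcongD (happrox_coherent x m) (happrox_coherent y m).
Qed.

Lemma happrox_scale a x n :
  hcong n (happrox (hcompl_scale a x) n) (a *: happrox x n).
Proof. apply: happrox_mk => m; exact: hcongZ (happrox_coherent x m). Qed.

Fact hcompl_addA : associative hcompl_add.
Proof.
move=> x y z; apply: hcompl_ext => n; apply: hcong_eq.
- by apply: hcong_trans (happrox_add _ _ _) (hcongD (hcong_refl _ _) (happrox_add _ _ _)).
- by apply: hcong_trans (happrox_add _ _ _) (hcongD (happrox_add _ _ _) (hcong_refl _ _)).
- exact: addrA.
Qed.
Fact hcompl_addC : commutative hcompl_add.
Proof.
move=> x y; apply: hcompl_ext => n.
by apply: hcong_eq (happrox_add _ _ _) (happrox_add _ _ _) _; apply: addrC.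
Qed.
Fact hcompl_add0 : left_id (hin 0) hcompl_add.
Proof.
move=> x; apply: hcompl_ext => n; apply: hcong_trans (happrox_add _ _ _) _.
have := hcongD (happrox_in (0 : T) n) (hcong_refl n (happrox x n)).
by rewrite add0r.
Qed.
Fact hcompl_addN : left_inverse (hin 0) hcompl_opp hcompl_add.
Proof.
move=> x; apply: hcompl_ext => n; apply: hcong_eq (happrox_in _ _) _.
  apply: hcong_trans (happrox_add _ _ _) _.
  exact: hcongD (happrox_scale _ _ _) (hcong_refl _ _).
by rewrite scaleN1r addNr.
Qed.

HB.instance Definition _ :=
  GRing.isZmodule.Build hcompl hcompl_addA hcompl_addC hcompl_add0 hcompl_addN.

Fact hcompl_scaleA a b x :
  hcompl_scale a (hcompl_scale b x) = hcompl_scale (a * b) x.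
Proof.
apply: hcompl_ext => n; apply: hcong_eq (happrox_scale _ _ _) _.
  by apply: hcong_trans (happrox_scale _ _ _) (hcongZ _ (happrox_scale _ _ _)).
exact: scalerA.
Qed.
Fact hcompl_scale1 : left_id 1 hcompl_scale.
Proof.
move=> x; apply: hcompl_ext => n.
by have := happrox_scale 1 x n; rewrite scale1r.
Qed.
Fact hcompl_scaleDr : right_distributive hcompl_scale +%R.
Proof.
move=> a x y; apply: hcompl_ext => n; apply: hcong_eq.
- by apply: hcong_trans (happrox_scale _ _ _) (hcongZ _ (happrox_add _ _ _)).
- apply: hcong_trans (happrox_add _ _ _) _.
  exact: hcongD (happrox_scale _ _ _) (happrox_scale _ _ _).
- exact: scalerDr.
Qed.
Fact hcompl_scaleDl x : {morph hcompl_scale^~ x : a b / a + b}.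
Proof.
move=> a b /=; apply: hcompl_ext => n; apply: hcong_eq.
- exact: happrox_scale.
- apply: hcong_trans (happrox_add _ _ _) _.
  exact: hcongD (happrox_scale _ _ _) (happrox_scale _ _ _).
- exact: scalerDl.
Qed.

HB.instance Definition _ := GRing.Zmodule_isLmodule.Build (fps K) hcompl
  hcompl_scaleA hcompl_scale1 hcompl_scaleDr hcompl_scaleDl.

(* The inverse of [hin], for complete and separated [T]. *)
Definition hout (x : hcompl) : T := xget 0 [set t | hin t = x].
End Completion.

Section CompletedAlgebra.
Variables (K : comNzRingType) (A : lmodType (fps K)) (sA : alg_struct A).
Local Notation C := (hcompl A).
Local Notation "x *a y" := (alg_mul sA x y) (at level 40).

Let hcongM n (x x' y y' : A) :
  hcong n x x' -> hcong n y y' -> hcong n (x *a y) (x' *a y').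
Proof.
have [bl br] := alg_bilinear sA.
case=> u xx [v yy]; apply: (@hcong_trans _ _ _ _ (x' *a y)).
  exists (u *a y); have -> : x = hbar ^+ n *: u + x' by rewrite -xx subrK.
  by rewrite bl addrK.
exists (x' *a v); have -> : y = hbar ^+ n *: v + y' by rewrite -yy subrK.
by rewrite br addrK.
Qed.

Definition hcompl_mul (x y : C) : C :=
  hmk (fun n => happrox x n *a happrox y n).

Lemma happrox_mul x y n :
  hcong n (happrox (hcompl_mul x y) n) (happrox x n *a happrox y n).
Proof.
apply: happrox_mk => m; exact: hcongM (happrox_coherent x m) (happrox_coherent y m).
Qed.

Fact hcompl_mulA : associative hcompl_mul.
Proof.
move=> x y z; apply: hcompl_ext => n; apply: hcong_eq.
- by apply: hcong_trans (happrox_mul _ _ _) (hcongM (hcong_refl _ _) (happrox_mul _ _ _)).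
- by apply: hcong_trans (happrox_mul _ _ _) (hcongM (happrox_mul _ _ _) (hcong_refl _ _)).
- exact: alg_mulA.
Qed.
Fact hcompl_mul1 : left_id (hin (alg_one sA)) hcompl_mul.
Proof.
move=> x; apply: hcompl_ext => n; apply: hcong_trans (happrox_mul _ _ _) _.
have := hcongM (happrox_in (alg_one sA) n) (hcong_refl n (happrox x n)).
by rewrite alg_mul1.
Qed.
Fact hcompl_1mul : right_id (hin (alg_one sA)) hcompl_mul.
Proof.
move=> x; apply: hcompl_ext => n; apply: hcong_trans (happrox_mul _ _ _) _.
have := hcongM (hcong_refl n (happrox x n)) (happrox_in (alg_one sA) n).
by rewrite alg_1mul.
Qed.
Fact hcompl_mul_bilinear : bilinear_map hcompl_mul.
Proof.
have [bl br] := alg_bilinear sA.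
split=> [z a x y|z a x y] /=; apply: hcompl_ext => n.
  apply: (hcong_eq _ _ (bl (happrox z n) a (happrox x n) (happrox y n))).
    apply: hcong_trans (happrox_mul _ _ _) (hcongM _ (hcong_refl _ _)).
    apply: hcong_trans (happrox_add _ _ _) (hcongD _ (hcong_refl _ _)).
    exact: happrox_scale.
  apply: hcong_trans (happrox_add _ _ _) (hcongD _ (happrox_mul _ _ _)).
  exact: hcong_trans (happrox_scale _ _ _) (hcongZ _ (happrox_mul _ _ _)).
apply: (hcong_eq _ _ (br (happrox z n) a (happrox x n) (happrox y n))).
  apply: hcong_trans (happrox_mul _ _ _) (hcongM (hcong_refl _ _) _).
  apply: hcong_trans (happrox_add _ _ _) (hcongD _ (hcong_refl _ _)).
  exact: happrox_scale.
apply: hcong_trans (happrox_add _ _ _) (hcongD _ (happrox_mul _ _ _)).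
exact: hcong_trans (happrox_scale _ _ _) (hcongZ _ (happrox_mul _ _ _)).
Qed.

Definition hcompl_alg : alg_struct C :=
  AlgStruct hcompl_mulA hcompl_mul1 hcompl_1mul hcompl_mul_bilinear.
End CompletedAlgebra.

(* The linear extension to completions of a linear map T -> hcompl P: the n-th
   approximation of the image of [x] is that of [f t], where [t] is the n-th
   approximation of [x]. *)
Definition hext (K : comNzRingType) (T P : lmodType (fps K))
    (f : T -> hcompl P) (x : hcompl T) : hcompl P :=
  hmk (fun n => happrox (f (happrox x n)) n).

(* For bilinear [f], the continuous linear map m (x) n |-> f m n. *)
Definition clift (K : comNzRingType) (M N P : lmodType (fps K))
    (f : M -> N -> hcompl P) : hcompl (tens M N) -> hcompl P :=
  hext (tlift f).

Lemma clift_pure (K : comNzRingType) (M N P : lmodType (fps K))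
    (f : M -> N -> hcompl P) m n :
  bilinear_map f -> clift f (hin (m ⊗ n)) = f m n.
Proof.
move=> bf; have lf := tlift_is_linear bf.
have cong i t u : hcong i t u -> hcong i (happrox (tlift f t) i) (happrox (tlift f u) i).
  case=> z tu; have -> : t = hbar ^+ i *: z + u by rewrite -tu subrK.
  rewrite lf; apply: hcong_trans (happrox_add _ _ _) _.
  apply: hcong_trans (hcongD (happrox_scale _ _ _) (hcong_refl _ _)) _.
  by exists (happrox (tlift f z) i); rewrite addrK.
apply: hcompl_ext => i; rewrite /clift /hext.
apply: hcong_trans (happrox_mk _ _) _ => [j|]; last first.
  by rewrite -(tlift_pure m n bf); apply/cong/happrox_in.
apply: hcong_trans (happrox_coherent _ j) _.
exact: cong (happrox_coherent _ j).
Qed.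

Section CompletedTensorPowers.
Variables (K : comNzRingType) (U : algType (fps K)).

Definition ctens2 := hcompl (tens U U).
Definition ctens3 := hcompl (tens U (tens U U)).
HB.instance Definition _ := GRing.Lmodule.on ctens2.
HB.instance Definition _ := GRing.Lmodule.on ctens3.

Let alg2 := tens_alg (alg_of U) (alg_of U).
Let alg3 := tens_alg (alg_of U) alg2.
Let calg2 : alg_struct ctens2 := hcompl_alg alg2.
Let calg3 : alg_struct ctens3 := hcompl_alg alg3.


HB.instance Definition _ := GRing.Zmodule_isPzRing.Build ctens2
  (alg_mulA calg2) (alg_mul1 calg2) (alg_1mul calg2) (alg_mulDl calg2) (alg_mulDr calg2).
HB.instance Definition _ := GRing.Zmodule_isPzRing.Build ctens3
  (alg_mulA calg3) (alg_mul1 calg3) (alg_1mul calg3) (alg_mulDl calg3) (alg_mulDr calg3).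

Lemma ctens2_mul_bilinear : bilinear_map (fun x y : ctens2 => x * y).
Proof. exact: (alg_bilinear calg2). Qed.
Lemma ctens3_mul_bilinear : bilinear_map (fun x y : ctens3 => x * y).
Proof. exact: (alg_bilinear calg3). Qed.
End CompletedTensorPowers.

Section ExpLog.
Variables (k : fieldType) (U : algType (fps k)).

Definition log_term (x : ctens2 U) (n : nat) : ctens2 U :=
  fpsC ((-1) ^+ n / n.+1%:R) *: (x - 1) ^+ n.+1.
Definition hlog (x : ctens2 U) : ctens2 U := hsum (log_term x).

Definition exp_term (x : ctens2 U) (n : nat) : ctens2 U :=
  fpsC (n`!%:R^-1) *: x ^+ n.
End ExpLog.

Section TopHopf.
Variables (K : comNzRingType) (U : algType (fps K)).

Record hopf_ops := HopfOps {
  cop : U -> ctens2 U;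
  eps : U -> fps K;
  antip : U -> U
}.
Variable H : hopf_ops.

Definition cflip : ctens2 U -> ctens2 U := clift (fun x y => hin (y ⊗ x)).
Definition leg12 : ctens2 U -> ctens3 U := clift (fun x y => hin (x ⊗ (y ⊗ 1))).
Definition leg23 : ctens2 U -> ctens3 U := clift (fun x y => hin (1 ⊗ (x ⊗ y))).

Definition cop_id : ctens2 U -> ctens3 U :=
  clift (fun x y => clift (fun a b => hin (a ⊗ (b ⊗ y))) (cop H x)).
Definition id_cop : ctens2 U -> ctens3 U :=
  clift (fun x y => clift (fun a b => hin (x ⊗ (a ⊗ b))) (cop H y)).

(* The next maps take values in the completion of [U], which is [U] itself (via
   [hin]) when [U] is topologically free. *)
Definition eps_id : ctens2 U -> hcompl U := clift (fun x y => hin (eps H x *: y)).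
Definition id_eps : ctens2 U -> hcompl U := clift (fun x y => hin (eps H y *: x)).
Definition mul_antip_id : ctens2 U -> hcompl U :=
  clift (fun x y => hin (antip H x * y)).
Definition mul_id_antip : ctens2 U -> hcompl U :=
  clift (fun x y => hin (x * antip H y)).

Definition is_top_hopf : Prop :=
  [/\ (linear (cop H) /\ monoid_morphism (cop H)),
      (linear (eps H : U -> (fps K)^o) /\ monoid_morphism (eps H)),
      (forall x, cop_id (cop H x) = id_cop (cop H x)),
      (forall x, eps_id (cop H x) = hin x /\ id_eps (cop H x) = hin x)
    & linear (antip H) /\
      forall x, mul_antip_id (cop H x) = hin (eps H x *: 1) /\
                mul_id_antip (cop H x) = hin (eps H x *: 1)].

Definition is_hopf_twist (F : ctens2 U) : Prop :=
  [/\ exists G, F * G = 1 /\ G * F = 1,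
      eps_id F = hin 1,
      id_eps F = hin 1
    & leg12 F * cop_id F = leg23 F * id_cop F].

(* With v = sum S(f'_1) f'_2 for F^-1 = sum f'_1 (x) f'_2, the antipode of the
   twist by the coproduct F Delta(-) F^-1 is v^-1 S(-) v; equivalently it is
   w S(-) w^-1 for w = v^-1 = sum F_1 S(F_2). *)
Definition twist_elt (F : ctens2 U) : U := hout (mul_antip_id (ring_inv F)).

Definition twist_hopf (F : ctens2 U) : hopf_ops := {|
  cop := fun x => F * cop H x * ring_inv F;
  eps := eps H;
  antip := fun x => ring_inv (twist_elt F) * antip H x * twist_elt F
|}.
End TopHopf.

Section Quea.
Variables (K : comNzRingType) (U : algType (fps K)).
Variables (g : lmodType K) (br : g -> g -> g).
Implicit Types (H : hopf_ops U) (p : U -> uea br).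

(* [p (x) p], for [p] with kernel hbar U: the reduction modulo hbar
   U (x)^ U -> U(g) (x) U(g). *)
Definition red2 p (t : ctens2 U) : tens (uea br) (uea br) :=
  tlift (fun x y => p x ⊗ p y) (happrox t 1).

(* An isomorphism of Hopf algebras U / hbar U -> U(g), given as its composite
   [p] with the projection of U onto U / hbar U. *)
Definition is_hopf_reduction H p : Prop :=
  [/\ (forall a x y, p (a *: x + y) = a 0%N *: p x + p y) /\ monoid_morphism p,
      (forall u, exists x, p x = u) /\
      (forall x, p x = 0 <-> exists y, x = hbar *: y),
      forall x, red2 p (cop H x) = uea_cop (p x),
      forall x, eps H x 0%N = uea_eps (p x)
    & forall x, p (antip H x) = uea_antip (p x)].

Definition is_quea H p : Prop :=
  [/\ is_lie br, is_top_hopf H, top_free U & is_hopf_reduction H p].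

(* Delta(x') - Delta^op(x') = hbar y with y = delta(x) modulo hbar, for every
   lift x' of x. *)
Definition is_quea_over H (delta : g -> tens g g) p : Prop :=
  [/\ is_quea H p,
      is_lie_bialg br delta
    & forall x x', p x' = uea_in br x ->
        exists2 y, cop H x' - cflip (cop H x') = hbar *: y
                 & red2 p y = tmap (uea_in br) (uea_in br) (delta x)].
End Quea.

(* Main.v *)
(** Write F = 1 + hbar f, so that kappa = f modulo hbar.

    Modulo hbar, the twist equation says that K = f mod hbar is a 2-cocycle of
    the cocommutative coalgebra U(g), whence t = K - K_21 is antisymmetric and
    primitive in each factor.  In characteristic zero t lies in g (x) g: U(g) is
    spanned by the powers of the elements of g, and interpolation in the second
    Adams operation projects onto the primitive elements while mapping U(g) to g.

    Alternating the full twist equation turns its part linear in f into hbar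
    times (delta_h (x) id)(f - f_21), where hbar delta_h = Delta - Delta^op, and
    its quadratic part into hbar times a lift of [[t, t]]; dividing by hbar gives
    (delta (x) id)(c) + c.p. + [[c, c]] = 0.

    Finally F Delta(x) F^-1 = Delta(x) + hbar (f Delta(x) - Delta(x) f) F^-1,
    which reduces to delta(x) - ad_x(c).  Its co-Jacobi identity is the one that
    Delta - Delta^op satisfies for any coassociative Delta, divided by hbar^2.

    Identities descend from the tensor powers of U(g) to those of g since g is a
    direct summand of U(g): U(g) acts by left-invariant vector fields on the
    formal group of g, written in exponential coordinates.  Divisions by hbar are
    legitimate since the completed tensor powers of U_hbar are torsion free. *)

Require Import Defs.
From HB Require Import structures.
From mathcomp Require Import all_boot all_order all_algebra.
From mathcomp Require Import boolp classical_sets.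
From mathcomp Require Import ring.

Set Implicit Arguments.
Unset Strict Implicit.
Unset Printing Implicit Defensive.

Import GRing.Theory.
Local Open Scope ring_scope.

(** * Identities in abelian groups, by reflection *)

(** Topological freeness presents U_hbar as some V[[hbar]], whereas the theorem speaks of its
    reduction U(g). The notion [hfree] links the two, and it passes to algebraic tensor products,
    which need not be topologically free. Elements of completions are not finite sums: linear maps
    are compared on pure tensors, by density when the target is separated, and modulo hbar
    otherwise. The cobracket is given on g only, while delta_h acts on U_hbar; it is therefore
    reduced to a map on all of U(g), which restricts to delta. The exponential and the logarithm
    involve powers of one element only. Modulo hbar^n they are values of polynomials, and the
    polynomial identities follow from differential equations. Part (a) then amounts to the
    injectivity of exp and to exp(-x) = exp(x)^-1. For the antipode of the twist, S conjugated by v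
    satisfies the left axiom and S conjugated by w = sum F_1 S(F_2) the right one; they agree
    because a left and a right convolution inverse of the identity coincide. Both axioms rest on the
    antimultiplicativity of S, itself obtained by convolution. *)

Inductive zexpr := ZVar of nat | ZZero | ZAdd of zexpr & zexpr | ZOpp of zexpr.

Fixpoint zeval (V : zmodType) (env : seq V) e : V :=
  match e with
  | ZVar i => nth 0 env i
  | ZZero => 0
  | ZAdd e1 e2 => zeval env e1 + zeval env e2
  | ZOpp e1 => - zeval env e1
  end.

Fixpoint zcoef (i : nat) e : int :=
  match e with
  | ZVar j => (i == j)%:R
  | ZZero => 0
  | ZAdd e1 e2 => zcoef i e1 + zcoef i e2
  | ZOpp e1 => - zcoef i e1
  end.

Lemma zevalE (V : zmodType) (env : seq V) e :
  zeval env e = \sum_(i < size env) nth 0 env i *~ zcoef i e.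
Proof.
elim: e => [j||e1 IH1 e2 IH2|e IH] /=.
- have [js|sj] := ltnP j (size env).
    rewrite (bigD1 (Ordinal js)) //= eqxx mulr1z big1 ?addr0 // => i ij.
    by rewrite (_ : _ == j = false) //; apply: contraNF ij => /eqP ij; apply/eqP/val_inj.
  rewrite nth_default // big1 // => i _.
  by rewrite ltn_eqF // (leq_trans _ sj).
- by rewrite big1.
- by rewrite IH1 IH2 -big_split; apply: eq_bigr => i _; rewrite mulrzDr.
- by rewrite IH -sumrN; apply: eq_bigr => i _; rewrite mulrNz.
Qed.

(** Both sides are integer combinations of the atoms in [env], so the identity reduces to a
    computation with their coefficients. *)
Lemma zeval_eq (V : zmodType) (env : seq V) e1 e2 :
  all (fun i => zcoef i e1 == zcoef i e2) (iota 0 (size env)) ->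
  zeval env e1 = zeval env e2.
Proof.
move=> /allP E; rewrite !zevalE; apply: eq_bigr => i _; congr (_ *~ _).
by apply/eqP/E; rewrite mem_iota /=.
Qed.

(** Atoms are compared up to conversion, since one tensor can occur through several convertible
    structures, such as those of [tens A A] and [atens2 A]. *)
Ltac zsame x y := lazymatch y with x => idtac | _ => unify x y end.
Ltac zmem x l :=
  match l with
  | nil => constr:(false)
  | ?y :: _ => let _ := match goal with _ => zsame x y end in constr:(true)
  | _ :: ?l' => zmem x l'
  end.
Ltac zindex x l :=
  match l with
  | ?y :: _ => let _ := match goal with _ => zsame x y end in constr:(0%N)
  | _ :: ?l' => let i := zindex x l' in constr:(i.+1)
  end.
Ltac zatoms e l :=
  lazymatch e with
  | @GRing.add _ ?a ?b => let l' := zatoms a l in zatoms b l'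
  | @GRing.opp _ ?a => zatoms a l
  | @GRing.zero _ => l
  | _ => lazymatch zmem e l with true => l | false => constr:(e :: l) end
  end.
Ltac zreify e l :=
  lazymatch e with
  | @GRing.add _ ?a ?b =>
      let x := zreify a l in let y := zreify b l in constr:(ZAdd x y)
  | @GRing.opp _ ?a => let x := zreify a l in constr:(ZOpp x)
  | @GRing.zero _ => constr:(ZZero)
  | _ => let i := zindex e l in constr:(ZVar i)
  end.
Ltac abelian :=
  lazymatch goal with
  | |- @eq ?T ?a ?b =>
      let l := zatoms a (@nil T) in
      let l := zatoms b l in
      let x := zreify a l in
      let y := zreify b l in
      let E := fresh in
      pose proof (E := @zeval_eq _ l x y isT); exact E
  end.

(** * Linear maps and elementary Lie algebra identities *)

Section LinearMaps.
Variables (R : pzRingType) (U : lmodType R) (V : lmodType R) (f : U -> V).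
Hypothesis lf : linear f.

Lemma lin_add x y : f (x + y) = f x + f y.
Proof. by have := lf 1 x y; rewrite !scale1r. Qed.
Lemma lin_zero : f 0 = 0.
Proof. by apply: (addrI (f 0)); rewrite -lin_add !addr0. Qed.
Lemma lin_scale a x : f (a *: x) = a *: f x.
Proof. by have := lf a x 0; rewrite lin_zero !addr0. Qed.
Lemma lin_opp x : f (- x) = - f x.
Proof. by rewrite -scaleN1r lin_scale scaleN1r. Qed.
Lemma lin_sub x y : f (x - y) = f x - f y.
Proof. by rewrite lin_add lin_opp. Qed.
Lemma lin_sum I (r : seq I) (P : pred I) (F : I -> U) :
  f (\sum_(i <- r | P i) F i) = \sum_(i <- r | P i) f (F i).
Proof. exact: (big_morph f lin_add lin_zero). Qed.
End LinearMaps.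

Lemma linear_comp (R : pzRingType) (U V W : lmodType R) (f : U -> V) (h : V -> W) :
  linear f -> linear h -> linear (fun x => h (f x)).
Proof. by move=> lf lh a x y; rewrite lf lh. Qed.

Lemma linear_addf (R : pzRingType) (U V : lmodType R) (f h : U -> V) :
  linear f -> linear h -> linear (fun x => f x + h x).
Proof. by move=> lf lh a x y; rewrite lf lh scalerDr addrACA. Qed.

Lemma linear_subf (R : pzRingType) (U V : lmodType R) (f h : U -> V) :
  linear f -> linear h -> linear (fun x => f x - h x).
Proof. by move=> lf lh a x y; rewrite lf lh scalerBr opprD addrACA. Qed.

Lemma scale_linear (R : comPzRingType) (U : lmodType R) (a : R) :
  linear (fun x : U => a *: x).
Proof. by move=> b x y; rewrite scalerDr !scalerA mulrC. Qed.

Section LieAlgebra.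
Variables (R : comNzRingType) (g : lmodType R) (br : g -> g -> g).
Hypothesis lie : is_lie br.
Let bil : bilinear_map br. Proof. by case: lie. Qed.

Lemma lie_linear_l y : linear (br^~ y). Proof. exact: bil.1. Qed.
Lemma lie_linear_r x : linear (br x). Proof. exact: bil.2. Qed.
Lemma lie_0l y : br 0 y = 0. Proof. exact: (lin_zero (lie_linear_l y)). Qed.
Lemma lie_0r x : br x 0 = 0. Proof. exact: (lin_zero (lie_linear_r x)). Qed.
Lemma lie_anti x y : br x y = - br y x.
Proof.
have [_ alt _] := lie; apply/eqP; rewrite -addr_eq0; apply/eqP.
have := alt (x + y); rewrite (lin_add (lie_linear_l _)) !(lin_add (lie_linear_r _)).
by rewrite !alt add0r addr0.
Qed.
Lemma lie_jacobi x y z : br x (br y z) = br (br x y) z + br y (br x z).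
Proof.
have [_ _ jac] := lie; apply/eqP; rewrite -subr_eq0 -(jac x y z).
rewrite (lie_anti (br x y)) (lie_anti x z) (lin_opp (lie_linear_r y)).
by rewrite opprD !opprK addrA addrAC.
Qed.
End LieAlgebra.

Lemma natrS_neq0 (K : idomainType) n : [pchar K] =i pred0 -> (n.+1%:R : K) != 0.
Proof. by move/pcharf0P => ->. Qed.

(** * Left-invariant vector fields on the formal group of a Lie algebra *)

(* A formal power series on [g] with values in [V], given by its polarization:
   [F [:: a1; ...; an]] is the derivative of [F] at the origin along a1, ..., an. *)
Definition fmap (K : fieldType) (g V : lmodType K) : Type := seq g -> V.

(* Linear endomorphisms of [M (+) K]; the summand [K] makes the ring non-zero. *)
Section Endomorphisms.
Variables (K : fieldType) (M : lmodType K).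
Local Notation M1 := (M * K^o)%type.

Record lend := LEnd { lend_fun :> M1 -> M1; lendP : linear lend_fun }.
HB.instance Definition _ := gen_eqMixin lend.
HB.instance Definition _ := gen_choiceMixin lend.

Lemma lend_ext (f h : lend) : (forall x, f x = h x) -> f = h.
Proof.
case: f h => [f lf] [h lh] /= fh; have fE : f = h by apply/funext.
by rewrite fE in lf *; congr LEnd; apply: Prop_irrelevance.
Qed.

Fact lend_add_linear (f h : lend) : linear (fun x => f x + h x).
Proof. exact: linear_addf (lendP f) (lendP h). Qed.
Fact lend_zero_linear : linear (fun _ : M1 => 0 : M1).
Proof. by move=> a x y; rewrite scaler0 addr0. Qed.
Fact lend_scale_linear a (f : lend) : linear (fun x => a *: f x).
Proof. by move=> b x y; rewrite lendP scalerDr !scalerA mulrC. Qed.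
Fact lend_comp_linear (f h : lend) : linear (fun x => f (h x)).
Proof. exact: linear_comp (lendP h) (lendP f). Qed.
Fact lend_id_linear : linear (fun x : M1 => x).
Proof. by []. Qed.

Definition lend_add f h := LEnd (lend_add_linear f h).
Definition lend_zero := LEnd lend_zero_linear.
Definition lend_scale a f := LEnd (lend_scale_linear a f).
Definition lend_mul f h := LEnd (lend_comp_linear f h).
Definition lend_one := LEnd lend_id_linear.

Fact lend_addA : associative lend_add.
Proof. by move=> f h l; apply: lend_ext => x; apply: addrA. Qed.
Fact lend_addC : commutative lend_add.
Proof. by move=> f h; apply: lend_ext => x; apply: addrC. Qed.
Fact lend_add0 : left_id lend_zero lend_add.
Proof. by move=> f; apply: lend_ext => x; apply: add0r. Qed.
Fact lend_addN : left_inverse lend_zero (lend_scale (-1)) lend_add.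
Proof. by move=> f; apply: lend_ext => x; rewrite /= scaleN1r addNr. Qed.
HB.instance Definition _ :=
  GRing.isZmodule.Build lend lend_addA lend_addC lend_add0 lend_addN.

Fact lend_mulA : associative lend_mul.
Proof. by move=> f h l; apply: lend_ext. Qed.
Fact lend_mul1 : left_id lend_one lend_mul.
Proof. by move=> f; apply: lend_ext. Qed.
Fact lend_1mul : right_id lend_one lend_mul.
Proof. by move=> f; apply: lend_ext. Qed.
Fact lend_mulDl : left_distributive lend_mul +%R.
Proof. by move=> f h l; apply: lend_ext. Qed.
Fact lend_mulDr : right_distributive lend_mul +%R.
Proof. by move=> f h l; apply: lend_ext => x; apply: (lin_add (lendP f)). Qed.
Fact lend_1_neq0 : lend_one != 0.
Proof.
apply/eqP => /(congr1 (fun f : lend => (f (0, 1)).2)) /= /eqP.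
by rewrite oner_eq0.
Qed.
HB.instance Definition _ := GRing.Zmodule_isNzRing.Build lend
  lend_mulA lend_mul1 lend_1mul lend_mulDl lend_mulDr lend_1_neq0.

Fact lend_scaleA a b f : lend_scale a (lend_scale b f) = lend_scale (a * b) f.
Proof. by apply: lend_ext => x; apply: scalerA. Qed.
Fact lend_scale1 : left_id 1 lend_scale.
Proof. by move=> f; apply: lend_ext => x; apply: scale1r. Qed.
Fact lend_scaleDr : right_distributive lend_scale +%R.
Proof. by move=> a f h; apply: lend_ext => x; apply: scalerDr. Qed.
Fact lend_scaleDl f : {morph lend_scale^~ f : a b / a + b}.
Proof. by move=> a b; apply: lend_ext => x; apply: scalerDl. Qed.
HB.instance Definition _ := GRing.Zmodule_isLmodule.Build K lend
  lend_scaleA lend_scale1 lend_scaleDr lend_scaleDl.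

Fact lend_scalerAl a (f h : lend) : a *: (f * h) = (a *: f) * h.
Proof. by apply: lend_ext. Qed.
Fact lend_scalerAr a (f h : lend) : a *: (f * h) = f * (a *: h).
Proof. by apply: lend_ext => x /=; rewrite (lin_scale (lendP f)). Qed.
HB.instance Definition _ := GRing.Lmodule_isLalgebra.Build K lend lend_scalerAl.
HB.instance Definition _ := GRing.Lalgebra_isAlgebra.Build K lend lend_scalerAr.

Lemma lendD (f h : lend) x : (f + h) x = f x + h x. Proof. by []. Qed.
Lemma lendN (f : lend) x : (- f) x = - f x.
Proof. exact: scaleN1r. Qed.
Lemma lendZ a (f : lend) x : (a *: f) x = a *: f x. Proof. by []. Qed.
Lemma lendM (f h : lend) x : (f * h) x = f (h x). Proof. by []. Qed.
End Endomorphisms.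

(** * Formal maps, vector fields and 1-forms *)

Section FormalMaps.
Variables (K : fieldType) (g : lmodType K).

Section Module.
Variable V : lmodType K.
Implicit Types F G H : fmap g V.

HB.instance Definition _ := gen_eqMixin (fmap g V).
HB.instance Definition _ := gen_choiceMixin (fmap g V).

Fact fmap_addA : associative (fun F G => (fun s => F s + G s) : fmap g V).
Proof. by move=> F G H; apply/funext => s; apply: addrA. Qed.
Fact fmap_addC : commutative (fun F G => (fun s => F s + G s) : fmap g V).
Proof. by move=> F G; apply/funext => s; apply: addrC. Qed.
Fact fmap_add0 : left_id (fun=> 0) (fun F G => (fun s => F s + G s) : fmap g V).
Proof. by move=> F; apply/funext => s; apply: add0r. Qed.
Fact fmap_addN : left_inverse (fun=> 0) (fun F => (fun s => - F s) : fmap g V)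
  (fun F G => (fun s => F s + G s) : fmap g V).
Proof. by move=> F; apply/funext => s; apply: addNr. Qed.
HB.instance Definition _ :=
  GRing.isZmodule.Build (fmap g V) fmap_addA fmap_addC fmap_add0 fmap_addN.

Definition fmap_scale (a : K) F : fmap g V := fun s => a *: F s.
Fact fmap_scaleA a b F : fmap_scale a (fmap_scale b F) = fmap_scale (a * b) F.
Proof. by apply/funext => s; apply: scalerA. Qed.
Fact fmap_scale1 : left_id 1 fmap_scale.
Proof. by move=> F; apply/funext => s; apply: scale1r. Qed.
Fact fmap_scaleDr : right_distributive fmap_scale +%R.
Proof. by move=> a F G; apply/funext => s; apply: scalerDr. Qed.
Fact fmap_scaleDl F : {morph fmap_scale^~ F : a b / a + b}.
Proof. by move=> a b; apply/funext => s; apply: scalerDl. Qed.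
HB.instance Definition _ := GRing.Zmodule_isLmodule.Build K (fmap g V)
  fmap_scaleA fmap_scale1 fmap_scaleDr fmap_scaleDl.

Lemma fmapD F G s : (F + G) s = F s + G s. Proof. by []. Qed.
Lemma fmapN F s : (- F) s = - F s. Proof. by []. Qed.
Lemma fmapZ a F s : (a *: F) s = a *: F s. Proof. by []. Qed.
Lemma fmap0 s : (0 : fmap g V) s = 0. Proof. by []. Qed.

(** In polarized form, a derivative along a constant field prepends a letter, and a constant map
    lives on the empty word. [fscal c] multiplies the homogeneous component of degree n by c(n), so
    [feuler] is the derivative along the Euler field. *)
Definition fder (a : g) F : fmap g V := fun s => F (a :: s).
Definition fcst (v : V) : fmap g V := fun s => if s is [::] then v else 0.
Definition fscal (c : nat -> K) F : fmap g V := fun s => c (size s) *: F s.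
Definition feuler F : fmap g V := fscal (fun n => n%:R) F.

Lemma fder_linear a : linear (fder a). Proof. by []. Qed.
Lemma fderD a F G : fder a (F + G) = fder a F + fder a G. Proof. by []. Qed.
Lemma fderN a F : fder a (- F) = - fder a F. Proof. by []. Qed.
Lemma fcst_linear : linear fcst.
Proof. by move=> a v w; apply/funext => -[|b s]; rewrite fmapD fmapZ //= scaler0 addr0. Qed.
Lemma fder_cst a v : fder a (fcst v) = 0. Proof. by []. Qed.
Lemma fder_euler a F : fder a (feuler F) = feuler (fder a F) + fder a F.
Proof.
apply/funext => s; rewrite fmapD /fder /feuler /fscal /= -{3}[F _]scale1r -scalerDl.
by rewrite -natr1.
Qed.

(** Polarizations of genuine power series are multilinear and symmetric. Asking this of the leading
    letters of every iterated derivative, up to a given order, makes it provable by induction on the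
    order. *)
Fixpoint good_upto n F : Prop :=
  if n is m.+1 then
    [/\ linear (fun a => fder a F),
        forall a b, fder a (fder b F) = fder b (fder a F)
      & forall a, good_upto m (fder a F)]
  else True.
Definition good F := forall n, good_upto n F.

Lemma good_linear F : good F -> linear (fun a => fder a F).
Proof. by move/(_ 1%N) => []. Qed.
Lemma good_sym F a b : good F -> fder a (fder b F) = fder b (fder a F).
Proof. by move/(_ 1%N) => []. Qed.
Lemma good_der F a : good F -> good (fder a F).
Proof. by move=> gF n; have [_ _] := gF n.+1; apply. Qed.

Lemma good_upto_cst n v : good_upto n (fcst v).
Proof.
have z m : good_upto m (0 : fmap g V).
  by elim: m => //= m IH; split=> // a x y; apply/funext => s; rewrite fmapD fmapZ scaler0 addr0.
case: n => //= n; split=> // a x y.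
by apply/funext => s; rewrite fmapD fmapZ scaler0 addr0.
Qed.

Lemma good_upto_lin n c F G : good_upto n F -> good_upto n G -> good_upto n (c *: F + G).
Proof.
elim: n F G => //= n IH F G [lF sF dF] [lG sG dG]; split=> [a x y|a b|a].
- rewrite !fder_linear lF lG !scalerDr !scalerA (mulrC a) -!addrA; congr (_ + _).
  by rewrite addrCA.
- by rewrite !fder_linear sF sG.
- by rewrite fder_linear; apply: IH.
Qed.

Lemma good_uptoD n F G : good_upto n F -> good_upto n G -> good_upto n (F + G).
Proof. by move=> gF gG; rewrite -[F]scale1r; apply: good_upto_lin. Qed.

Lemma good_uptoW n F : good_upto n.+1 F -> good_upto n F.
Proof. by elim: n F => //= n IH F [lF sF dF]; split=> // a; apply/IH/dF. Qed.

Lemma good_upto_scal n c F : good_upto n F -> good_upto n (fscal c F).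
Proof.
elim: n c F => //= n IH c F [lF sF dF]; split=> [a x y|a b|a].
- apply/funext => s; rewrite fmapD fmapZ /fder /fscal /=.
  rewrite -/(fder _ F s) lF fmapD fmapZ scalerDr !scalerA mulrC.
  by rewrite /fder.
- by apply/funext => s; have /(congr1 (fun f => f s)) := sF a b; rewrite /fder /fscal /= => ->.
- exact: IH (fun n => c n.+1) _ (dF a).
Qed.

(** At a given word, each condition of [good_upto] only involves words of bounded length, so it
    passes to limits of truncations. *)
Lemma good_lim F : (forall m, exists2 G, good G & forall s, (size s < m)%N -> F s = G s) ->
  good F.
Proof.
move=> limF n; elim: n F limF => //= n IH F limF; split=> [c x y|a b|a].
- apply/funext => s; have [G gG FG] := limF (size s).+2.
  rewrite fmapD fmapZ /fder !FG //=.
  by have /(congr1 (fun f => f s)) := good_linear gG c x y.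
- apply/funext => s; have [G gG FG] := limF (size s).+3.
  rewrite /fder !FG //=.
  by have /(congr1 (fun f => f s)) := good_sym a b gG.
- apply: IH => m; have [G gG FG] := limF m.+1.
  by exists (fder a G); [apply: good_der | move=> s sm; apply: FG].
Qed.
End Module.

(** Leibniz rule: each letter differentiates either the field or the form; once no letter is left,
    the form is evaluated at the value of the field at the origin. *)
Fixpoint fstar (V : lmodType K) (xi : fmap g g) (Phi : g -> fmap g V) (s : seq g) : V :=
  if s is a :: s' then
    fstar (fder a xi) Phi s' + fstar xi (fun b => fder a (Phi b)) s'
  else Phi (xi [::]) [::].

(* The contraction of the vector field [xi] with the 1-form [Phi]. *)
Definition contract (V : lmodType K) xi Phi : fmap g V := fstar xi Phi.

Section Contract.
Variable V : lmodType K.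
Implicit Types (xi eta : fmap g g) (Phi Psi : g -> fmap g V) (F G : fmap g V).

Lemma fder_contract a xi Phi :
  fder a (contract xi Phi)
  = contract (fder a xi) Phi + contract xi (fun b => fder a (Phi b)).
Proof. by []. Qed.

Lemma contract_nil xi Phi : contract xi Phi [::] = Phi (xi [::]) [::].
Proof. by []. Qed.

Lemma contract_cons xi Phi a s :
  contract xi Phi (a :: s)
  = contract (fder a xi) Phi s + contract xi (fun b => fder a (Phi b)) s.
Proof. by []. Qed.

Lemma contract_lin xi (c : K) Phi Psi :
  contract xi (fun b => c *: Phi b + Psi b) = c *: contract xi Phi + contract xi Psi.
Proof.
apply/funext => s; rewrite fmapD fmapZ.
elim: s xi Phi Psi => // a s IH xi Phi Psi.
rewrite !contract_cons IH (IH _ (fun b => fder a (Phi b)) (fun b => fder a (Psi b))).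
by rewrite scalerDr addrACA.
Qed.

Lemma fder_form_linear Phi c : linear Phi -> linear (fun b => fder c (Phi b)).
Proof. by move=> lP d x y; rewrite lP. Qed.

Lemma contract_linear c xi eta Phi : linear Phi ->
  contract (c *: xi + eta) Phi = c *: contract xi Phi + contract eta Phi.
Proof.
move=> lP; apply/funext => s; rewrite fmapD fmapZ.
elim: s xi eta Phi lP => [|a s IH] xi eta Phi lP.
  by rewrite !contract_nil lP.
rewrite !contract_cons fder_linear !IH //; first by rewrite scalerDr addrACA.
exact: fder_form_linear.
Qed.

Lemma contract_add xi Phi Psi :
  contract xi (fun b => Phi b + Psi b) = contract xi Phi + contract xi Psi.
Proof.
have := contract_lin xi 1 Phi Psi; rewrite scale1r => <-.
by congr contract; apply/funext => b; rewrite scale1r.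
Qed.

Lemma contractD xi eta Phi : linear Phi ->
  contract (xi + eta) Phi = contract xi Phi + contract eta Phi.
Proof. by move=> lP; rewrite -{1}[xi]scale1r contract_linear // scale1r. Qed.

Lemma contract_zero xi : contract xi (fun=> 0 : fmap g V) = 0.
Proof.
have := contract_lin xi (-1) (fun=> 0) (fun=> 0 : fmap g V).
by rewrite scaler0 addr0 scaleN1r addNr.
Qed.

Lemma contract_sub xi Phi Psi :
  contract xi (fun b => Phi b - Psi b) = contract xi Phi - contract xi Psi.
Proof.
rewrite addrC -scaleN1r -contract_lin; congr contract.
by apply/funext => b; rewrite scaleN1r addrC.
Qed.
End Contract.

Section ContractMore.
Variable V : lmodType K.
Implicit Types (xi eta : fmap g g) (Phi Psi : g -> fmap g V) (F G : fmap g V).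

Lemma contract_exchange xi eta (B : g -> g -> fmap g V) :
  contract xi (fun a => contract eta (B a))
  = contract eta (fun b => contract xi (B^~ b)).
Proof.
apply/funext => s; elim: s xi eta B => // c s IH xi eta B.
have E (x y : fmap g g) (C : g -> g -> fmap g V) :
    contract x (fun b => fder c (contract y (C b))) s
    = contract x (fun b => contract (fder c y) (C b)) s
      + contract x (fun b => contract y (fun a => fder c (C b a))) s.
  by rewrite -fmapD -contract_add.
rewrite !contract_cons (E xi eta B) (E eta xi (fun a b => B b a)).
by rewrite IH (IH xi) (IH xi eta (fun a b => fder c (B a b))) addrCA.
Qed.

Lemma contract_assoc xi (H : g -> fmap g g) Phi : linear Phi ->
  contract xi (fun a => contract (H a) Phi) = contract (contract xi H) Phi.
Proof.
move=> lP; apply/funext => s; elim: s xi H Phi lP => // c s IH xi H Phi lP.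
have E : contract xi (fun b => fder c (contract (H b) Phi)) s
  = contract xi (fun b => contract (fder c (H b)) Phi) s
    + contract xi (fun b => contract (H b) (fun a => fder c (Phi a))) s.
  by rewrite -fmapD -contract_add.
rewrite !contract_cons E !IH //; last exact: fder_form_linear.
by rewrite fder_contract contractD // fmapD addrA.
Qed.

Lemma contract_good_upto n xi Phi : good_upto n xi -> linear Phi ->
  (forall a, good_upto n (Phi a)) -> good_upto n (contract xi Phi).
Proof.
elim: n xi Phi => // n IH xi Phi gx lP gP; have [lx sx dx] := gx.
have lPd c := fder_form_linear c lP.
split=> [c a b|a b|a].
- rewrite !fder_contract lx contract_linear // scalerDr.
  rewrite (_ : (fun d => fder _ (Phi d)) = fun d => c *: fder a (Phi d) + fder b (Phi d)).
    by rewrite contract_lin addrACA.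
  by apply/funext => d; case: (gP d) => ->.
- rewrite !(fder_contract, fderD) sx.
  have -> : (fun d => fder a (fder b (Phi d))) = fun d => fder b (fder a (Phi d)).
    by apply/funext => d; case: (gP d) => _ ->.
  by rewrite addrACA [X in _ + X]addrC addrACA.
rewrite fder_contract; apply: good_uptoD.
  by apply: IH => // [|d]; [apply: dx | apply/good_uptoW/gP].
by apply: IH => // [|d]; [apply: good_uptoW | case: (gP d) => _ _; apply].
Qed.

Lemma contract_local n xi eta Phi :
  (forall s, (size s <= n)%N -> xi s = eta s) ->
  forall s, (size s <= n)%N -> contract xi Phi s = contract eta Phi s.
Proof.
move=> xe s; elim: s n xi eta Phi xe => [|a s IH] n xi eta Phi xe sn.
  by rewrite !contract_nil xe.
rewrite !contract_cons; congr (_ + _).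
  apply: (IH n.-1) => [u un|]; last by case: n sn {xe}.
  by rewrite /fder xe //=; case: n sn un {xe}.
by apply: (IH n) => //; apply: ltnW.
Qed.

(** A form vanishing at the origin raises the degree by one: agreement in degrees below n gives
    agreement in degree n. This makes the iteration [inv_approx] converge. *)
Lemma contract_local_lt n xi eta Phi : (forall b, Phi b [::] = 0) ->
  (forall s, (size s < n)%N -> xi s = eta s) ->
  forall s, (size s <= n)%N -> contract xi Phi s = contract eta Phi s.
Proof.
move=> P0 xe s; elim: s n xi eta Phi P0 xe => [|a s IH] n xi eta Phi P0 xe sn.
  by rewrite !contract_nil !P0.
case: n sn xe => // n sn xe.
rewrite !contract_cons; congr (_ + _).
  by apply: (IH n) => // u un; rewrite /fder xe.
exact: (@contract_local n).
Qed.
End ContractMore.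

(** In linear coordinates [fcst] is the tautological form dy. *)
Lemma contract_cst (xi : fmap g g) : contract xi (@fcst g) = xi.
Proof.
have z eta s : contract eta (fun=> 0 : fmap g g) s = 0.
  elim: s eta => // a s IH eta; rewrite contract_cons IH add0r.
  exact: IH.
apply/funext => s; elim: s xi => // a s IH xi.
by rewrite contract_cons IH z addr0.
Qed.

(** * Pointwise brackets and the Maurer-Cartan form *)

Section Bracket.
Variable br : g -> g -> g.
Hypothesis lie : is_lie br.
Implicit Types (xi eta : fmap g g) (F G H : fmap g g).

Fixpoint fbr_rec F G (s : seq g) : g :=
  if s is a :: s' then fbr_rec (fder a F) G s' + fbr_rec F (fder a G) s'
  else br (F [::]) (G [::]).
Definition fbr F G : fmap g g := fbr_rec F G.

Lemma fder_fbr a F G : fder a (fbr F G) = fbr (fder a F) G + fbr F (fder a G).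
Proof. by []. Qed.

Lemma fbr_cons F G a s : fbr F G (a :: s) = fbr (fder a F) G s + fbr F (fder a G) s.
Proof. by []. Qed.

Lemma fbr_linear_r F : linear (fbr F).
Proof.
move=> c G H; apply/funext => s; rewrite fmapD fmapZ.
elim: s F G H => [|a s IH] F G H; first exact: lie_linear_r.
by rewrite !fbr_cons fder_linear !IH scalerDr addrACA.
Qed.

Lemma fbr_anti F G : fbr F G = - fbr G F.
Proof.
apply/funext => s; elim: s F G => [|a s IH] F G; first exact: lie_anti.
by rewrite fmapN !fbr_cons IH (IH F) !fmapN -opprD addrC.
Qed.

Lemma fbr_linear_l G : linear (fbr^~ G).
Proof. by move=> c F H; rewrite fbr_anti fbr_linear_r opprD -scalerN -!fbr_anti. Qed.

Lemma fbrDr F G H : fbr F (G + H) = fbr F G + fbr F H.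
Proof. exact: lin_add (fbr_linear_r F) _ _. Qed.
Lemma fbrDl F G H : fbr (F + G) H = fbr F H + fbr G H.
Proof. exact: lin_add (fbr_linear_l H) _ _. Qed.
Lemma fbrNr F G : fbr F (- G) = - fbr F G.
Proof. exact: lin_opp (fbr_linear_r F) _. Qed.
Lemma fbrNl F G : fbr (- F) G = - fbr F G.
Proof. exact: lin_opp (fbr_linear_l G) _. Qed.
Lemma fbr0r F : fbr F 0 = 0.
Proof. exact: lin_zero (fbr_linear_r F). Qed.
Lemma fbr0l F : fbr 0 F = 0.
Proof. exact: lin_zero (fbr_linear_l F). Qed.

Lemma fbr_jacobi F G H : fbr F (fbr G H) = fbr (fbr F G) H + fbr G (fbr F H).
Proof.
apply/funext => s; rewrite fmapD; elim: s F G H => [|a s IH] F G H.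
  exact: lie_jacobi.
rewrite !fbr_cons !fder_fbr.
rewrite !fbrDr !fbrDl !fmapD.
rewrite (IH (fder a F)) (IH F (fder a G)) (IH F G (fder a H)).
abelian.
Qed.

Lemma fbr_cst a b : fbr (fcst a) (fcst b) = fcst (br a b).
Proof.
apply/funext => -[|c s] //; rewrite fbr_cons !fder_cst.
by rewrite fbr0r fbr0l addr0.
Qed.

Lemma fbr_euler F G : feuler (fbr F G) = fbr (feuler F) G + fbr F (feuler G).
Proof.
apply/funext => s; elim: s F G => [|a s IH] F G.
  rewrite fmapD /feuler /fscal /fbr /= !scale0r.
  by rewrite (lie_0l lie) (lie_0r lie) addr0.
have E X : feuler X (a :: s) = feuler (fder a X) s + fder a X s.
  by rewrite -fmapD -fder_euler.
rewrite E fder_fbr fmapD; have -> : feuler (fbr (fder a F) G + fbr F (fder a G)) s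
   = feuler (fbr (fder a F) G) s + feuler (fbr F (fder a G)) s.
  by rewrite /feuler /fscal fmapD scalerDr.
rewrite !IH !fmapD -[in RHS]/(fder a (fbr (feuler F) G) s).
rewrite -[X in _ = _ + X]/(fder a (fbr F (feuler G)) s) !fder_fbr !fder_euler.
rewrite !fmapD fbrDl fbrDr !fmapD.
abelian.
Qed.

Lemma fbr_good_upto n F G : good_upto n F -> good_upto n G -> good_upto n (fbr F G).
Proof.
elim: n F G => // n IH F G gF gG; have [[lF sF dF] [lG sG dG]] := (gF, gG).
split=> [c a b|a b|a].
- rewrite !fder_fbr lF lG fbr_linear_r fbr_linear_l scalerDr.
  by rewrite addrACA.
- rewrite !(fder_fbr, fderD) sF sG -!addrA; congr (_ + _).
  by rewrite addrA [in LHS](addrC (fbr _ _)) -addrA.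
rewrite fder_fbr; apply: good_uptoD.
  exact: IH (dF a) (good_uptoW gG).
exact: IH (good_uptoW gF) (dG a).
Qed.

Lemma fbr_local n H F G : (forall s, (size s <= n)%N -> F s = G s) ->
  forall s, (size s <= n)%N -> fbr H F s = fbr H G s.
Proof.
move=> FG s; elim: s n H F G FG => [|a s IH] n H F G FG sn.
  by rewrite /fbr /= FG.
rewrite !fbr_cons; congr (_ + _).
  by apply: (IH n) => //; apply: ltnW.
apply: (IH n.-1) => [u un|]; last by case: n sn {FG}.
by rewrite /fder FG //=; case: n sn un {FG}.
Qed.

(** The same gain of one degree, for the bracket with a map vanishing at the origin; the case of
    interest is H = [fid], the coordinate y itself. *)
Lemma fbr_local_lt n H F G : H [::] = 0 -> (forall s, (size s < n)%N -> F s = G s) ->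
  forall s, (size s <= n)%N -> fbr H F s = fbr H G s.
Proof.
move=> H0 FG s; elim: s n H F G H0 FG => [|a s IH] n H F G H0 FG sn.
  by rewrite /fbr /= H0 !(lie_0l lie).
case: n sn FG => // n sn FG.
rewrite !fbr_cons; congr (_ + _); first exact: (@fbr_local n).
by apply: (IH n) => // u un; rewrite /fder FG.
Qed.

Lemma contract_fbr xi (Phi : g -> fmap g g) G :
  fbr (contract xi Phi) G = contract xi (fun a => fbr (Phi a) G).
Proof.
apply/funext => s; elim: s xi Phi G => // a s IH xi Phi G.
rewrite fbr_cons contract_cons fder_contract.
rewrite fbrDl fmapD !IH -addrA; congr (_ + _).
by rewrite -fmapD -contract_add.
Qed.

Hypothesis char0 : [pchar K] =i pred0.

Let natr_neq0 n : (n.+1%:R : K) != 0. Proof. exact: natrS_neq0. Qed.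

Definition fid : fmap g g := fun s => if s is [:: a] then a else 0.

Lemma fder_id a : fder a fid = fcst a.
Proof. by apply/funext => -[]. Qed.

Lemma fid_good n : good_upto n fid.
Proof.
case: n => //= n; split=> [c a b|a b|a]; rewrite !fder_id.
- exact: fcst_linear.
- by rewrite !fder_cst.
- exact: good_upto_cst.
Qed.

(* Truncations of the series [(1 - exp (- ad y)) / ad y] applied to [a]. *)
Fixpoint mc_approx (m : nat) (a : g) : fmap g g :=
  if m is m'.+1 then
    fscal (fun n => n.+1%:R^-1) (fcst a - fbr fid (mc_approx m' a))
  else 0.

(* The left Maurer-Cartan form in exponential coordinates. *)
Definition mc_form (a : g) : fmap g g := fun s => mc_approx (size s).+1 a s.

Lemma mc_approxE m n a s : (size s < m)%N -> (size s < n)%N ->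
  mc_approx m a s = mc_approx n a s.
Proof.
elim: m n s => // m IH [|n] s //= sm sn.
rewrite /fscal !fmapD !fmapN; congr (_ *: (_ - _)).
apply: (@fbr_local_lt (size s)) => // u us.
apply: IH; [exact: leq_trans us _ | exact: leq_trans us _].
Qed.

Lemma mc_form_approx m a s : (size s < m)%N -> mc_form a s = mc_approx m a s.
Proof. by move=> sm; apply: mc_approxE. Qed.

(** With E the Euler field and omega = (1 - exp(- ad y)) / ad y applied to a, this is (E + 1) omega
    = a - [y, omega]. On a ray y = s x it expresses that s omega has derivative exp(- s ad x) a. The
    coefficients 1/(n+1) of [mc_approx] invert E + 1 in degree n. *)
Lemma mc_form_eq a :
  feuler (mc_form a) = fcst a - fbr fid (mc_form a) - mc_form a.
Proof.
apply/funext => s; rewrite !fmapD !fmapN /feuler /fscal.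
apply/eqP; rewrite eq_sym subr_eq -{2}[mc_form a s]scale1r -scalerDl natr1.
have -> : mc_form a s = (size s).+1%:R^-1 *: (fcst a s - fbr fid (mc_form a) s).
  rewrite {1}/mc_form /= /fscal fmapD fmapN; congr (_ *: (_ - _)).
  apply: (@fbr_local_lt (size s)) => // u us.
  by rewrite -mc_form_approx.
by rewrite scalerA divff ?scale1r.
Qed.

Lemma mc_form_nil a : mc_form a [::] = a.
Proof.
have := congr1 (fun f => f [::]) (mc_form_eq a).
rewrite !fmapD !fmapN /feuler /fscal /= scale0r /fbr /= (lie_0l lie) subr0.
by move/eqP; rewrite eq_sym subr_eq0 => /eqP.
Qed.

Lemma mc_form_linear : linear mc_form.
Proof.
have lin m : linear (mc_approx m).
  elim: m => [|m IH] c a b /=; first by rewrite scaler0 addr0.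
  apply/funext => s; rewrite !fmapD fmapZ /fscal !fmapD !fmapN IH.
  rewrite fcst_linear fbr_linear_r !fmapD !fmapZ opprD addrACA -scalerBr.
  by rewrite scalerDr !scalerA mulrC.
by move=> c a b; apply/funext => s; rewrite fmapD fmapZ /mc_form lin.
Qed.

Lemma mc_form_good a : good (mc_form a).
Proof.
apply: good_lim => m; exists (mc_approx m a); last exact: mc_form_approx.
elim: m => [|m IH] n /=; first by rewrite -(lin_zero (@fcst_linear g)); apply: good_upto_cst.
apply: good_upto_scal; rewrite addrC -scaleN1r.
apply: good_upto_lin; last exact: good_upto_cst.
exact: fbr_good_upto (fid_good n) (IH n).
Qed.

(** In degree n the operator E + c + 1 is the non-zero scalar n + c + 1, while the bracket with y
    only involves components of lower degree; so F vanishes degree by degree. *)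
Lemma euler_uniq c F : feuler F = - fbr fid F - c.+1%:R *: F -> F = 0.
Proof.
move=> FE; apply/funext => s; have [m] := ubnP (size s).
elim: m s => // m IH s sm.
have := congr1 (fun f => f s) FE; rewrite !fmapD !fmapN fmapZ /feuler /fscal.
rewrite (@fbr_local_lt (size s) fid F 0) //; last first.
  by move=> u us; apply: IH; apply: leq_trans us _.
rewrite fbr0r fmap0 oppr0 add0r => /eqP.
rewrite -subr_eq0 opprK -scalerDl -natrD addnS scaler_eq0 (negbTE (natr_neq0 _)) /=.
by move/eqP.
Qed.

(** The curvature X on the left satisfies the homogeneous equation (E + 2) X = - [y, X], whose only
    solution is 0 by [euler_uniq]. *)
Lemma maurer_cartan a b :
  fder a (mc_form b) - fder b (mc_form a) + fbr (mc_form a) (mc_form b) = 0.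
Proof.
have E (x y : g) : feuler (fder x (mc_form y))
    = - fbr (fcst x) (mc_form y) - fbr fid (fder x (mc_form y))
      - fder x (mc_form y) - fder x (mc_form y).
  apply/eqP; rewrite -subr_eq opprK -fder_euler mc_form_eq !(fderD, fderN) fder_fbr.
  by rewrite fder_id fder_cst add0r opprD.
have ED F G : feuler (F + G) = feuler F + feuler G.
  by apply/funext => s; rewrite fmapD /feuler /fscal fmapD scalerDr.
have EN F : feuler (- F) = - feuler F.
  by apply/funext => s; rewrite fmapN /feuler /fscal fmapN scalerN.
apply: (@euler_uniq 1); rewrite !(ED, EN) !E fbr_euler !mc_form_eq.
set A := mc_form a; set B := mc_form b; set da := fder a B; set db := fder b A.
rewrite !(fbrDr, fbrDl, fbrNr, fbrNl).
rewrite (fbr_jacobi fid A B) [fbr A (fcst b)]fbr_anti.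
rewrite scaler_nat mulr2n.
set x1 := fbr _ B; set x2 := fbr _ A; set x3 := fbr fid da; set x4 := fbr fid db.
set x5 := fbr _ B; set x6 := fbr A _; set x7 := fbr A B.
abelian.
Qed.

(** * Left-invariant fields and the action of U(g) on formal maps *)

Definition theta xi : fmap g g := contract xi mc_form.

(** Iterates xi = v - (omega - dy)(xi), which restates omega(xi) = v. Since omega - dy vanishes at
    the origin, each iteration fixes one more degree. *)
Fixpoint inv_approx (m : nat) (v : g) : fmap g g :=
  if m is m'.+1 then
    fcst v - contract (inv_approx m' v) (fun b => mc_form b - fcst b)
  else 0.

(* The left-invariant vector field with value [v] at the origin. *)
Definition linv (v : g) : fmap g g := fun s => inv_approx (size s).+1 v s.

Let mc_form0_nil b : (mc_form b - fcst b) [::] = 0.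
Proof. by rewrite fmapD fmapN mc_form_nil subrr. Qed.

Let mc_form0_linear : linear (fun b => mc_form b - fcst b).
Proof. exact: linear_subf mc_form_linear (@fcst_linear g). Qed.

Lemma thetaE xi : theta xi = xi + contract xi (fun b => mc_form b - fcst b).
Proof.
rewrite -{2}[xi]contract_cst -contract_add; congr contract.
by apply/funext => b; rewrite addrC subrK.
Qed.

Lemma inv_approxE m n v s : (size s < m)%N -> (size s < n)%N ->
  inv_approx m v s = inv_approx n v s.
Proof.
elim: m n s => // m IH [|n] s //= sm sn.
rewrite !fmapD !fmapN; congr (_ - _).
apply: (@contract_local_lt _ (size s)) => // u us.
apply: IH; [exact: leq_trans us _ | exact: leq_trans us _].
Qed.

Lemma theta_linv v : theta (linv v) = fcst v.
Proof.
apply/funext => s; rewrite thetaE fmapD.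
rewrite (@contract_local_lt _ (size s) _ (inv_approx (size s) v)) //.
  by rewrite /linv /= fmapD fmapN subrK.
by move=> u us; apply: inv_approxE.
Qed.

Lemma theta_linear : linear theta.
Proof. by move=> c x y; apply/contract_linear/mc_form_linear. Qed.

(** A field killed by omega is minus its contraction with omega - dy, a form that vanishes at the
    origin; so it vanishes degree by degree. *)
Lemma theta_inj xi : theta xi = 0 -> xi = 0.
Proof.
move=> t0; apply/funext => s; have [m] := ubnP (size s).
elim: m s => // m IH s sm.
have := congr1 (fun f => f s) t0; rewrite thetaE fmapD.
rewrite (@contract_local_lt _ (size s) xi 0) //; last first.
  by move=> u us; apply: IH; apply: leq_trans us _.
(* Linearity at 0 reads C = C + C for the contraction C of the zero field, whence C = 0. *)
have := contract_linear 1 0 0 mc_form0_linear.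
rewrite scaler0 addr0 scale1r => /(congr1 (fun f => f s)); rewrite fmapD.
by rewrite -[LHS]addr0 => /addrI <-; rewrite addr0.
Qed.

Lemma theta_uniq xi eta : theta xi = theta eta -> xi = eta.
Proof.
move=> E; apply/eqP; rewrite -subr_eq0; apply/eqP/theta_inj.
by rewrite (lin_sub theta_linear) E subrr.
Qed.

Lemma linv_linear : linear linv.
Proof. by move=> c x y; apply: theta_uniq; rewrite theta_linear !theta_linv fcst_linear. Qed.

Lemma linv_good v : good (linv v).
Proof.
apply: good_lim => m; exists (inv_approx m v); last by move=> s sm; apply: inv_approxE.
elim: m => [|m IH] n /=; first by rewrite -(lin_zero (@fcst_linear g)); apply: good_upto_cst.
rewrite addrC -scaleN1r; apply: good_upto_lin; last exact: good_upto_cst.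
apply: contract_good_upto => // a; rewrite addrC -scaleN1r.
apply: good_upto_lin; [exact: good_upto_cst | exact: mc_form_good].
Qed.

Lemma linv_nil v : linv v [::] = v.
Proof.
by rewrite /linv /= fmapD fmapN contract_nil mc_form0_nil subr0.
Qed.

Section LieDerivative.
Variable V : lmodType K.

Definition lder xi (F : fmap g V) : fmap g V := contract xi (fun a => fder a F).

Lemma lder_linear xi : linear (lder xi).
Proof. by move=> c F G; apply: contract_lin. Qed.

Lemma lder_good xi (F : fmap g V) : good xi -> good F -> good (lder xi F).
Proof.
move=> gx gF n; apply: contract_good_upto => // [|a]; first exact: good_linear.
exact: good_der.
Qed.
End LieDerivative.

Lemma lder_contract (V : lmodType K) xi eta (Phi : g -> fmap g V) : linear Phi ->
  lder xi (contract eta Phi)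
  = contract (lder xi eta) Phi + contract eta (fun b => lder xi (Phi b)).
Proof.
move=> lP; rewrite /lder; under eq_fun do rewrite fder_contract.
by rewrite contract_add contract_assoc // contract_exchange.
Qed.

(** The second derivatives of F cancel by symmetry, which is where goodness enters; what remains is
    the derivative along the bracket of the two fields. *)
Lemma lder_comm (V : lmodType K) xi eta (F : fmap g V) : good F ->
  lder xi (lder eta F) - lder eta (lder xi F) = lder (lder xi eta - lder eta xi) F.
Proof.
move=> gF; have lF := good_linear gF.
rewrite {2 4}/lder !lder_contract // /lder contract_exchange.
have -> : (fun b => contract eta (fun a => fder a (fder b F)))
        = (fun b => contract eta (fun a => fder b (fder a F))).
  by apply/funext => b; congr contract; apply/funext => a; apply: good_sym.
rewrite opprD addrACA subrr addr0.
by rewrite -(lin_sub (f := fun x => contract x _)) // => c x y; apply: contract_linear.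
Qed.

(** As omega is constant on left-invariant fields, its value on their commutator is - d omega, and
    the Maurer-Cartan equation turns this into the bracket of v and w. Fields are determined by
    their image under omega. *)
Lemma linv_comm v w :
  lder (linv v) (linv w) - lder (linv w) (linv v) = linv (br v w).
Proof.
apply: theta_uniq; rewrite (lin_sub theta_linear) theta_linv.
have E x y : theta (lder (linv x) (linv y))
    = - contract (linv y) (fun b => lder (linv x) (mc_form b)).
  apply/eqP; rewrite -addr_eq0 -lder_contract; last exact: mc_form_linear.
  by rewrite -/(theta _) theta_linv /lder contract_zero.
have R a : fbr (mc_form a) (theta (linv w))
    = contract (linv w) (fun b => fder b (mc_form a))
      - contract (linv w) (fun b => fder a (mc_form b)).
  rewrite fbr_anti contract_fbr -contract_sub -[LHS]add0r -(contract_zero _ (linv w)).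
  rewrite -contract_sub; congr contract; apply/funext => b.
  rewrite sub0r -fbr_anti; apply/eqP; rewrite -subr_eq0 -(maurer_cartan a b).
  by apply/eqP; abelian.
rewrite !E opprK -fbr_cst -(theta_linv v) -(theta_linv w) {1}/theta contract_fbr.
under [in RHS]eq_fun do rewrite R.
by rewrite contract_sub addrC /lder; congr (_ - _); apply: contract_exchange.
Qed.

Definition good_pred : {pred fmap g g} := fun F => `[< good F >].

Fact good_submod : submod_closed good_pred.
Proof.
split=> [|c F G /asboolP gF /asboolP gG]; apply/asboolP => n.
  rewrite -(lin_zero (@fcst_linear g)); apply: good_upto_cst.
exact: good_upto_lin.
Qed.
HB.instance Definition _ := GRing.isSubmodClosed.Build K (fmap g g) good_pred good_submod.

(** The derivatives along [linv v] represent the Lie algebra only on multilinear symmetric maps, so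
    the action of U(g) is restricted to these. *)
Definition gmap := {F : fmap g g | F \in good_pred}.
HB.instance Definition _ := Choice.on gmap.
HB.instance Definition _ := SubType.on gmap.
HB.instance Definition _ := [SubChoice_isSubLmodule of gmap by <:].

Lemma lder_linv_good v (F : gmap) : lder (linv v) (val F) \in good_pred.
Proof. by apply/asboolP/lder_good; [exact: linv_good | exact/asboolP/(valP F)]. Qed.

Definition linv_act (v : g) (x : gmap * K^o) : gmap * K^o :=
  (exist _ (lder (linv v) (val x.1)) (lder_linv_good v x.1), 0).

Fact linv_act_linear v : linear (linv_act v).
Proof.
move=> c [F a] [G b]; congr pair; last by rewrite /= scaler0 addr0.
by apply: val_inj; rewrite /= lder_linear.
Qed.

Definition linv_end v : lend gmap := LEnd (linv_act_linear v).

Lemma linv_end_lie : lie_to_alg br linv_end.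
Proof.
split=> [c v w|v w]; apply: lend_ext => -[F a].
  rewrite lendD lendZ; congr pair; last by rewrite /= scaler0 addr0.
  apply: val_inj; rewrite /= linv_linear /lder contract_linear //.
  exact/good_linear/asboolP/(valP F).
rewrite lendD lendN !lendM; congr pair; last by rewrite /= subrr.
apply: val_inj; rewrite /= lder_comm ?linv_comm //.
exact/asboolP/(valP F).
Qed.

Fact fid_good_pred : fid \in good_pred.
Proof. by apply/asboolP => n; apply: fid_good. Qed.

(* The logarithm in exponential coordinates: as a linear form on [U(g)], seen
   as the algebra of distributions at the origin. *)
Definition uea_log (u : uea br) : g :=
  val (ulift linv_end u (exist _ fid fid_good_pred : gmap, 0 : K^o)).1 [::].

Lemma uea_log_linear : linear uea_log.
Proof.
move=> c u v; rewrite /uea_log.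
have -> : ulift linv_end (c *: u + v) = c *: ulift linv_end u + ulift linv_end v.
  by rewrite -(ulift_scale linv_end_lie) -(ulift_add linv_end_lie).
by [].
Qed.

Lemma uea_logK x : uea_log (uea_in br x) = x.
Proof.
rewrite /uea_log (ulift_in linv_end_lie) /= /lder contract_nil linv_nil.
by [].
Qed.

End Bracket.
End FormalMaps.

(* Poincare-Birkhoff-Witt in characteristic zero, in the weak form that is
   needed: [g] is a direct summand of [U(g)]. *)
Lemma uea_in_retraction (K : fieldType) (g : lmodType K) (br : g -> g -> g) :
  [pchar K] =i pred0 -> is_lie br ->
  exists2 e : uea br -> g, linear e & forall x, e (uea_in br x) = x.
Proof.
move=> char0 lie; exists (uea_log lie char0); first exact: uea_log_linear.
exact: uea_logK.
Qed.

(** * Tensor products *)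

Section Bilinear.
Variable R : comNzRingType.
Implicit Types M N P Q : lmodType R.

Lemma bilinear_comp M N M' N' P (f : M' -> N' -> P) (a : M -> M') (b : N -> N') :
  linear a -> linear b -> bilinear_map f -> bilinear_map (fun x y => f (a x) (b y)).
Proof.
move=> la lb [fl fr]; split=> [y c x x'|x c y y'] /=; first by rewrite la fl.
by rewrite lb fr.
Qed.

Lemma linear_bilinear M N P Q (f : M -> N -> P) (h : P -> Q) :
  linear h -> bilinear_map f -> bilinear_map (fun x y => h (f x y)).
Proof.
move=> lh [fl fr]; split=> [y c x x'|x c y y'] /=; first by rewrite fl lh.
by rewrite fr lh.
Qed.

Lemma bilinear_swap M N P (f : M -> N -> P) :
  bilinear_map f -> bilinear_map (fun y x => f x y).
Proof. by case. Qed.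

Lemma bilinear_add M N P (f h : M -> N -> P) :
  bilinear_map f -> bilinear_map h -> bilinear_map (fun x y => f x y + h x y).
Proof.
by move=> [fl fr] [hl hr]; split=> [y c x x'|x c y y'] /=;
  rewrite ?(fl y) ?(hl y) ?(fr x) ?(hr x) scalerDr addrACA.
Qed.

Lemma id_linear M : linear (fun x : M => x). Proof. by []. Qed.

Lemma tpure_linear_l M N (y : N) : linear (fun x : M => x ⊗ y).
Proof. exact: (tpure_bilinear M N).1. Qed.
Lemma tpure_linear_r M N (x : M) : linear (fun y : N => x ⊗ y).
Proof. exact: (tpure_bilinear M N).2. Qed.

Lemma tpureDl M N (x x' : M) (y : N) : (x + x') ⊗ y = x ⊗ y + x' ⊗ y.
Proof. exact: lin_add (tpure_linear_l y) _ _. Qed.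
Lemma tpureDr M N (x : M) (y y' : N) : x ⊗ (y + y') = x ⊗ y + x ⊗ y'.
Proof. exact: lin_add (tpure_linear_r x) _ _. Qed.
Lemma tpureZl M N a (x : M) (y : N) : (a *: x) ⊗ y = a *: (x ⊗ y).
Proof. exact: lin_scale (tpure_linear_l y) _ _. Qed.
Lemma tpureZr M N a (x : M) (y : N) : x ⊗ (a *: y) = a *: (x ⊗ y).
Proof. exact: lin_scale (tpure_linear_r x) _ _. Qed.
Lemma tpureNl M N (x : M) (y : N) : (- x) ⊗ y = - (x ⊗ y).
Proof. exact: lin_opp (tpure_linear_l y) _. Qed.
Lemma tpureNr M N (x : M) (y : N) : x ⊗ (- y) = - (x ⊗ y).
Proof. exact: lin_opp (tpure_linear_r x) _. Qed.
Lemma tpure0r M N (x : M) : x ⊗ (0 : N) = 0.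
Proof. exact: lin_zero (tpure_linear_r x). Qed.

Lemma tens_ind M N (S : tens M N -> Prop) :
  S 0 -> (forall x y t, S t -> S (x ⊗ y + t)) -> forall t, S t.
Proof.
move=> S0 SD t; rewrite [t]tens_pureE; elim: (repr t) => [|q s IH].
  by rewrite big_nil.
by rewrite big_cons; apply: SD.
Qed.

Lemma tens_linear_ext M N P (h1 h2 : tens M N -> P) : linear h1 -> linear h2 ->
  (forall x y, h1 (x ⊗ y) = h2 (x ⊗ y)) -> forall t, h1 t = h2 t.
Proof.
move=> l1 l2 E; elim/tens_ind => [|x y t IH]; first by rewrite !lin_zero.
by rewrite (lin_add l1) (lin_add l2) E IH.
Qed.

Lemma tens3_linear_ext M N P Q (h1 h2 : tens M (tens N P) -> Q) :
  linear h1 -> linear h2 ->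
  (forall x y z, h1 (x ⊗ (y ⊗ z)) = h2 (x ⊗ (y ⊗ z))) -> forall t, h1 t = h2 t.
Proof.
move=> l1 l2 E; apply: tens_linear_ext => // x.
by apply: tens_linear_ext => //; apply: linear_comp (tpure_linear_r x) _.
Qed.

Lemma tlift2_bilinear M N P Q (f : M -> N -> P -> Q) :
  (forall x, bilinear_map (f x)) -> (forall y z, linear (fun x => f x y z)) ->
  bilinear_map (fun x => tlift (f x)).
Proof.
move=> f2 f1; split=> [u c x x' /=|x]; last exact: tlift_is_linear.
rewrite /tlift /tsum scaler_sumr -big_split /=; apply: eq_bigr => q _.
exact: f1.
Qed.

Lemma tlift_param_linear M N P Q (f : M -> N -> P -> Q) t :
  (forall x y, linear (f x y)) -> linear (fun u => tlift (fun x y => f x y u) t).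
Proof.
move=> lf c u v; rewrite /tlift /tsum scaler_sumr -big_split /=.
by apply: eq_bigr => q _; apply: lf.
Qed.

Lemma tmap_bilinear M N M' N' (f : M -> M') (h : N -> N') :
  linear f -> linear h -> bilinear_map (fun x y => f x ⊗ h y).
Proof. by move=> lf lh; apply: bilinear_comp (tpure_bilinear _ _). Qed.

Lemma tmap_linear M N M' N' (f : M -> M') (h : N -> N') :
  linear f -> linear h -> linear (tmap f h).
Proof. by move=> lf lh; apply/tlift_is_linear/tmap_bilinear. Qed.

Lemma tmap_pure M N M' N' (f : M -> M') (h : N -> N') x y :
  linear f -> linear h -> tmap f h (x ⊗ y) = f x ⊗ h y.
Proof. by move=> lf lh; rewrite /tmap tlift_pure //; apply: tmap_bilinear. Qed.

Lemma tmap_comp M N M' N' M'' N'' (f : M -> M') (h : N -> N') (f' : M' -> M'') (h' : N' -> N'') t :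
  linear f -> linear h -> linear f' -> linear h' ->
  tmap f' h' (tmap f h t) = tmap (fun x => f' (f x)) (fun x => h' (h x)) t.
Proof.
move=> lf lh lf' lh'; move: t; apply: tens_linear_ext => [||x y].
- exact: linear_comp (tmap_linear lf lh) (tmap_linear lf' lh').
- exact: tmap_linear (linear_comp lf lf') (linear_comp lh lh').
by rewrite !tmap_pure //; [apply: linear_comp lf lf' | apply: linear_comp lh lh'].
Qed.

Lemma tmap_id M N t : tmap (fun x : M => x) (fun y : N => y) t = t.
Proof.
move: t; apply: tens_linear_ext => [||x y]; rewrite ?tmap_pure //.
exact: tmap_linear (@id_linear M) (@id_linear N).
Qed.

Lemma eq_tmap M N M' N' (f f' : M -> M') (h h' : N -> N') t :
  f =1 f' -> h =1 h' -> tmap f h t = tmap f' h' t.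
Proof. by move=> ff hh; congr (tlift _ t); apply/funext => x; apply/funext => y; rewrite ff hh. Qed.
End Bilinear.

(** * Permutations of tensor factors and cobrackets *)

Section TensorPowers.
Variables (R : comNzRingType) (M : lmodType R).
Local Notation M2 := (tens M M).
Local Notation M3 := (tens M (tens M M)).
Implicit Types (x y z : M) (s t : M2) (u v : M3).

Lemma tflip_linear : linear (@tflip R M).
Proof. exact/tlift_is_linear/bilinear_swap/tpure_bilinear. Qed.
Lemma tflip_pure x y : tflip (x ⊗ y) = y ⊗ x.
Proof. by rewrite /tflip tlift_pure //; apply/bilinear_swap/tpure_bilinear. Qed.
Lemma tflipK t : tflip (tflip t) = t.
Proof.
move: t; apply: tens_linear_ext => [||x y]; rewrite ?tflip_pure //.
exact: linear_comp tflip_linear tflip_linear.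
Qed.
Lemma tflipD s t : tflip (s + t) = tflip s + tflip t.
Proof. exact: lin_add tflip_linear _ _. Qed.
Lemma tflipN s : tflip (- s) = - tflip s.
Proof. exact: lin_opp tflip_linear _. Qed.

Definition tcons_r (y : M) : M2 -> M3 := tlift (fun a b => a ⊗ (b ⊗ y)).

Lemma tcons_r_bilinear2 y : bilinear_map (fun a b : M => a ⊗ (b ⊗ y)).
Proof. exact: bilinear_comp (@id_linear _ M) (tpure_linear_l y) (tpure_bilinear _ _). Qed.
Lemma tcons_r_pure a b y : tcons_r y (a ⊗ b) = a ⊗ (b ⊗ y).
Proof. by rewrite /tcons_r tlift_pure //; apply: tcons_r_bilinear2. Qed.
Lemma tcons_r_bilinear : bilinear_map tcons_r.
Proof.
apply: tlift2_bilinear => [y|a b]; first exact: tcons_r_bilinear2.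
exact: linear_comp (tpure_linear_r b) (tpure_linear_r a).
Qed.
Lemma tcons_r_linear y : linear (tcons_r y). Proof. exact: tcons_r_bilinear.2. Qed.

Lemma cyc3_linear : linear (@cyc3 R M).
Proof. exact/tlift_is_linear/tcons_r_bilinear. Qed.
Lemma cyc3_cons x s : cyc3 (x ⊗ s) = tcons_r x s.
Proof. by rewrite /cyc3 tlift_pure //; apply: tcons_r_bilinear. Qed.
Lemma cyc3_pure x y z : cyc3 (x ⊗ (y ⊗ z)) = y ⊗ (z ⊗ x).
Proof. by rewrite cyc3_cons tcons_r_pure. Qed.

Definition swap23 : M3 -> M3 := tmap (fun x => x) (@tflip R M).
Definition swap12 (u : M3) : M3 := cyc3 (cyc3 (swap23 u)).

Lemma swap23_linear : linear swap23.
Proof. exact: tmap_linear (@id_linear _ M) tflip_linear. Qed.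
Lemma swap23_cons x s : swap23 (x ⊗ s) = x ⊗ tflip s.
Proof. by rewrite /swap23 tmap_pure //; apply: tflip_linear. Qed.
Lemma swap23_pure x y z : swap23 (x ⊗ (y ⊗ z)) = x ⊗ (z ⊗ y).
Proof. by rewrite swap23_cons tflip_pure. Qed.
Lemma swap12_linear : linear swap12.
Proof. exact: linear_comp swap23_linear (linear_comp cyc3_linear cyc3_linear). Qed.
Lemma swap12_pure x y z : swap12 (x ⊗ (y ⊗ z)) = y ⊗ (x ⊗ z).
Proof. by rewrite /swap12 swap23_pure !cyc3_pure. Qed.

Lemma cyc3K u : cyc3 (cyc3 (cyc3 u)) = u.
Proof.
move: u; apply: tens3_linear_ext => [||x y z]; rewrite ?cyc3_pure //.
exact: linear_comp cyc3_linear (linear_comp cyc3_linear cyc3_linear).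
Qed.
Lemma cyc3_swap12 u : cyc3 (swap12 u) = swap23 u.
Proof. by rewrite /swap12 cyc3K. Qed.
Lemma swap12_cons_r y s : swap12 (tcons_r y s) = tcons_r y (tflip s).
Proof.
move: s; apply: tens_linear_ext => [||a b]; rewrite ?(tcons_r_pure, swap12_pure, tflip_pure) //.
  exact: linear_comp (tcons_r_linear y) swap12_linear.
exact: linear_comp tflip_linear (tcons_r_linear y).
Qed.

Lemma plus_cp_linear : linear (@plus_cp R M).
Proof.
apply: linear_addf; first apply: linear_addf; rewrite //.
  exact: cyc3_linear.
exact: linear_comp cyc3_linear cyc3_linear.
Qed.
Lemma plus_cp_cyc3 u : plus_cp (cyc3 u) = plus_cp u.
Proof. by rewrite /plus_cp cyc3K; abelian. Qed.
(** Two transpositions differ by a cyclic permutation, which the cyclic sum does not see. *)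
Lemma plus_cp_swap u : plus_cp (swap12 u) = plus_cp (swap23 u).
Proof. by rewrite /swap12 !plus_cp_cyc3. Qed.

Section Cobracket.
Variable phi : M -> M2.
Hypothesis lphi : linear phi.

Lemma delta_id_bilinear : bilinear_map (fun x y => tcons_r y (phi x)).
Proof. exact: bilinear_comp lphi (@id_linear _ M) (bilinear_swap tcons_r_bilinear). Qed.
Lemma delta_id_linear : linear (delta_id phi).
Proof. exact/tlift_is_linear/delta_id_bilinear. Qed.
Lemma delta_id_pure x y : delta_id phi (x ⊗ y) = tcons_r y (phi x).
Proof. by rewrite /delta_id tlift_pure //; apply: delta_id_bilinear. Qed.

Definition id_delta : M2 -> M3 := tmap (fun x => x) phi.
Lemma id_delta_linear : linear id_delta.
Proof. exact: tmap_linear (@id_linear _ M) lphi. Qed.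
Lemma id_delta_pure x y : id_delta (x ⊗ y) = x ⊗ phi y.
Proof. by rewrite /id_delta tmap_pure. Qed.
Lemma delta_id_flip t : delta_id phi (tflip t) = cyc3 (id_delta t).
Proof.
move: t; apply: tens_linear_ext => [||x y].
- exact: linear_comp tflip_linear delta_id_linear.
- exact: linear_comp id_delta_linear cyc3_linear.
by rewrite tflip_pure delta_id_pure id_delta_pure cyc3_cons.
Qed.
Lemma swap12_delta_id t : (forall x, tflip (phi x) = phi x) ->
  swap12 (delta_id phi t) = delta_id phi t.
Proof.
move=> cophi; move: t; apply: tens_linear_ext => [||x y].
- exact: linear_comp delta_id_linear swap12_linear.
- exact: delta_id_linear.
by rewrite delta_id_pure swap12_cons_r cophi.
Qed.
Lemma swap23_id_delta t : (forall x, tflip (phi x) = phi x) ->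
  swap23 (id_delta t) = id_delta t.
Proof.
move=> cophi; move: t; apply: tens_linear_ext => [||x y].
- exact: linear_comp id_delta_linear swap23_linear.
- exact: id_delta_linear.
by rewrite id_delta_pure swap23_cons cophi.
Qed.
End Cobracket.
End TensorPowers.

Section Naturality.
Variables (R : comNzRingType) (M N : lmodType R) (f : M -> N).
Hypothesis lf : linear f.
Local Notation f2 := (tmap f f).
Local Notation f3 := (tmap f f2).

Lemma tmap2_linear : linear f2. Proof. exact: tmap_linear. Qed.
Lemma tmap3_linear : linear f3. Proof. exact: tmap_linear lf tmap2_linear. Qed.
Lemma tmap3_pure x y z : f3 (x ⊗ (y ⊗ z)) = f x ⊗ (f y ⊗ f z).
Proof. by rewrite tmap_pure ?tmap_pure //; apply: tmap2_linear. Qed.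

Lemma tflip_tmap t : tflip (f2 t) = f2 (tflip t).
Proof.
move: t; apply: tens_linear_ext => [||x y].
- exact: linear_comp tmap2_linear (@tflip_linear _ _).
- exact: linear_comp (@tflip_linear _ _) tmap2_linear.
by rewrite !(tmap_pure, tflip_pure).
Qed.

Lemma tcons_r_tmap y t : tcons_r (f y) (f2 t) = f3 (tcons_r y t).
Proof.
move: t; apply: tens_linear_ext => [||a b].
- exact: linear_comp tmap2_linear (tcons_r_linear _).
- exact: linear_comp (tcons_r_linear _) tmap3_linear.
by rewrite tmap_pure // !tcons_r_pure tmap3_pure.
Qed.

Lemma cyc3_tmap u : cyc3 (f3 u) = f3 (cyc3 u).
Proof.
move: u; apply: tens3_linear_ext => [||x y z].
- exact: linear_comp tmap3_linear (@cyc3_linear _ _).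
- exact: linear_comp (@cyc3_linear _ _) tmap3_linear.
by rewrite tmap3_pure !cyc3_pure tmap3_pure.
Qed.

Lemma plus_cp_tmap u : plus_cp (f3 u) = f3 (plus_cp u).
Proof. by rewrite /plus_cp !cyc3_tmap !(lin_add tmap3_linear). Qed.

Lemma delta_id_tmap (phi : M -> tens M M) (psi : N -> tens N N) t :
  linear phi -> linear psi -> (forall x, psi (f x) = f2 (phi x)) ->
  delta_id psi (f2 t) = f3 (delta_id phi t).
Proof.
move=> lp lq E; move: t; apply: tens_linear_ext => [||x y].
- exact: linear_comp tmap2_linear (delta_id_linear lq).
- exact: linear_comp (delta_id_linear lp) tmap3_linear.
by rewrite tmap_pure // !delta_id_pure // E tcons_r_tmap.
Qed.

Section Retraction.
Variable e : N -> M.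
Hypotheses (le : linear e) (fK : forall x, e (f x) = x).

Lemma tmap2_retract t : tmap e e (f2 t) = t.
Proof.
rewrite tmap_comp // -[RHS]tmap_id; exact: eq_tmap.
Qed.

(** A linear retraction splits all tensor powers of f by functoriality, without any choice of
    bases. *)
Lemma tmap3_inj u v : f3 u = f3 v -> u = v.
Proof.
move=> /(congr1 (tmap e (tmap e e))); rewrite !tmap_comp //; try exact: tmap_linear.
by rewrite !(eq_tmap _ fK tmap2_retract) !tmap_id.
Qed.
End Retraction.
End Naturality.

(** * Multiplication and legs in tensor powers of an algebra *)

Section TensorAlgebras.
Variables (R : comNzRingType) (A : algType R).

Definition atens2 := tens A A.
Definition atens3 := tens A (tens A A).
HB.instance Definition _ := GRing.Lmodule.on atens2.
HB.instance Definition _ := GRing.Lmodule.on atens3.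

Let alg2 : alg_struct atens2 := tens_alg (alg_of A) (alg_of A).
Let alg3 : alg_struct atens3 := tens_alg (alg_of A) alg2.

HB.instance Definition _ := GRing.Zmodule_isPzRing.Build atens2
  (alg_mulA alg2) (alg_mul1 alg2) (alg_1mul alg2) (alg_mulDl alg2) (alg_mulDr alg2).
HB.instance Definition _ := GRing.Zmodule_isPzRing.Build atens3
  (alg_mulA alg3) (alg_mul1 alg3) (alg_1mul alg3) (alg_mulDl alg3) (alg_mulDr alg3).

Implicit Types (a b c : A) (s t : atens2) (u v : atens3).

Lemma tens_mul_pure (P Q : lmodType R) (sP : alg_struct P) (sQ : alg_struct Q) x y x' y' :
  alg_mul (tens_alg sP sQ) (x ⊗ y) (x' ⊗ y') = alg_mul sP x x' ⊗ alg_mul sQ y y'.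
Proof.
have [Pl Pr] := alg_bilinear sP; have [Ql Qr] := alg_bilinear sQ.
rewrite /= /tens_mul !tlift_pure //.
  exact: tmap_bilinear (Pr x) (Qr y).
apply: tlift_bilinear_map => [a b|a b]; first exact: tmap_bilinear (Pr a) (Qr b).
exact: tmap_bilinear (Pl a) (Ql b).
Qed.

Lemma atens2_bilinear : bilinear_map (fun s t => s * t).
Proof. exact: (alg_bilinear alg2). Qed.
Lemma atens3_bilinear : bilinear_map (fun u v => u * v).
Proof. exact: (alg_bilinear alg3). Qed.
Lemma atens2_mulE a b a' b' : (a ⊗ b : atens2) * (a' ⊗ b' : atens2) = (a * a') ⊗ (b * b').
Proof. exact: (tens_mul_pure (alg_of A) (alg_of A)). Qed.
Lemma atens3_mul_cons a s a' s' :
  (a ⊗ s : atens3) * (a' ⊗ s' : atens3) = (a * a') ⊗ (s * s').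
Proof. exact: (tens_mul_pure (alg_of A) alg2). Qed.
Lemma atens3_mulE a b c a' b' c' :
  (a ⊗ (b ⊗ c) : atens3) * (a' ⊗ (b' ⊗ c') : atens3) = (a * a') ⊗ ((b * b') ⊗ (c * c')).
Proof. by rewrite atens3_mul_cons; congr (_ ⊗ _); apply: atens2_mulE. Qed.

Section BilinearExt.
Variables (P Q : lmodType R).

Lemma tens_bilinear_ext (B1 B2 : tens A A -> tens A A -> P) :
  bilinear_map B1 -> bilinear_map B2 ->
  (forall a b a' b', B1 (a ⊗ b) (a' ⊗ b') = B2 (a ⊗ b) (a' ⊗ b')) ->
  forall s t, B1 s t = B2 s t.
Proof.
move=> [l1 r1] [l2 r2] E s t; move: s.
apply: tens_linear_ext; [exact: l1 | exact: l2 | move=> a b].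
by move: t; apply: tens_linear_ext; [exact: r1 | exact: r2 | move=> a' b'; apply: E].
Qed.

Lemma tens3_bilinear_ext (B1 B2 : tens A (tens A A) -> tens A (tens A A) -> P) :
  bilinear_map B1 -> bilinear_map B2 ->
  (forall a b c a' b' c',
     B1 (a ⊗ (b ⊗ c)) (a' ⊗ (b' ⊗ c')) = B2 (a ⊗ (b ⊗ c)) (a' ⊗ (b' ⊗ c'))) ->
  forall u v, B1 u v = B2 u v.
Proof.
move=> [l1 r1] [l2 r2] E u v; move: u.
apply: tens3_linear_ext; [exact: l1 | exact: l2 | move=> a b c].
by move: v; apply: tens3_linear_ext; [exact: r1 | exact: r2 | move=> a' b' c'; apply: E].
Qed.
End BilinearExt.

Lemma atens2_morph2 (h : atens2 -> atens2) : linear h ->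
  (forall a b a' b', h ((a * a') ⊗ (b * b')) = h (a ⊗ b) * h (a' ⊗ b')) ->
  forall s t, h (s * t) = h s * h t.
Proof.
move=> lh E; apply: tens_bilinear_ext => [||a b a' b'].
- exact: linear_bilinear lh atens2_bilinear.
- exact: (bilinear_comp lh lh atens2_bilinear).
by rewrite -E -atens2_mulE.
Qed.

Lemma atens3_morph3 (h : atens3 -> atens3) : linear h ->
  (forall a b c a' b' c', h ((a * a') ⊗ ((b * b') ⊗ (c * c')))
     = h (a ⊗ (b ⊗ c)) * h (a' ⊗ (b' ⊗ c'))) ->
  forall u v, h (u * v) = h u * h v.
Proof.
move=> lh E; apply: tens3_bilinear_ext => [||a b c a' b' c'].
- exact: linear_bilinear lh atens3_bilinear.
- exact: (bilinear_comp lh lh atens3_bilinear).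
by rewrite -E -atens3_mulE.
Qed.

Lemma tflipM s t : tflip (s * t) = (tflip s : atens2) * (tflip t : atens2).
Proof.
apply: (@atens2_morph2 (@tflip R A)) => [|a b a' b']; first exact: tflip_linear.
by rewrite !tflip_pure atens2_mulE.
Qed.
Lemma cyc3M u v : cyc3 (u * v) = (cyc3 u : atens3) * (cyc3 v : atens3).
Proof.
apply: (@atens3_morph3 (@cyc3 R A)) => [|a b c a' b' c']; first exact: cyc3_linear.
by rewrite !cyc3_pure atens3_mulE.
Qed.
Lemma swap23M u v : swap23 (u * v) = (swap23 u : atens3) * (swap23 v : atens3).
Proof.
apply: (@atens3_morph3 (@swap23 R A)) => [|a b c a' b' c']; first exact: swap23_linear.
by rewrite !swap23_pure atens3_mulE.
Qed.
Lemma swap12M u v : swap12 (u * v) = (swap12 u : atens3) * (swap12 v : atens3).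
Proof. by rewrite /swap12 swap23M !cyc3M. Qed.

Definition aleg12 (t : atens2) : atens3 := tcons_r 1 t.
Definition aleg23 (t : atens2) : atens3 := (1 : A) ⊗ t.
Definition aleg13 (t : atens2) : atens3 := swap23 (aleg12 t).

Lemma aleg12_linear : linear aleg12. Proof. exact: tcons_r_linear. Qed.
Lemma aleg23_linear : linear aleg23. Proof. exact: tpure_linear_r. Qed.
Lemma aleg13_linear : linear aleg13.
Proof. exact: linear_comp aleg12_linear (@swap23_linear _ _). Qed.
Lemma aleg12_pure a b : aleg12 (a ⊗ b) = a ⊗ (b ⊗ 1). Proof. exact: tcons_r_pure. Qed.
Lemma aleg13_pure a b : aleg13 (a ⊗ b) = a ⊗ ((1 : A) ⊗ b).
Proof. by rewrite /aleg13 aleg12_pure swap23_pure. Qed.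
Lemma aleg23N t : aleg23 (- t) = - aleg23 t. Proof. exact: lin_opp aleg23_linear _. Qed.
Lemma aleg13N t : aleg13 (- t) = - aleg13 t. Proof. exact: lin_opp aleg13_linear _. Qed.

Lemma cyc3_leg23 t : cyc3 (aleg23 t) = aleg12 t. Proof. exact: cyc3_cons. Qed.
Lemma swap23_leg23 t : swap23 (aleg23 t) = aleg23 (tflip t).
Proof. exact: swap23_cons. Qed.
Lemma swap12_leg12 t : swap12 (aleg12 t) = aleg12 (tflip t).
Proof. exact: swap12_cons_r. Qed.
Lemma cyc3_leg12 t : cyc3 (aleg12 t) = aleg13 (tflip t).
Proof.
move: t; apply: tens_linear_ext => [||a b].
- exact: linear_comp aleg12_linear (@cyc3_linear _ _).
- exact: linear_comp (@tflip_linear _ _) aleg13_linear.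
by rewrite aleg12_pure cyc3_pure tflip_pure aleg13_pure.
Qed.
Lemma cyc3_leg13 t : cyc3 (aleg13 t) = aleg23 (tflip t).
Proof.
move: t; apply: tens_linear_ext => [||a b].
- exact: linear_comp aleg13_linear (@cyc3_linear _ _).
- exact: linear_comp (@tflip_linear _ _) aleg23_linear.
by rewrite aleg13_pure cyc3_pure tflip_pure.
Qed.
Lemma acyc3D u v : cyc3 (u + v) = (cyc3 u : atens3) + cyc3 v.
Proof. exact: lin_add (@cyc3_linear _ A) u v. Qed.
Lemma acyc3N u : cyc3 (- u) = - (cyc3 u : atens3).
Proof. exact: lin_opp (@cyc3_linear _ A) u. Qed.
End TensorAlgebras.

(** * First and second order consequences of the twist equation *)

Section InfinitesimalTwist.
Variables (R : comNzRingType) (A : algType R) (Delta : A -> tens A A).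
Hypotheses (lD : linear Delta) (coD : forall x, tflip (Delta x) = Delta x).
Variable K : atens2 A.
Hypothesis cocycle : aleg12 K + delta_id Delta K = aleg23 K + id_delta Delta K.

Let t : atens2 A := K - tflip K.
Let flip_t : tflip t = - t :> atens2 A.
Proof. by rewrite /t tflipD tflipN tflipK opprB addrC. Qed.

(** Three forms of the cocycle equation are combined: the equation itself, its cyclic permutation
    and its image under the transposition of the last two factors. Cocommutativity absorbs the
    transpositions of the factors created by Delta, and only the legs of t survive. *)
Lemma cocycle_antisym_primitive : delta_id Delta t = aleg13 t + aleg23 t.
Proof.
have PD x y : delta_id Delta (x - y) = delta_id Delta x - delta_id Delta y.
  exact: lin_sub (delta_id_linear lD) x y.
have L13 x y : aleg13 (x - y : atens2 A) = aleg13 x - aleg13 y.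
  exact: lin_sub (@aleg13_linear _ A) x y.
have L23 x y : aleg23 (x - y : atens2 A) = aleg23 x - aleg23 y.
  exact: lin_sub (@aleg23_linear _ A) x y.
rewrite /t PD L13 L23 (delta_id_flip lD).
have E : delta_id Delta K = aleg23 K + id_delta Delta K - aleg12 K.
  by rewrite -cocycle; abelian.
have E' : cyc3 (id_delta Delta K) = cyc3 (aleg12 K) + cyc3 (delta_id Delta K) - aleg12 K.
  rewrite -(lin_add (@cyc3_linear _ A)) cocycle (lin_add (@cyc3_linear _ A)) cyc3_leg23.
  by abelian.
have E'' : id_delta Delta K = aleg13 K + cyc3 (delta_id Delta K) - aleg23 (tflip K).
  rewrite -{1}(swap23_id_delta lD K coD) -(swap12_delta_id lD K coD) cyc3_swap12.
  rewrite /aleg13 -(lin_add (@swap23_linear _ A)) cocycle (lin_add (@swap23_linear _ A)).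
  by rewrite swap23_leg23; abelian.
by rewrite E' {1}E E'' cyc3_leg12; abelian.
Qed.

Let P : atens3 A := delta_id Delta K.
Let N : atens3 A := id_delta Delta K.
Let Q : atens3 A := aleg12 K * P - aleg23 K * N.
Definition lie_bracket3 (x y : atens3 A) : atens3 A := x * y - y * x.

(** P and N are symmetric in the two factors created by Delta, so alternating replaces K by t in
    front of them. A cyclic permutation brings both products to the form t12 (Delta (x) id)(-), and
    primitivity of t expands the cyclic sum into six products, which pair into three commutators. *)
Lemma cocycle_second_order : plus_cp (Q - swap12 Q) =
  lie_bracket3 (aleg12 t) (aleg13 t) + lie_bracket3 (aleg12 t) (aleg23 t)
  + lie_bracket3 (aleg13 t) (aleg23 t).
Proof.
have ls := @swap12_linear _ A; have lp := @plus_cp_linear _ A.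
have E1 : plus_cp (aleg12 K * P - swap12 (aleg12 K * P)) = plus_cp (aleg12 t * P).
  rewrite swap12M swap12_leg12 (swap12_delta_id lD K coD : swap12 P = P) -mulrBl.
  by rewrite -(lin_sub (@aleg12_linear _ A)).
have E2 : plus_cp (aleg23 K * N - swap12 (aleg23 K * N))
        = plus_cp (aleg12 t * (delta_id Delta (tflip K) : atens3 A)).
  rewrite (lin_sub lp) plus_cp_swap swap23M swap23_leg23 (swap23_id_delta lD K coD : swap23 N = N).
  rewrite -(lin_sub lp).
  rewrite -(@mulrBl (atens3 A)) -(lin_sub (@aleg23_linear _ A)).
  by rewrite -plus_cp_cyc3 cyc3M cyc3_leg23 delta_id_flip.
have -> : plus_cp (Q - swap12 Q) = plus_cp (aleg12 t * (aleg13 t + aleg23 t)).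
  have D : aleg12 t * (delta_id Delta t : atens3 A)
         = aleg12 t * P - aleg12 t * (delta_id Delta (tflip K) : atens3 A).
    by rewrite -mulrBr; congr (_ * _); apply: lin_sub (delta_id_linear lD) _ _.
  transitivity (plus_cp (aleg12 t * P)
              - plus_cp (aleg12 t * (delta_id Delta (tflip K) : atens3 A))).
    rewrite -E1 -E2 -(lin_sub lp); congr plus_cp; rewrite /Q (lin_sub ls).
    by abelian.
  by rewrite -cocycle_antisym_primitive D; symmetry; apply: (lin_sub lp).
(* Antisymmetry of t makes the cyclic permutation send t12 to - t13, t13 to - t23 and t23 to t12;
   the signs produce the commutators. *)
pose a : atens3 A := aleg12 t; pose b : atens3 A := aleg13 t; pose c : atens3 A := aleg23 t.
have ca : cyc3 a = - b :> atens3 A by rewrite /a cyc3_leg12 flip_t aleg13N.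
have cb : cyc3 b = - c :> atens3 A by rewrite /b cyc3_leg13 flip_t aleg23N.
have cc : cyc3 c = a :> atens3 A by rewrite /c cyc3_leg23.
have c1 : cyc3 (a * (b + c)) = b * c - b * a :> atens3 A.
  by rewrite cyc3M acyc3D ca cb cc mulNr mulrDr mulrN opprD opprK addrC.
have c2 : cyc3 (b * c - b * a) = - (c * a) - c * b :> atens3 A.
  by rewrite acyc3D acyc3N !cyc3M ca cb cc !mulNr mulrN opprK addrC.
rewrite /plus_cp -/a -/b -/c c1 c2 /lie_bracket3 mulrDr.
by abelian.
Qed.
End InfinitesimalTwist.

(** * Bi-primitive tensors in the enveloping algebra *)

Section SubspaceOfPolynomials.
Variables (K : fieldType) (V : lmodType K) (W : V -> Prop).
Hypotheses (char0 : [pchar K] =i pred0) (W0 : W 0).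
Hypothesis WD : forall c u v, W u -> W v -> W (c *: u + v).

Lemma subspace_add u v : W u -> W v -> W (u + v).
Proof. by move=> Wu Wv; rewrite -[u]scale1r; apply: WD. Qed.
Lemma subspace_scale c u : W u -> W (c *: u).
Proof. by move=> Wu; rewrite -[_ *: u]addr0; apply: WD. Qed.
Lemma subspace_sum I (r : seq I) (F : I -> V) :
  (forall i, W (F i)) -> W (\sum_(i <- r) F i).
Proof. by move=> WF; elim/big_ind: _ => // *; apply: subspace_add. Qed.

Lemma exp2_inj_char0 m n : (2 ^+ m : K) = 2 ^+ n -> m = n.
Proof.
rewrite -!natrX => E; have [mn|nm|mn] := ltngtP (2 ^ m)%N (2 ^ n)%N; last first.
- by apply/eqP; rewrite -(eqn_exp2l _ _ (isT : 1 < 2)%N) mn.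
- have : ((2 ^ m - 2 ^ n)%N%:R : K) == 0 by rewrite natrB ?E ?subrr // ltnW.
  by move/pcharf0P: char0 => ->; rewrite subn_eq0 leqNgt nm.
have : ((2 ^ n - 2 ^ m)%N%:R : K) == 0 by rewrite natrB ?E ?subrr // ltnW.
by move/pcharf0P: char0 => ->; rewrite subn_eq0 leqNgt mn.
Qed.

(* p(2s) - 2^n p(s) has no term of degree n. *)
Lemma subspace_coef n (w : nat -> V) :
  (forall s : K, W (\sum_(j < n) s ^+ j *: w j)) -> forall j, (j < n)%N -> W (w j).
Proof.
elim: n w => // n IH w Ww.
have Wlt j : (j < n)%N -> W (w j).
  move=> jn; have nz : 2 ^+ j - 2 ^+ n != 0 :> K.
    by rewrite subr_eq0; apply: contraTneq jn => /exp2_inj_char0 ->; rewrite ltnn.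
  rewrite -[w j]scale1r -(mulVf nz) -scalerA; apply: subspace_scale.
  apply: (IH (fun j => (2 ^+ j - 2 ^+ n) *: w j)) => // s.
  have := WD (- 2 ^+ n) (Ww s) (Ww (2 * s)).
  rewrite !big_ord_recr /= scalerDr addrACA scaler_sumr -big_split /=.
  rewrite [X in _ + X](_ : _ = 0); last first.
    by rewrite exprMn scalerA -scalerDl mulNr addNr scale0r.
  rewrite addr0; congr (W _); apply: eq_bigr => i _.
  by rewrite !scalerA -scalerDl exprMn mulNr mulrBr addrC mulrC [2 ^+ n * _]mulrC.
move=> j; rewrite ltnS leq_eqVlt => /predU1P [->|]; last exact: Wlt.
have := Ww 1; rewrite big_ord_recr /= expr1n scale1r => W1.
rewrite -[w n](addKr (\sum_(i < n) 1 ^+ i *: w i)) -scaleN1r; apply: WD => //.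
by apply: subspace_sum => i; apply/subspace_scale/Wlt.
Qed.
End SubspaceOfPolynomials.

(** * Symmetrization: products in the span of powers *)

Section Powers.
Variables (K : fieldType) (A : algType K) (L : A -> Prop).
Hypothesis char0 : [pchar K] =i pred0.
Hypothesis LD : forall (c : K) x y, L x -> L y -> L (c *: x + y).
Hypothesis Lbr : forall x y, L x -> L y -> L (x * y - y * x).

Variable W : A -> Prop.
Hypothesis W0 : W 0.
Hypothesis WD : forall (c : K) u v, W u -> W v -> W (c *: u + v).
Hypothesis WX : forall x n, L x -> W (x ^+ n).

(** This is the coefficient of s in (y + s x)^(n+1), a polynomial in s whose values all lie in W. *)
Lemma span_polarize x y n : L x -> L y -> W (\sum_(i < n.+1) y ^+ i * x * y ^+ (n - i)).
Proof.
move=> Lx Ly; pose P n (w : nat -> A) := forall s : K,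
  (y + s *: x) ^+ n = \sum_(j < n.+2) s ^+ j *: w j.
suff [w [Pw <-]] : exists w, P n.+1 w /\
    w 1%N = \sum_(i < n.+1) y ^+ i * x * y ^+ (n - i).
  apply: (@subspace_coef _ _ _ char0 W0 WD n.+3) => // s; rewrite -Pw.
  by apply: WX; rewrite addrC; apply: LD.
elim: n => [|n [w [Pw w1]]].
  exists (fun j => if j is 0%N then y else if j is 1%N then x else 0); split.
    move=> s; rewrite !big_ord_recl big_ord0 /= expr1 expr0 scale1r expr1.
    by rewrite scaler0 !addr0.
  by rewrite big_ord1 expr0 mul1r mulr1.
have w0 : w 0%N = y ^+ n.+1.
  have := Pw 0; rewrite scale0r addr0 => ->.
  rewrite big_ord_recl /= expr0 scale1r big1 ?addr0 // => i _.
  by rewrite exprS mul0r scale0r.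
(* Coefficients of the product with y + s x. The factor (j < n.+3) discards the values of w beyond
   the range that [Pw] controls. *)
exists (fun j => w j * y * (j < n.+3)%:R + (if j is i.+1 then w i * x else 0)); split.
  move=> s; rewrite exprSr Pw mulrDr.
  rewrite [RHS](eq_bigr (fun j : 'I_n.+4 => s ^+ j *: (w j * y * (j < n.+3)%:R)
     + s ^+ j *: (if (j : nat) is i.+1 then w i * x else 0))); last first.
    by move=> j _; rewrite scalerDr.
  rewrite big_split /=; congr (_ + _).
    rewrite [RHS]big_ord_recr /= ltnn mulr0 scaler0 addr0 mulr_suml.
    by apply: eq_bigr => j _; rewrite ltn_ord mulr1 scalerAl.
  rewrite [RHS]big_ord_recl /= scaler0 add0r mulr_suml; apply: eq_bigr => j _.
  by rewrite -scalerAl -scalerAr scalerA exprSr.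
rewrite /= mulr1 w1 w0 [RHS]big_ord_recr /= subnn expr0 mulr1; congr (_ + _).
rewrite mulr_suml; apply: eq_bigr => i _.
by rewrite -mulrA -exprSr subSn // -ltnS.
Qed.

(** By induction on n = i + j. Moving x past one y costs a term with [y, x], which is in L, and with
    only n - 1 letters y; so modulo W all products with the same n agree. Their sum over i is in W
    by [span_polarize], and it is n + 1 times any of them modulo W. *)
Lemma span_powers_mul x y i j : L x -> L y -> W (y ^+ i * x * y ^+ j).
Proof.
move=> Lx Ly; have [n] := ubnP (i + j); elim: n => // n IH in x Lx i j *.
rewrite ltnS leq_eqVlt => /predU1P [ijn|]; last exact: IH.
have step l m : (l + m).+1 = n -> W (y ^+ l.+1 * x * y ^+ m - y ^+ l * x * y ^+ m.+1).
  move=> lmn; have -> : y ^+ l.+1 * x * y ^+ m - y ^+ l * x * y ^+ m.+1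
      = y ^+ l * (y * x - x * y) * y ^+ m.
    by rewrite mulrBr mulrBl exprSr exprS !mulrA.
  by apply: IH; rewrite ?lmn //; apply: Lbr.
have eqmod l : (l <= n)%N -> W (y ^+ l * x * y ^+ (n - l) - x * y ^+ n).
  elim: l => [|l IHl] ln; first by rewrite expr0 mul1r subn0 subrr.
  have := subspace_add WD (step l (n - l.+1)%N _) (IHl (ltnW ln)).
  rewrite subnSK // addrA subrK; apply.
  by rewrite -addnS subnSK // subnKC // ltnW.
have Wx : W (x * y ^+ n).
  have nz := natrS_neq0 n char0.
  rewrite -[x * _]scale1r -(mulVf nz) -scalerA; apply: subspace_scale => //.
  have -> : n.+1%:R *: (x * y ^+ n) = \sum_(i < n.+1) y ^+ i * x * y ^+ (n - i)
      + (-1) *: \sum_(i < n.+1) (y ^+ i * x * y ^+ (n - i) - x * y ^+ n).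
    by rewrite scaleN1r sumrB opprB addrC subrK sumr_const card_ord scaler_nat.
  apply: (subspace_add WD); first exact: span_polarize.
  apply: subspace_scale => //; apply: subspace_sum => // l.
  by apply: eqmod; rewrite -ltnS.
have := subspace_add WD (eqmod i _) Wx; rewrite subrK -ijn addKn; apply.
by rewrite leq_addr.
Qed.
End Powers.

(** * The enveloping algebra, its powers and its primitive elements *)

Section EnvelopingAlgebra.
Variables (K : fieldType) (g : lmodType K) (br : g -> g -> g).
Local Notation Ug := (uea br).
Local Notation iota := (@uea_in K g br).

Lemma uea_in_linear : linear iota.
Proof. by case: (uea_in_lie br). Qed.
Lemma uea_in_br x y : iota (br x y) = iota x * iota y - iota y * iota x.
Proof. by case: (uea_in_lie br). Qed.

Lemma uea_ind (S : Ug -> Prop) :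
  (forall c u v, S u -> S v -> S (c *: u + v)) -> S 0 -> S 1 ->
  (forall x u, S u -> S (iota x * u)) -> forall u, S u.
Proof.
move=> SD S0 S1 SM u; have -> : u = weval iota (repr u).
  apply: uea_ext => A f lf; rewrite /weval; set r := repr u.
  have -> : ulift f u = weval f r by [].
  rewrite /weval; elim: r => [|q r IH]; first by rewrite !big_nil (ulift_zero lf).
  rewrite !big_cons (ulift_add lf) -IH (ulift_scale lf); congr (_ *: _ + _).
  elim: q.2 => [|x w IHw]; first by rewrite !big_nil (ulift_one lf).
  by rewrite !big_cons (ulift_mul lf) (ulift_in lf) IHw.
rewrite /weval; elim: (repr u) => [|q r IH]; first by rewrite big_nil.
rewrite big_cons; apply: SD => //; elim: q.2 => [|x w IHw].
  by rewrite big_nil.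
by rewrite big_cons; apply: SM.
Qed.

Lemma ulift_linear (A : algType K) (f : g -> A) : lie_to_alg br f -> linear (@ulift _ _ br A f).
Proof. by move=> lf c u v; rewrite (ulift_add lf) (ulift_scale lf). Qed.

Lemma uea_cop_lie : lie_to_alg br (fun x => iota x ⊗ 1 + 1 ⊗ iota x : uea2 br).
Proof.
split=> [c x y|x y].
  rewrite uea_in_linear tpureDl tpureDr tpureZl tpureZr scalerDr.
  by rewrite addrACA.
have M (a b a' b' : Ug) : (a ⊗ b : uea2 br) * (a' ⊗ b' : uea2 br) = (a * a') ⊗ (b * b').
  exact: (tens_mul_pure (alg_of Ug) (alg_of Ug)).
have C : forall a b : Ug,
    (a ⊗ 1 + 1 ⊗ a : uea2 br) * (b ⊗ 1 + 1 ⊗ b : uea2 br)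
    = (a * b) ⊗ 1 + 1 ⊗ (a * b) + (a ⊗ b + b ⊗ a).
  move=> a b; rewrite mulrDl !mulrDr !M !mul1r !mulr1.
  by abelian.
rewrite !C uea_in_br tpureDl tpureDr tpureNl tpureNr.
by abelian.
Qed.

Lemma uea_cop_linear : linear (@uea_cop K g br).
Proof. exact: ulift_linear uea_cop_lie. Qed.

Lemma uea_cop_in x : uea_cop (iota x) = iota x ⊗ 1 + 1 ⊗ iota x.
Proof. exact: (ulift_in uea_cop_lie x). Qed.

Lemma uea_copM (u v : Ug) : uea_cop (u * v) = (uea_cop u : atens2 Ug) * (uea_cop v : atens2 Ug).
Proof. exact: (ulift_mul uea_cop_lie u v). Qed.

Lemma uea_cop1 : uea_cop (1 : Ug) = 1 :> atens2 Ug.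
Proof. exact: (ulift_one uea_cop_lie). Qed.

Lemma uea_cop_cocomm (u : Ug) : tflip (uea_cop u) = uea_cop u.
Proof.
elim/uea_ind: u => [c u v Eu Ev|||x u Eu].
- by rewrite uea_cop_linear tflip_linear Eu Ev.
- by rewrite (lin_zero uea_cop_linear) (lin_zero (@tflip_linear _ _)).
- by rewrite uea_cop1 tflip_pure.
by rewrite uea_copM tflipM Eu uea_cop_in tflipD !tflip_pure addrC.
Qed.

(* The second Adams operation: it has eigenvalue 2^n on n-th powers of
   elements of [g], and eigenvalue 2 on primitive elements. *)
Definition adams2 (u : Ug) : Ug := tlift (fun a b => a * b) (uea_cop u).

Lemma adams2_linear : linear adams2.
Proof. exact: linear_comp uea_cop_linear (tlift_is_linear (mul_bilinear _)). Qed.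

Lemma adams2_exp x n : adams2 (iota x ^+ n) = 2 ^+ n *: iota x ^+ n.
Proof.
have lm := tlift_is_linear (mul_bilinear Ug).
have E (a b : Ug) j : (a ⊗ b : atens2 Ug) ^+ j = (a ^+ j) ⊗ (b ^+ j).
  by elim: j => [|j IH]; rewrite ?expr0 // !exprS IH atens2_mulE.
have copX : uea_cop (iota x ^+ n) = (1 ⊗ iota x + iota x ⊗ 1 : atens2 Ug) ^+ n.
  elim: n => [|n IH]; first by rewrite !expr0 uea_cop1.
  by rewrite !exprS uea_copM IH uea_cop_in addrC.
have cx : GRing.comm (1 ⊗ iota x : atens2 Ug) (iota x ⊗ 1 : atens2 Ug).
  by rewrite /GRing.comm !atens2_mulE !mul1r !mulr1.
rewrite /adams2 copX (exprDn_comm _ cx) (lin_sum lm).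
have -> : (2 ^+ n : K) = \sum_(i < n.+1) 'C(n, i)%:R.
  rewrite -natrX -[2%N]/(1 + 1)%N expnDn natr_sum; apply: eq_bigr => i _.
  by rewrite !exp1n !muln1.
rewrite scaler_suml; apply: eq_bigr => i _.
rewrite !E atens2_mulE !expr1n mul1r mulr1 -scaler_nat (lin_scale lm) tlift_pure; last exact: mul_bilinear.
by rewrite -exprD subnKC // -ltnS.
Qed.

Hypothesis char0 : [pchar K] =i pred0.

(** The span of the powers contains 1 and is stable under left multiplication by g, by
    [span_powers_mul]. It is written as an intersection of subspaces so that the induction
    hypothesis applies to the preimage of a subspace under such a multiplication. *)
Lemma uea_powers_ind (W : Ug -> Prop) : W 0 ->
  (forall c u v, W u -> W v -> W (c *: u + v)) ->
  (forall x n, W (iota x ^+ n)) -> forall u, W u.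
Proof.
move=> W0 WD WX u.
pose span u := forall S : Ug -> Prop, S 0 ->
  (forall c u v, S u -> S v -> S (c *: u + v)) -> (forall x n, S (iota x ^+ n)) -> S u.
suff : span u by apply.
elim/uea_ind: u => [c u v su sv|||x u su] S S0 SD SX //.
- have := su S S0 SD SX; have := sv S S0 SD SX; move=> *; exact: SD.
- by rewrite -(expr0 (iota 0)); apply: SX.
apply: (su (fun u => S (iota x * u))) => [|c v w|y n]; first by rewrite mulr0.
  by rewrite mulrDr -scalerAr; apply: SD.
pose L (a : Ug) := exists z, a = iota z.
have := @span_powers_mul K Ug L char0 _ _ S S0 SD _ (iota x) (iota y) 0%N n.
rewrite mul1r; apply; try by eexists.
- by move=> c _ _ [a ->] [b ->]; exists (c *: a + b); rewrite uea_in_linear.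
- by move=> _ _ [a ->] [b ->]; exists (br a b); rewrite uea_in_br.
- by move=> _ m [a ->]; apply: SX.
Qed.

(* Interpolation in [adams2]: eventually projects onto the eigenvalue 2. *)
Fixpoint adams_proj (N : nat) (u : Ug) : Ug :=
  if N is M.+1 then
    (2 - 2 ^+ M.+2)^-1 *: (adams2 (adams_proj M u) - 2 ^+ M.+2 *: adams_proj M u)
  else adams2 u - u.

Let two_sub_exp_neq0 n : 2 - 2 ^+ n.+2 != 0 :> K.
Proof. by rewrite subr_eq0 -{1}[2]expr1; apply/eqP => /(exp2_inj_char0 char0). Qed.

Lemma adams_proj_linear N : linear (adams_proj N).
Proof.
have la := adams2_linear.
elim: N => [|N IH]; first exact: linear_subf la (@id_linear _ Ug).
apply: linear_comp (scale_linear _).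
exact: linear_subf (linear_comp IH la) (linear_comp IH (scale_linear _)).
Qed.

Lemma adams_proj_power N x n : (n <= N.+1)%N ->
  adams_proj N (iota x ^+ n) = if n == 1%N then iota x else 0.
Proof.
(* c(n) is the product of (2^n - 2^m) / (2 - 2^m) over m = 0, 2, 3, ..., N + 1: Lagrange
   interpolation at the eigenvalues, equal to 1 at n = 1. *)
have [c E1 [E2 E3]] : exists2 c : nat -> K,
    forall n, adams_proj N (iota x ^+ n) = c n *: iota x ^+ n
  & c 1%N = 1 /\ forall n, (n <= N.+1)%N -> n != 1%N -> c n = 0.
  elim: N => [|N [c E1 [E2 E3]]].
    exists (fun n => 2 ^+ n - 1) => [m|]; first by rewrite /= adams2_exp scalerBl scale1r.
    by split=> [|[|[]]] //; rewrite ?expr0 ?expr1 ?subrr // -{1}[2]/(1 + 1) addrK.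
  exists (fun n => (2 - 2 ^+ N.+2)^-1 * (c n * 2 ^+ n - 2 ^+ N.+2 * c n)) => [m|].
    rewrite /= E1 (lin_scale adams2_linear) adams2_exp !scalerA -scalerBl.
    by rewrite scalerA.
  split=> [|m]; first by rewrite E2 mul1r mulr1 expr1 mulVf.
  rewrite leq_eqVlt => /predU1P [->|mN] m1; last by rewrite E3 // mul0r mulr0 subrr mulr0.
  by rewrite mulrC [_ * c _]mulrC subrr mul0r.
move=> nN; rewrite E1; case: eqP => [->|/eqP n1]; first by rewrite E2 scale1r expr1.
by rewrite E3 // scale0r.
Qed.

(** N0 bounds the exponents in an expression of u by powers of elements of g; beyond it, only the
    linear terms survive. *)
Lemma adams_proj_lie u : exists N0, forall N, (N0 <= N)%N ->
  exists x, adams_proj N u = iota x.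
Proof.
elim/uea_powers_ind: u => [|c u v [N1 E1] [N2 E2]|x n].
- exists 0%N => N _; exists 0.
  by rewrite (lin_zero (adams_proj_linear N)) (lin_zero uea_in_linear).
- exists (maxn N1 N2) => N; rewrite geq_max => /andP [/E1 [x Ex] /E2 [y Ey]].
  by exists (c *: x + y); rewrite adams_proj_linear Ex Ey uea_in_linear.
exists n => N nN; rewrite adams_proj_power; last exact: leq_trans nN _.
case: eqP => _; first by exists x.
by exists 0; rewrite (lin_zero uea_in_linear).
Qed.

(** On the eigenspace 2 of [adams2] each factor (adams2 - 2^m) / (2 - 2^m) of the interpolation acts
    as the identity. *)
Lemma adams_proj_eigen N (t : atens2 Ug) :
  tmap adams2 (fun u => u) t = t + t -> tmap (adams_proj N) (fun u => u) t = t.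
Proof.
move=> tE; have la := adams2_linear; have li := @id_linear _ Ug.
have lp M := adams_proj_linear M.
elim: N => [|N IH].
  have -> : tmap (adams_proj 0) (fun u => u) t = tmap adams2 (fun u => u) t - t.
    move: (t); apply: tens_linear_ext => [||u v]; first exact: tmap_linear.
      exact: linear_subf (tmap_linear la li) (@id_linear _ _).
    by rewrite !tmap_pure // tpureDl tpureNl.
  by rewrite tE addrK.
have -> : tmap (adams_proj N.+1) (fun u => u) t = (2 - 2 ^+ N.+2)^-1 *:
    (tmap adams2 (fun u => u) (tmap (adams_proj N) (fun u => u) t)
     - 2 ^+ N.+2 *: tmap (adams_proj N) (fun u => u) t).
  rewrite (tmap_comp t (lp N) li la li); move: (t); apply: tens_linear_ext => [||u v].
  - exact: tmap_linear.
  - apply: linear_comp (scale_linear _); apply: linear_subf.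
      exact: tmap_linear (linear_comp (lp N) la) li.
    exact: linear_comp (tmap_linear (lp N) li) (scale_linear _).
  rewrite !tmap_pure //; last exact: linear_comp (lp N) la.
  by rewrite tpureZl tpureDl tpureNl tpureZl.
rewrite IH tE -mulr2n -scaler_nat -scalerBl scalerA mulVf ?scale1r //.
Qed.

(** The projections fix t in each factor, and for N large enough for the finitely many terms of t
    they map both factors into g. *)
Lemma adams_eigen_lie2 (t : atens2 Ug) :
  tmap adams2 (fun u => u) t = t + t -> tmap (fun u => u) adams2 t = t + t ->
  exists c, t = tmap iota iota c.
Proof.
move=> tl tr; have la := adams2_linear; have li := @id_linear _ Ug.
have lN N := adams_proj_linear N.
have [N0 EN] : exists N0, forall N, (N0 <= N)%N ->
    exists c, tmap (adams_proj N) (adams_proj N) t = tmap iota iota c.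
  have lt := tmap_linear uea_in_linear uea_in_linear.
  elim/tens_ind: t {tl tr} => [|u v t [N1 E1]].
    by exists 0%N => N _; exists 0; rewrite (lin_zero (tmap_linear (lN N) (lN N))) (lin_zero lt).
  have [N2 E2] := adams_proj_lie u; have [N3 E3] := adams_proj_lie v.
  exists (maxn N1 (maxn N2 N3)) => N.
  rewrite !geq_max => /and3P [/E1 [c Ec] /E2 [x Ex] /E3 [y Ey]].
  exists (x ⊗ y + c); rewrite (lin_add (tmap_linear (lN N) (lN N))) (lin_add lt).
  by rewrite Ec !tmap_pure ?Ex ?Ey //; apply: uea_in_linear.
have [c Ec] := EN N0 (leqnn _); exists c; rewrite -Ec.
have flipE (h : Ug -> Ug) s : linear h ->
    tmap (fun u => u) h s = tflip (tmap h (fun u => u) (tflip s)).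
  move=> lh; have lf := @tflip_linear _ Ug; move: s; apply: tens_linear_ext => [||u v].
  - exact: tmap_linear.
  - exact: linear_comp lf (linear_comp (tmap_linear lh li) lf).
  by rewrite tflip_pure !tmap_pure // tflip_pure.
have tfE : tmap adams2 (fun u => u) (tflip t) = tflip t + tflip t.
  by rewrite -tflipD -tr (flipE _ _ la) tflipK.
rewrite -(tmap_comp t li (lN N0) (lN N0) li).
by rewrite (flipE _ _ (lN N0)) (adams_proj_eigen _ tfE) tflipK adams_proj_eigen.
Qed.

(** Multiplying the first two factors of (Delta (x) id)(t) = t13 + t23 gives 2 t: the first factor
    is in the eigenspace 2 of [adams2]. Antisymmetry transfers this to the second factor. *)
Lemma bi_primitive_lie2 (t : atens2 Ug) :
  delta_id (@uea_cop K g br) t = aleg13 t + aleg23 t -> tflip t = - t ->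
  exists c, t = tmap iota iota c.
Proof.
move=> prim anti; have li := @id_linear _ Ug; have la := adams2_linear.
pose m12 (x : Ug) := tlift (fun y z : Ug => (x * y) ⊗ z).
have m12_bil x : bilinear_map (fun y z : Ug => (x * y) ⊗ z).
  exact: bilinear_comp ((mul_bilinear Ug).2 x) li (tpure_bilinear _ _).
have m12_bilinear : bilinear_map m12.
  apply: tlift2_bilinear => // y z.
  exact: linear_comp ((mul_bilinear Ug).1 y) (tpure_linear_l z).
have lm := tlift_is_linear m12_bilinear.
have mE x y z : tlift m12 (x ⊗ (y ⊗ z)) = (x * y) ⊗ z.
  by rewrite tlift_pure // /m12 tlift_pure.
have lc := uea_cop_linear.
have eigen s : delta_id (@uea_cop K g br) s = aleg13 s + aleg23 s ->
    tmap adams2 (fun u => u) s = s + s.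
  move=> sE; have -> : tmap adams2 (fun u => u) s = tlift m12 (delta_id (@uea_cop K g br) s).
    move: (s); apply: tens_linear_ext => [||u v]; first exact: tmap_linear.
      exact: linear_comp (delta_id_linear lc) lm.
    rewrite tmap_pure // delta_id_pure // /adams2; move: (uea_cop u).
    apply: tens_linear_ext => [||a b].
    - exact: linear_comp (tlift_is_linear (mul_bilinear Ug)) (tpure_linear_l v).
    - exact: linear_comp (tcons_r_linear v) lm.
    by rewrite tcons_r_pure mE tlift_pure //; apply: mul_bilinear.
  rewrite sE (lin_add lm); congr (_ + _); move: (s); apply: tens_linear_ext => // [|a b].
  - exact: linear_comp (@aleg13_linear _ _) lm.
  - by rewrite aleg13_pure mE mulr1.
  - exact: linear_comp (@aleg23_linear _ _) lm.
  - by rewrite mE mul1r.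
apply: adams_eigen_lie2; first exact: eigen.
have <- : - tflip t = t by rewrite anti opprK.
have lti := tmap_linear li la.
have -> : tmap (fun u => u) adams2 (- tflip t) = - tflip (tmap adams2 (fun u => u) t).
  rewrite (lin_opp lti); congr (- _); move: (t); apply: tens_linear_ext => [||a b].
  - exact: linear_comp (@tflip_linear _ _) lti.
  - exact: linear_comp (tmap_linear la li) (@tflip_linear _ _).
  by rewrite tflip_pure !tmap_pure // tflip_pure.
by rewrite eigen // tflipD opprD.
Qed.

(** * Lie operations on tensors, seen as commutators in U(g) *)

Section LieTensors.
Hypothesis lbr : bilinear_map br.
Let ll y : linear (br^~ y). Proof. exact: lbr.1. Qed.
Let lr x : linear (br x). Proof. exact: lbr.2. Qed.

Let F a b a' b' := br a a' ⊗ (b ⊗ b') + a ⊗ (br b a' ⊗ b') + a ⊗ (a' ⊗ br b b').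

Let F_bilinear_r a b : bilinear_map (F a b).
Proof.
have lp x := tpure_linear_r (M := g) (N := tens g g) x.
apply: bilinear_add; first apply: bilinear_add.
- exact: tmap_bilinear (lr a) (tpure_linear_r b).
- exact: linear_bilinear (lp a) (tmap_bilinear (lr b) (@id_linear _ g)).
- exact: linear_bilinear (lp a) (tmap_bilinear (@id_linear _ g) (lr b)).
Qed.

Let F_bilinear_l a' b' : bilinear_map (fun a b => F a b a' b').
Proof.
apply: bilinear_add; first apply: bilinear_add.
- exact: tmap_bilinear (ll a') (tpure_linear_l b').
- exact: tmap_bilinear (@id_linear _ g) (linear_comp (ll a') (tpure_linear_l b')).
- exact: tmap_bilinear (@id_linear _ g) (linear_comp (ll b') (tpure_linear_r a')).
Qed.

Lemma schouten_bilinear : bilinear_map (schouten br).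
Proof.
split=> [s|r]; first exact/tlift_is_linear/tlift_bilinear_map.
by apply: tlift_param_linear => a b; apply/tlift_is_linear/F_bilinear_r.
Qed.

Lemma schouten_pure a b a' b' : schouten br (a ⊗ b) (a' ⊗ b') = F a b a' b'.
Proof.
rewrite /schouten -/(F) tlift_pure ?tlift_pure //.
  exact: F_bilinear_r.
exact: tlift_bilinear_map F_bilinear_r F_bilinear_l.
Qed.

Lemma schouten_uea_in (r s : tens g g) :
  tmap iota (tmap iota iota) (schouten br r s) =
  lie_bracket3 (aleg12 (tmap iota iota r)) (aleg13 (tmap iota iota s))
  + lie_bracket3 (aleg12 (tmap iota iota r)) (aleg23 (tmap iota iota s))
  + lie_bracket3 (aleg13 (tmap iota iota r)) (aleg23 (tmap iota iota s)).
Proof.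
have lt := tmap2_linear uea_in_linear; have lt3 := tmap3_linear uea_in_linear.
have bb : bilinear_map (fun u v : atens3 Ug => lie_bracket3 u v).
  have [bl br3] := atens3_bilinear Ug.
  by split=> [v|u]; apply: linear_subf.
have B (f h : atens2 Ug -> atens3 Ug) : linear f -> linear h ->
    bilinear_map (fun r s : tens g g => lie_bracket3 (f (tmap iota iota r)) (h (tmap iota iota s))).
  by move=> lf lh; apply: bilinear_comp (linear_comp lt lf) (linear_comp lt lh) bb.
have l12 := @aleg12_linear _ Ug; have l13 := @aleg13_linear _ Ug; have l23 := @aleg23_linear _ Ug.
have [sl sr] := schouten_bilinear.
have [tl tr] := bilinear_add (bilinear_add (B _ _ l12 l13) (B _ _ l12 l23)) (B _ _ l13 l23).
move: r; apply: tens_linear_ext; [exact: linear_comp (sl s) lt3 | exact: tl | move=> a b].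
move: s; apply: tens_linear_ext; [exact: linear_comp (sr _) lt3 | exact: tr | move=> a' b'].
have li := uea_in_linear.
rewrite schouten_pure /F !(tmap_pure _ _ li li) !aleg12_pure !aleg13_pure /lie_bracket3.
rewrite /aleg23 !atens3_mulE !mul1r !mulr1 !(lin_add lt3) !tmap3_pure // !uea_in_br.
rewrite !(tpureDl, tpureDr, tpureNl, tpureNr).
by abelian.
Qed.

Lemma ad2_bilinear x : bilinear_map (fun a b => br x a ⊗ b + a ⊗ br x b).
Proof.
apply: bilinear_add; first exact: tmap_bilinear (lr x) (@id_linear _ g).
exact: tmap_bilinear (@id_linear _ g) (lr x).
Qed.
Lemma ad2_linear x : linear (ad2 br x).
Proof. exact/tlift_is_linear/ad2_bilinear. Qed.
Lemma ad2_pure x a b : ad2 br x (a ⊗ b) = br x a ⊗ b + a ⊗ br x b.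
Proof. by rewrite /ad2 tlift_pure //; apply: ad2_bilinear. Qed.
Lemma ad2_linear_l c : linear (fun x => ad2 br x c).
Proof.
move=> a x y; move: c; apply: tens_linear_ext => [||u v]; first exact: ad2_linear.
  exact: linear_addf (linear_comp (ad2_linear x) (scale_linear a)) (ad2_linear y).
rewrite !ad2_pure ll ll !(tpureDl, tpureDr, tpureZl, tpureZr) scalerDr.
by abelian.
Qed.
Lemma ad2_flip x c : tflip (ad2 br x c) = ad2 br x (tflip c).
Proof.
have lf := @tflip_linear _ g; move: c; apply: tens_linear_ext => [||u v].
- exact: linear_comp (ad2_linear x) lf.
- exact: linear_comp lf (ad2_linear x).
by rewrite tflip_pure !ad2_pure tflipD !tflip_pure addrC.
Qed.
Lemma ad3_linear x : linear (ad3 br x).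
Proof.
apply/tlift_is_linear/bilinear_add; first exact: tmap_bilinear (lr x) (@id_linear _ _).
exact: tmap_bilinear (@id_linear _ _) (ad2_linear x).
Qed.

Lemma ad2_uea_in x (c : tens g g) :
  tmap iota iota (ad2 br x c) =
  (uea_cop (iota x) : atens2 Ug) * (tmap iota iota c : atens2 Ug)
  - (tmap iota iota c : atens2 Ug) * (uea_cop (iota x) : atens2 Ug).
Proof.
have li := uea_in_linear; have lt := tmap2_linear li.
have [bl br2] := atens2_bilinear Ug.
move: c; apply: tens_linear_ext => [||a b].
- exact: linear_comp (ad2_linear x) lt.
- by apply: linear_subf; [exact: linear_comp lt (br2 _) | exact: linear_comp lt (bl _)].
rewrite ad2_pure uea_cop_in (lin_add lt) !(tmap_pure _ _ li li) !uea_in_br.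
rewrite (mulrDl (iota x ⊗ 1 : atens2 Ug)) (mulrDr (iota a ⊗ iota b : atens2 Ug)).
rewrite !atens2_mulE !mul1r !mulr1 !(tpureDl, tpureDr, tpureNl, tpureNr).
by abelian.
Qed.
End LieTensors.

Lemma ad2_lie x y c : is_lie br ->
  ad2 br (br x y) c = ad2 br x (ad2 br y c) - ad2 br y (ad2 br x c).
Proof.
move=> lie; have lbr : bilinear_map br by case: lie.
have la := ad2_linear lbr; move: c; apply: tens_linear_ext => [||a b]; first exact: la.
  exact: linear_subf (linear_comp (la y) (la x)) (linear_comp (la x) (la y)).
rewrite !(ad2_pure lbr) !(lin_add (la _)) !(ad2_pure lbr).
rewrite !(lie_jacobi lie x y) !(tpureDl, tpureDr).
by abelian.
Qed.
End EnvelopingAlgebra.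

(** * Completions *)

Definition hseparated (K : comNzRingType) (M : lmodType (fps K)) : Prop :=
  forall x y : M, (forall n, hcong n x y) -> x = y.

Section Congruences.
Variables (K : comNzRingType) (M N : lmodType (fps K)).

Lemma hcong_linear (f : M -> N) n x y : linear f -> hcong n x y -> hcong n (f x) (f y).
Proof. by move=> lf [z xy]; exists (f z); rewrite -(lin_sub lf) xy (lin_scale lf). Qed.

Lemma hcong0E n (x : M) : hcong n x 0 <-> exists y, x = hbar ^+ n *: y.
Proof. by split=> -[y xy]; exists y; [rewrite -xy subr0 | rewrite subr0]. Qed.

Lemma hcongN n (x y : M) : hcong n x y -> hcong n (- x) (- y).
Proof. by rewrite -[- x]scaleN1r -[- y]scaleN1r; apply: hcongZ. Qed.

Lemma hcongB n (x x' y y' : M) : hcong n x x' -> hcong n y y' -> hcong n (x - y) (x' - y').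
Proof. by move=> xx yy; apply: hcongD => //; apply: hcongN. Qed.

Lemma hcong_sub0 n (x y : M) : hcong n x y <-> hcong n (x - y) 0.
Proof. by split=> -[z E]; exists z; rewrite -E subr0. Qed.

Lemma hcong_scale m n (x y : M) : hcong n x y -> hcong (m + n) (hbar ^+ m *: x) (hbar ^+ m *: y).
Proof. by case=> z xy; exists z; rewrite exprD -scalerA -xy scalerBr. Qed.

Lemma hcong_cancel n (c x y x' y' : M) :
  hcong n (c + x + y) (c + x' + y') -> hcong n y y' -> hcong n x x'.
Proof. by case=> u E [v E']; exists (u - v); rewrite scalerBr -E -E'; abelian. Qed.

Lemma coherent_le (s : nat -> M) m n : coherent s -> (m <= n)%N -> hcong m (s n) (s m).
Proof.
move=> cs /subnK <-; elim: (n - m)%N => [|d IH]; first exact: hcong_refl.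
apply: hcong_trans IH; apply: hcong_le (cs (d + m)%N); exact: leq_addl.
Qed.
End Congruences.

Lemma hcong_bilinear (K : comNzRingType) (M N P : lmodType (fps K)) (f : M -> N -> P) n x x' y y' :
  bilinear_map f -> hcong n x x' -> hcong n y y' -> hcong n (f x y) (f x' y').
Proof.
move=> [fl fr] xx yy; apply: (@hcong_trans _ _ _ _ (f x' y)).
  exact: hcong_linear (fl y) xx.
exact: hcong_linear (fr x') yy.
Qed.

Section CompletionTheory.
Variables (K : comNzRingType) (T : lmodType (fps K)).
Local Notation C := (hcompl T).
Implicit Types (x y : C) (t u : T).

Lemma happroxD x y n : hcong n (happrox (x + y) n) (happrox x n + happrox y n).
Proof. exact: happrox_add. Qed.
Lemma happroxZ a x n : hcong n (happrox (a *: x) n) (a *: happrox x n).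
Proof. exact: happrox_scale. Qed.

Lemma happrox_sub x y n : hcong n (happrox (x - y) n) (happrox x n - happrox y n).
Proof.
apply: hcong_trans (happroxD _ _ _) (hcongD (hcong_refl _ _) _).
by rewrite -[- y]scaleN1r -[- happrox y n]scaleN1r; apply: happroxZ.
Qed.

Lemma hin_linear : linear (@hin K T).
Proof.
move=> a t u; apply: hcompl_ext => n; apply: hcong_trans (happrox_in _ _) _.
apply/hcong_sym/(hcong_trans (happroxD _ _ _)).
apply: hcongD (happrox_in _ _); apply: hcong_trans (happroxZ _ _ _) _.
exact/hcongZ/happrox_in.
Qed.

(* Summing the increments of a coherent sequence that vanishes modulo hbar^n
   exhibits its limit as a multiple of hbar^n. *)
Lemma happrox_hcong0 n x : hcong n (happrox x n) 0 -> exists y, x = hbar ^+ n *: y.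
Proof.
move=> /hcong0E [w xw]; have xc := happrox_coherent x.
have [d dE] := choice (fun m => xc (n + m)%N).
pose s m := w + \sum_(i < m) hbar ^+ i *: d i.
have cs : coherent s.
  by move=> m; exists (d m); rewrite /s big_ord_recr /= addrA [_ + _ *: _]addrC addrK.
have sE m : happrox x (n + m)%N = hbar ^+ n *: s m.
  elim: m => [|m IH]; first by rewrite addn0 xw /s big_ord0 addr0.
  rewrite /s big_ord_recr /= addrA scalerDr -/(s m) -IH scalerA -exprD.
  by rewrite -dE addnS addrC subrK.
exists (hmk s); apply: hcompl_ext => m; apply/hcong_sym.
apply: hcong_trans (happroxZ _ _ _) _; apply: hcong_trans (hcongZ _ (happrox_mk m cs)) _.
by rewrite -sE; apply: coherent_le => //; apply: leq_addl.
Qed.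

Lemma happrox_hcong n x y : hcong n x y <-> hcong n (happrox x n) (happrox y n).
Proof.
split=> [[z xy]|xy].
  apply/hcong_sub0; apply: hcong_trans (hcong_sym (happrox_sub _ _ _)) _.
  rewrite xy; apply: hcong_trans (happroxZ _ _ _) _.
  by exists (happrox z n); rewrite subr0.
have [z E] : exists z, x - y = hbar ^+ n *: z; last by exists z.
apply: happrox_hcong0; apply: hcong_trans (happrox_sub _ _ _) _.
exact: (hcong_sub0 n _ _).1.
Qed.

Lemma hcompl_separated : hseparated C.
Proof. by move=> x y xy; apply: hcompl_ext => n; apply/happrox_hcong. Qed.

Lemma hin_happrox x n : hcong n x (hin (happrox x n)).
Proof. exact/happrox_hcong/hcong_sym/happrox_in. Qed.

Lemma hcong_hin n t u : hcong n (hin t) (hin u) <-> hcong n t u.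
Proof.
split=> [/happrox_hcong tu|]; last exact: hcong_linear hin_linear.
exact: hcong_trans (hcong_sym (happrox_in t n)) (hcong_trans tu (happrox_in u n)).
Qed.

Lemma hcompl_complete (s : nat -> C) : coherent s -> exists x, forall n, hcong n x (s n).
Proof.
(* The diagonal sequence, as only the n-th approximation of [s n] matters modulo hbar^n. *)
move=> cs; pose r n := happrox (s n) n.
have cr : coherent r.
  move=> n; apply: hcong_trans (happrox_coherent (s n.+1) n) _.
  exact/happrox_hcong/cs.
exists (hmk r) => n; apply/happrox_hcong; exact: happrox_mk.
Qed.

Lemma hcompl_linear_ext (S : lmodType (fps K)) (h1 h2 : C -> S) : hseparated S ->
  linear h1 -> linear h2 -> (forall t, h1 (hin t) = h2 (hin t)) -> forall x, h1 x = h2 x.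
Proof.
move=> sS l1 l2 E x; apply: sS => n.
apply: hcong_eq (E (happrox x n)); exact/hcong_linear/hin_happrox.
Qed.

(** Meant for maps that factor through the reduction modulo hbar, where a single approximation
    decides; their target need not be a module over the power series. *)
Lemma hcompl_additive_ext (V : zmodType) (h1 h2 : C -> V) :
  {morph h1 : x y / x + y} -> {morph h2 : x y / x + y} ->
  (forall x, h1 (hbar *: x) = 0) -> (forall x, h2 (hbar *: x) = 0) ->
  (forall t, h1 (hin t) = h2 (hin t)) -> forall x, h1 x = h2 x.
Proof.
move=> a1 a2 k1 k2 E x; have [y] := hin_happrox x 1.
by move=> /(canRL (subrK _)) ->; rewrite expr1 a1 a2 k1 k2 E.
Qed.
End CompletionTheory.

Section Extension.
Variables (K : comNzRingType) (T P : lmodType (fps K)) (f : T -> hcompl P).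
Hypothesis lf : linear f.

Lemma hext_coherent x : coherent (fun n => happrox (f (happrox x n)) n).
Proof.
move=> n; apply: hcong_trans (happrox_coherent _ _) _.
exact/happrox_hcong/(hcong_linear lf)/happrox_coherent.
Qed.

Lemma hext_hcong n x : hcong n (hext f x) (f (happrox x n)).
Proof. by apply/happrox_hcong/happrox_mk/hext_coherent. Qed.

Lemma hext_hin t : hext f (hin t) = f t.
Proof.
apply: hcompl_separated => n; apply: hcong_trans (hext_hcong _ _) _.
exact/(hcong_linear lf)/happrox_in.
Qed.

Lemma hext_linear : linear (hext f).
Proof.
move=> a x y; apply: hcompl_separated => n; apply: hcong_trans (hext_hcong _ _) _.
apply: hcong_eq (hcongD (hcongZ a (hext_hcong n x)) (hext_hcong n y)) (lf _ _ _).
apply: (hcong_linear lf); apply: hcong_trans (happroxD _ _ _) _.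
exact: hcongD (happroxZ _ _ _) (hcong_refl _ _).
Qed.
End Extension.

(** * Power series modules *)

Section SeriesModules.
Variables (K : comNzRingType) (V : lmodType K).
Implicit Types (v w : vps V) (a : fps K).

Definition vcst (x : V) : vps V := fun n => if n is 0%N then x else 0.

Lemma vpsD v w n : (v + w) n = v n + w n. Proof. by []. Qed.
Lemma vpsN v n : (- v) n = - v n. Proof. by []. Qed.
Lemma vpsZ a v n : (a *: v) n = \sum_(i < n.+1) a i *: v (n - i)%N. Proof. by []. Qed.

Lemma hbarE n : (hbar : fps K) n = (n == 1%N)%:R. Proof. by []. Qed.

Lemma vps_hbar v n : (hbar *: v) n = if n is m.+1 then v m else 0.
Proof.
rewrite vpsZ; case: n => [|n]; first by rewrite big_ord1 hbarE scale0r.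
rewrite (bigD1 (Ordinal (isT : 1 < n.+2)%N)) //= hbarE scale1r subn1 /=.
rewrite big1 ?addr0 // => i i1; rewrite hbarE (_ : (i : nat) == 1%N = false) ?scale0r //.
by apply: contraNF i1 => /eqP i1; apply/eqP/val_inj.
Qed.

Lemma vps_hbarX m v n : (hbar ^+ m *: v) n = if (n < m)%N then 0 else v (n - m)%N.
Proof.
elim: m v n => [|m IH] v n; first by rewrite expr0 scale1r subn0.
by rewrite exprS -scalerA vps_hbar; case: n => [|n] //=; rewrite IH.
Qed.

Lemma vps_hcong m v w : hcong m v w <-> forall n, (n < m)%N -> v n = w n.
Proof.
split=> [[z vw] n nm|vw].
  by apply/eqP; rewrite -subr_eq0 -vpsN -vpsD vw vps_hbarX nm.
exists (fun n => v (n + m)%N - w (n + m)%N); apply/funext => n.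
rewrite vps_hbarX vpsD vpsN; case: ltnP => nm; first by rewrite vw // subrr.
by rewrite subnK.
Qed.

Lemma vps_scale0 a v : (a *: v) 0%N = a 0%N *: v 0%N.
Proof. by rewrite vpsZ big_ord1. Qed.

Lemma vps_fpsC c v n : (fpsC c *: v) n = c *: v n.
Proof.
rewrite vpsZ big_ord_recl subn0 /= big1 ?addr0 // => i _.
by rewrite /bump /= scale0r.
Qed.

End SeriesModules.

Section SeriesRing.
Variable K : comNzRingType.

Lemma fpsCM (a b : K) : fpsC (a * b) = fpsC a * fpsC b.
Proof.
apply/funext => n.
have -> : (fpsC a * fpsC b) n = a * fpsC b n := vps_fpsC (V := K^o) a (fpsC b) n.
by case: n => //= n; rewrite mulr0.
Qed.
Lemma fpsCD (a b : K) : fpsC (a + b) = fpsC a + fpsC b.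
Proof. by apply/funext => -[|n] //; rewrite [RHS]/GRing.add /= /fps_add /= addr0. Qed.
Lemma fpsC1 : fpsC (1 : K) = 1. Proof. by []. Qed.
Lemma fpsC0 : fpsC (0 : K) = 0. Proof. by []. Qed.
End SeriesRing.

(** * Flatness of tensor products *)

(* The restriction of scalars of an R[[hbar]]-module to R. *)
Definition restr (K : comNzRingType) (M : lmodType (fps K)) : Type := M.

Section Restriction.
Variables (K : comNzRingType) (M : lmodType (fps K)).
HB.instance Definition _ := GRing.Zmodule.on (restr M).

Definition restr_scale (a : K) (x : restr M) : restr M := fpsC a *: (x : M).
Fact restr_scaleA a b x : restr_scale a (restr_scale b x) = restr_scale (a * b) x.
Proof. by rewrite /restr_scale scalerA fpsCM. Qed.
Fact restr_scale1 : left_id 1 restr_scale.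
Proof. by move=> x; apply: scale1r. Qed.
Fact restr_scaleDr : right_distributive restr_scale +%R.
Proof. by move=> a x y; apply: scalerDr. Qed.
Fact restr_scaleDl x : {morph restr_scale^~ x : a b / a + b}.
Proof. by move=> a b; rewrite /restr_scale fpsCD scalerDl. Qed.
HB.instance Definition _ := GRing.Zmodule_isLmodule.Build K (restr M)
  restr_scaleA restr_scale1 restr_scaleDr restr_scaleDl.

Lemma restrZ (a : K) (x : M) : a *: (x : restr M) = fpsC a *: x. Proof. by []. Qed.
End Restriction.

(* [M] is, up to completion, free with reduction modulo hbar [pi] onto [V]. *)
Definition hfree (K : comNzRingType) (M : lmodType (fps K)) (V : lmodType K)
    (pi : M -> V) : Prop :=
  exists (phi : M -> vps V) (j : V -> restr M),
  [/\ linear phi, linear j, forall x, phi x 0%N = pi x & forall x, hcong 1 x (j (pi x) : M)].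

Section Cauchy.
Variables (K : comNzRingType) (V W : lmodType K).

Definition cauchy (v : vps V) (w : vps W) : vps (tens V W) :=
  fun n => \sum_(i < n.+1) v i ⊗ w (n - i)%N.

Lemma cauchy_rev v w n : cauchy v w n = \sum_(i < n.+1) v (n - i)%N ⊗ w i.
Proof.
rewrite /cauchy (reindex_inj rev_ord_inj) /=; apply: eq_bigr => i _.
by rewrite subSS subKn -1?ltnS.
Qed.

Lemma cauchyDl v v' w : cauchy (v + v') w = cauchy v w + cauchy v' w.
Proof.
apply/funext => n; rewrite vpsD -big_split; apply: eq_bigr => i _.
by rewrite vpsD tpureDl.
Qed.
Lemma cauchyDr v w w' : cauchy v (w + w') = cauchy v w + cauchy v w'.
Proof.
apply/funext => n; rewrite vpsD -big_split; apply: eq_bigr => i _.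
by rewrite vpsD tpureDr.
Qed.

(* Both sides are the sum of a_i v_j (x) w_l over i + j + l = n. *)
Lemma cauchyZl (a : fps K) v w : cauchy (a *: v) w = a *: cauchy v w.
Proof.
apply/funext => n; rewrite cauchy_rev vpsZ.
pose c3 i l := a i *: (v (n - i - l)%N ⊗ w l).
transitivity (\sum_(l < n.+1) \sum_(i < n.+1 | (i <= n - l)%N) c3 i l).
  apply: eq_bigr => l _; rewrite vpsZ (lin_sum (tpure_linear_l _)).
  rewrite (big_ord_narrow_leq (leq_subr _ _)); apply: eq_bigr => i _.
  by rewrite tpureZl /c3 /= -!subnDA addnC.
rewrite (exchange_big_dep predT) //=; apply: eq_bigr => i _.
rewrite cauchy_rev scaler_sumr.
rewrite -[RHS](big_ord_narrow_leq (F := fun l : 'I_n.+1 => c3 i l) (leq_subr i n)).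
apply: eq_bigl => l; rewrite -ltnS -(ltnS l) -!subSn ?leq_ord //.
by rewrite -subn_gt0 -(subn_gt0 l) -!subnDA addnC.
Qed.

Lemma cauchyZr (a : fps K) v w : cauchy v (a *: w) = a *: cauchy v w.
Proof.
apply/funext => n; rewrite /cauchy vpsZ.
pose c3 i l := a i *: (v l ⊗ w (n - i - l)%N).
transitivity (\sum_(l < n.+1) \sum_(i < n.+1 | (i <= n - l)%N) c3 i l).
  apply: eq_bigr => l _; rewrite vpsZ (lin_sum (tpure_linear_r _)).
  rewrite (big_ord_narrow_leq (leq_subr _ _)); apply: eq_bigr => i _.
  by rewrite tpureZr /c3 /= -!subnDA addnC.
rewrite (exchange_big_dep predT) //=; apply: eq_bigr => i _.
rewrite scaler_sumr.
rewrite -[RHS](big_ord_narrow_leq (F := fun l : 'I_n.+1 => c3 i l) (leq_subr i n)).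
apply: eq_bigl => l; rewrite -ltnS -(ltnS l) -!subSn ?leq_ord //.
by rewrite -subn_gt0 -(subn_gt0 l) -!subnDA addnC.
Qed.

Lemma cauchy_bilinear : bilinear_map cauchy.
Proof.
by split=> [w a v v'|v a w w'] /=; rewrite ?cauchyDl ?cauchyDr ?cauchyZl ?cauchyZr.
Qed.
End Cauchy.

(** The Cauchy product of the two series maps serves as [phi], and the tensor product of the two
    sections as [j]. Neither requires the algebraic tensor product to be complete. *)
Lemma hfree_tens (K : comNzRingType) (M N : lmodType (fps K)) (V W : lmodType K)
    (pi : M -> V) (rho : N -> W) : hfree pi -> hfree rho ->
  hfree (tlift (fun x y => pi x ⊗ rho y)).
Proof.
move=> [phi [j [lphi lj phi0 jE]]] [psi [i [lpsi li psi0 iE]]].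
have bc : bilinear_map (fun x y => cauchy (phi x) (psi y)).
  exact: bilinear_comp lphi lpsi (cauchy_bilinear _ _).
have bj : bilinear_map (fun (v : V) (w : W) => ((j v : M) ⊗ (i w : N) : restr _)).
  split=> [w a v v'|v a w w'] /=; rewrite ?lj ?li ?(tpureDl, tpureDr, restrZ) ?(tpureZl, tpureZr) //.
pose Phi := tlift (fun x y => cauchy (phi x) (psi y)).
have lPhi : linear Phi by apply: tlift_is_linear.
pose J : tens V W -> restr (tens M N) := tlift (fun v w => (j v : M) ⊗ (i w : N) : restr _).
have lJ : linear J by apply: tlift_is_linear.
pose red (t : tens M N) : tens V W := tlift (fun x y => pi x ⊗ rho y) t.
(* The target of [red] is a module over K only, outside the universal property of [tlift]; hence the
   comparison on representatives. *)
have PhiE t : Phi t 0%N = red t.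
  rewrite /Phi /red /tlift /tsum.
  elim: (repr t) => [|q s IH]; first by rewrite !big_nil.
  by rewrite !big_cons vpsD IH /cauchy big_ord1 phi0 psi0.
exists Phi, J; split=> // t; rewrite -/(red t) -PhiE.
elim/tens_ind: t => [|x y t IH].
  by rewrite (lin_zero lPhi) (lin_zero lJ); apply: hcong_refl.
rewrite (lin_add lPhi) vpsD (lin_add lJ); apply: hcongD IH.
rewrite /Phi tlift_pure // /cauchy big_ord1 subnn phi0 psi0 /J tlift_pure //.
exact: hcong_bilinear (tpure_bilinear _ _) (jE x) (iE y).
Qed.

Lemma hfree_tens_pure (K : comNzRingType) (M N : lmodType (fps K)) (V W : lmodType K)
    (pi : M -> V) (rho : N -> W) x y : hfree pi -> hfree rho ->
  tlift (fun x y => pi x ⊗ rho y) (x ⊗ y) = pi x ⊗ rho y.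
Proof.
move=> [phi [_ [lphi _ phi0 _]]] [psi [_ [lpsi _ psi0 _]]].
have bc : bilinear_map (fun x y => cauchy (phi x) (psi y)).
  exact: bilinear_comp lphi lpsi (cauchy_bilinear _ _).
transitivity (tlift (fun x y => cauchy (phi x) (psi y)) (x ⊗ y) 0%N); last first.
  by rewrite tlift_pure // /cauchy big_ord1 phi0 psi0.
rewrite /tlift /tsum; elim: (repr _) => [|q s IH]; first by rewrite !big_nil.
by rewrite !big_cons vpsD IH /cauchy big_ord1 phi0 psi0.
Qed.

Section HFree.
Variables (K : comNzRingType) (M : lmodType (fps K)) (V : lmodType K) (pi : M -> V).
Hypothesis free : hfree pi.

Lemma hfree_semilinear a x y : pi (a *: x + y) = a 0%N *: pi x + pi y.
Proof.
have [phi [j [lphi _ phi0 _]]] := free.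
by rewrite -!phi0 lphi vpsD vps_scale0.
Qed.

Lemma hfree_kernel (x : M) : pi x = 0 <-> hcong 1 x 0.
Proof.
have [phi [j [lphi lj phi0 jE]]] := free; split=> [x0|[y]].
  by have := jE x; rewrite x0 (lin_zero lj).
rewrite subr0 => ->; rewrite -phi0 (lin_scale lphi) expr1 vps_hbar //.
Qed.

(** [phi] is strict: if the series of y vanishes below degree m, then [hfree_kernel] extracts m
    factors hbar from y one by one. So the hbar-adic order can be read off [phi], where
    multiplication by hbar is a shift. *)
Lemma hfree_hbar n (x : M) : hcong n.+1 (hbar *: x) 0 -> hcong n x 0.
Proof.
have [phi [j [lphi lj phi0 jE]]] := free.
have strict m y : (forall i, (i < m)%N -> phi y i = 0) -> hcong m y 0.
  elim: m y => [|m IH] y ym; first by exists y; rewrite subr0 expr0 scale1r.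
  have /hfree_kernel [z] : pi y = 0 by rewrite -phi0 ym.
  rewrite subr0 expr1 => yz; rewrite yz -[0](scaler0 _ hbar) -[hbar]expr1 -addn1 addnC.
  apply/hcong_scale/IH => i im; have := ym i.+1 im.
  by rewrite yz (lin_scale lphi) vps_hbar.
move=> hx; apply: strict => i im.
have /vps_hcong/(_ i.+1 im) := hcong_linear lphi hx.
by rewrite (lin_scale lphi) vps_hbar (lin_zero lphi).
Qed.

Lemma hcompl_torsionfree (x : hcompl M) : hbar *: x = 0 -> x = 0.
Proof.
move=> hx; apply: hcompl_separated => n; apply/happrox_hcong.
(* The approximation of order n + 1 is used because dividing by hbar loses one order. *)
have E : hcong n (happrox x n.+1) 0.
  apply: hfree_hbar; apply: hcong_trans (hcong_sym (happroxZ hbar x n.+1)) _.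
  rewrite hx; exact: happrox_in.
apply: hcong_trans (hcong_sym (happrox_coherent x n)) _; apply: hcong_trans E _.
exact/hcong_sym/happrox_in.
Qed.

Definition hred (x : hcompl M) : V := pi (happrox x 1).

Lemma hfree_cong (x y : M) : hcong 1 x y -> pi x = pi y.
Proof.
move/hcong_sub0/hfree_kernel; rewrite addrC -scaleN1r hfree_semilinear.
move/eqP; rewrite addrC -[(-1 : fps K) 0%N]/(-1) scaleN1r subr_eq0 => /eqP.
by [].
Qed.

Lemma hred_semilinear a x y : hred (a *: x + y) = a 0%N *: hred x + hred y.
Proof.
rewrite /hred -hfree_semilinear; apply: hfree_cong.
by apply: hcong_trans (happroxD _ _ _) (hcongD (happroxZ _ _ _) (hcong_refl _ _)).
Qed.

Lemma hred_hin t : hred (hin t) = pi t.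
Proof. exact/hfree_cong/happrox_in. Qed.

Lemma hred_kernel x : hred x = 0 <-> exists y, x = hbar *: y.
Proof.
rewrite /hred hfree_kernel; split=> [/happrox_hcong0|[y ->]]; rewrite ?expr1 //.
apply: hcong_trans (happroxZ _ _ _) _.
by exists (happrox y 1); rewrite subr0 expr1.
Qed.

Lemma hredD x y : hred (x + y) = hred x + hred y.
Proof. by have := hred_semilinear 1 x y; rewrite !scale1r. Qed.
Lemma hred_hbar x : hred (hbar *: x) = 0.
Proof. by apply/hred_kernel; exists x. Qed.
Lemma hredN x : hred (- x) = - hred x.
Proof. by apply: (addrI (hred x)); rewrite -hredD !subrr -[0](scaler0 _ hbar) hred_hbar. Qed.
Lemma hredZ a x : hred (a *: x) = a 0%N *: hred x.
Proof.
have h0 : hred 0 = 0 by rewrite -(scaler0 _ hbar) hred_hbar.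
by have := hred_semilinear a x 0; rewrite h0 !addr0.
Qed.
Lemma hred_hcong (x y : hcompl M) : hcong 1 x y -> hred x = hred y.
Proof. by move/happrox_hcong; apply: hfree_cong. Qed.
End HFree.

(** * Truncated exponential and logarithm *)

Section FormalExpLog.
Variable k : fieldType.
Hypothesis char0 : [pchar k] =i pred0.
Implicit Types p q : {poly k}.

Definition exp_poly N : {poly k} := \sum_(n < N) (n`!%:R^-1 : k) *: 'X^n.
Definition log_poly N : {poly k} := \sum_(n < N) ((-1) ^+ n / n.+1%:R : k) *: 'X^(n.+1).

Let natr_neq0 n : (n.+1%:R : k) != 0. Proof. exact: natrS_neq0. Qed.

Lemma poly_split N p q : (forall i, (i < N)%N -> p`_i = q`_i) ->
  exists r, p = q + 'X^N * r.
Proof.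
move=> pq; exists (drop_poly N (p - q)); rewrite mulrC -[LHS](subrK q) addrC.
congr (_ + _); rewrite -[LHS](poly_take_drop N) [take_poly _ _](_ : _ = 0) ?add0r //.
apply/polyP => i; rewrite coef_take_poly coef0; case: ltnP => // iN.
by rewrite coefB pq // subrr.
Qed.

Lemma exp_poly_recr N : exp_poly N.+1 = exp_poly N + (N`!%:R^-1 : k) *: 'X^N.
Proof. by rewrite /exp_poly big_ord_recr. Qed.

Lemma exp_poly_recl N :
  exp_poly N.+1 = 1 + \sum_(n < N) (n.+1`!%:R^-1 : k) *: 'X^(n.+1).
Proof. by rewrite /exp_poly big_ord_recl fact0 invr1 scale1r expr0. Qed.

Lemma exp_poly_split N : exists q, exp_poly N.+2 = 1 + 'X + 'X^2 * q.
Proof.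
exists (\sum_(n < N) (n.+2`!%:R^-1 : k) *: 'X^n).
rewrite exp_poly_recl big_ord_recl factS fact0 invr1 scale1r expr1 addrA; congr (_ + _).
by rewrite mulr_sumr; apply: eq_bigr => i _; rewrite -scalerAr -exprD.
Qed.

Lemma deriv_exp_poly N : (exp_poly N.+1)^`() = exp_poly N.
Proof.
rewrite exp_poly_recl derivD derivC add0r raddf_sum; apply: eq_bigr => i _.
rewrite /= derivZ derivXn -scaler_nat scalerA; congr (_ *: _).
by rewrite factS natrM invfM -mulrA mulrC -mulrA divff ?mulr1.
Qed.

Lemma exp_poly_at0 N : (exp_poly N.+1).[0] = 1.
Proof.
rewrite exp_poly_recl hornerD hornerC horner_sum big1 ?addr0 // => i _.
by rewrite hornerZ hornerXn expr0n mulr0.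
Qed.

Lemma log_poly_factor N : exists q, log_poly N = 'X * q.
Proof.
exists (\sum_(n < N) ((-1) ^+ n / n.+1%:R : k) *: 'X^n); rewrite mulr_sumr.
by apply: eq_bigr => i _; rewrite -scalerAr exprS.
Qed.

Lemma deriv_log_poly N : (1 + 'X) * (log_poly N)^`() = 1 - (-1) ^+ N *: 'X^N.
Proof.
rewrite raddf_sum (eq_bigr (fun n : 'I_N => (-1) ^+ n *: 'X^n)); last first.
  move=> i _; rewrite /= derivZ derivXn -scaler_nat scalerA -mulrA mulVf ?mulr1 //.
elim: N => [|N IH]; first by rewrite big_ord0 mulr0 expr0 scale1r expr0 subrr.
rewrite big_ord_recr mulrDr IH -scalerAr mulrDl mul1r -exprS scalerDr.
by rewrite [(-1) ^+ N.+1]exprS mulN1r scaleNr; abelian.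
Qed.

(** The composite P satisfies (1 + X) P' = P up to order N + 1, so its coefficients obey (j + 1)
    P_{j+1} = (1 - j) P_j. From P(0) = 1 they are 1, 1, 0, 0, ... as far as the recurrence holds. *)
Lemma exp_poly_log_poly N :
  exists q, exp_poly N.+2 \Po log_poly N.+2 = 1 + 'X + 'X^(N.+2) * q.
Proof.
set E := exp_poly _; set L := log_poly _; set P := E \Po L.
have [L1 LE] : exists q, L = 'X * q := log_poly_factor _.
have [S PS] : exists S, (1 + 'X) * P^`() = P + 'X^(N.+1) * S.
  have E' : E^`() = E - (N.+1`!%:R^-1 : k) *: 'X^(N.+1).
    by rewrite deriv_exp_poly [in RHS]/E [in RHS]exp_poly_recr addrK.
  rewrite /P deriv_comp mulrCA deriv_log_poly E'.
  have LX : L ^+ N.+1 = 'X^(N.+1) * L1 ^+ N.+1 by rewrite LE exprMn.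
  rewrite comp_polyB comp_polyZ comp_Xn_poly -/P; set c := (_^-1); set d := (-1) ^+ _.
  exists (- (c *: L1 ^+ N.+1) - d *: ('X * (P - c *: L ^+ N.+1))).
  rewrite [('X^(N.+2))]exprS LX -!mul_polyC.
  by ring.
apply: poly_split => i iN.
have Pc j : (j < N.+1)%N -> P`_j.+1 *+ j.+1 + (P`_j *+ j) = P`_j.
  move=> jN; have := congr1 (fun p : {poly k} => p`_j) PS.
  rewrite coefD coefXnM jN addr0 mulrDl mul1r coefD coef_deriv coefXM.
  by case: j {jN} => [|j] //; rewrite coef_deriv.
have P0 : P`_0 = 1.
  by rewrite -horner_coef0 horner_comp LE hornerM hornerX mul0r exp_poly_at0.
have P1 : P`_1 = 1 by have := Pc 0%N isT; rewrite mulr1n mulr0n addr0 P0.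
rewrite coefD coef1 coefX; case: i iN => [|[|i]] iN; rewrite ?P0 ?P1 ?addr0 ?add0r //.
have P2 j : (j < N)%N -> P`_j.+2 = 0.
  elim: j => [|j IH] jN.
    have /eqP := Pc 1%N jN; rewrite mulr1n -subr_eq0 addrK.
    by rewrite -mulr_natr mulf_eq0 (negbTE (natr_neq0 1)) orbF => /eqP.
  have := Pc j.+2 jN; rewrite IH ?(ltnW jN) // mul0rn addr0 => /eqP.
  by rewrite -mulr_natr mulf_eq0 (negbTE (natr_neq0 _)) orbF => /eqP.
by rewrite P2.
Qed.

(** The derivative of the product is divisible by X^N and its value at 0 is 1. *)
Lemma exp_polyN N : exists q, exp_poly N.+1 * (exp_poly N.+1 \Po - 'X) = 1 + 'X^(N.+1) * q.
Proof.
set E := exp_poly _; set E1 := E \Po _; set Q := E * E1.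
have [S QS] : exists S, Q^`() = 'X^N * S.
  have E' : E^`() = E - (N`!%:R^-1 : k) *: 'X^N.
    by rewrite deriv_exp_poly [in RHS]/E [in RHS]exp_poly_recr addrK.
  rewrite derivM /E1 deriv_comp derivN derivX mulrN1 E' comp_polyB -/E1 comp_polyZ comp_Xn_poly.
  rewrite exprNn; set c := (_^-1).
  exists (- (c *: E1) + E * ((-1) ^+ N * c%:P)).
  by rewrite -!mul_polyC; ring.
apply: poly_split => -[|i] iN; last first.
  have /eqP := congr1 (fun p : {poly k} => p`_i) QS.
  rewrite coef_deriv coefXnM (_ : (i < N)%N) // -mulr_natr mulf_eq0.
  by rewrite (negbTE (natr_neq0 _)) orbF coef1 => /eqP.
by rewrite coef1 -horner_coef0 hornerM /E1 horner_comp hornerN hornerX oppr0 exp_poly_at0 mulr1.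
Qed.
End FormalExpLog.

(** * Exponential and logarithm in the completed tensor square *)

Section ExpLogSeries.
Variables (k : fieldType) (U : algType (fps k)).
Hypothesis char0 : [pchar k] =i pred0.
Local Notation C := (ctens2 U).
Hypothesis torsionfree : forall x : C, hbar *: x = 0 -> x = 0.
Implicit Types (x y f F : C) (q r : {poly k}).

Lemma ctens2_scaleAl a x y : a *: (x * y) = (a *: x) * y.
Proof. exact/esym/(lin_scale ((ctens2_mul_bilinear U).1 y)). Qed.
Lemma ctens2_scaleAr a x y : a *: (x * y) = x * (a *: y).
Proof. exact/esym/(lin_scale ((ctens2_mul_bilinear U).2 x)). Qed.
Lemma ctens2_exprZ a x n : (a *: x) ^+ n = a ^+ n *: x ^+ n.
Proof.
elim: n => [|n IH]; first by rewrite !expr0 scale1r.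
by rewrite !exprS IH -ctens2_scaleAl -ctens2_scaleAr scalerA.
Qed.

Lemma hbar_inj x y : hbar *: x = hbar *: y -> x = y.
Proof.
move=> xy; apply/eqP; rewrite -subr_eq0; apply/eqP/torsionfree.
by rewrite scalerBr xy subrr.
Qed.

Lemma hcong_hbar n x y : hcong n.+1 (hbar *: x) (hbar *: y) -> hcong n x y.
Proof.
case=> z; rewrite -scalerBr exprS -scalerA => /hbar_inj xy.
by exists z.
Qed.

Lemma hcong_mul n x x' y y' : hcong n x x' -> hcong n y y' -> hcong n (x * y) (x' * y').
Proof. exact: hcong_bilinear (ctens2_mul_bilinear U). Qed.

Lemma hcong_exp n m x y : hcong n x y -> hcong n (x ^+ m) (y ^+ m).
Proof.
move=> xy; elim: m => [|m IH]; first by rewrite !expr0; apply: hcong_refl.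
by rewrite !exprS; apply: hcong_mul.
Qed.

Lemma hcong_sum n m (u v : nat -> C) :
  (forall i, (i < m)%N -> hcong n (u i) (v i)) ->
  hcong n (\sum_(i < m) u i) (\sum_(i < m) v i).
Proof.
elim: m => [|m IH] uv; first by rewrite !big_ord0; apply: hcong_refl.
rewrite !big_ord_recr; apply: hcongD; last exact: uv.
by apply: IH => i im; apply: uv; apply: ltnW.
Qed.

(** Evaluation at x, through the embedding [fpsC] of constants. It is multiplicative because the
    powers of x commute, although the ring does not; the ring may also be zero. *)
Definition peval x q : C := \sum_(i < size q) fpsC q`_i *: x ^+ i.

Lemma peval_widen x q n : (size q <= n)%N -> peval x q = \sum_(i < n) fpsC q`_i *: x ^+ i.
Proof.
move=> qn; rewrite /peval (big_ord_widen n (fun i => fpsC q`_i *: x ^+ i) qn).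
rewrite big_mkcond; apply: eq_bigr => i _; case: ltnP => // iq.
by rewrite nth_default // fpsC0 scale0r.
Qed.

Lemma pevalD x q r : peval x (q + r) = peval x q + peval x r.
Proof.
pose n := maxn (size q) (size r).
rewrite !(@peval_widen _ _ n) ?leq_maxl ?leq_maxr ?size_polyD //.
by rewrite -big_split; apply: eq_bigr => i _; rewrite coefD fpsCD scalerDl.
Qed.

Lemma pevalZ x c q : peval x (c *: q) = fpsC c *: peval x q.
Proof.
rewrite (@peval_widen _ _ (size q)) ?size_scale_leq // scaler_sumr.
by apply: eq_bigr => i _; rewrite coefZ fpsCM scalerA.
Qed.

Lemma peval0 x : peval x 0 = 0.
Proof. by rewrite /peval size_poly0 big_ord0. Qed.

Lemma peval1 x : peval x 1 = 1.
Proof. by rewrite /peval size_poly1 big_ord1 coef1 fpsC1 scale1r. Qed.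

Lemma pevalC x c : peval x c%:P = fpsC c *: (1 : C).
Proof. by rewrite -[c%:P]mulr1 mul_polyC pevalZ peval1. Qed.

Lemma pevalMX x q : peval x (q * 'X) = peval x q * x.
Proof.
rewrite (@peval_widen _ _ (size q).+1) ?(leq_trans (size_polyMleq _ _)) ?size_polyX ?addn2 //.
rewrite big_ord_recl coefMX /= fpsC0 scale0r add0r mulr_suml.
by apply: eq_bigr => i _; rewrite coefMX /= exprSr ctens2_scaleAl.
Qed.

Lemma peval_comm x q : x * peval x q = peval x q * x.
Proof.
rewrite mulr_sumr mulr_suml; apply: eq_bigr => i _.
by rewrite -ctens2_scaleAl -ctens2_scaleAr -exprS exprSr.
Qed.

Lemma pevalM x q r : peval x (q * r) = peval x q * peval x r.
Proof.
elim/poly_ind: q => [|q c IH]; first by rewrite mul0r peval0 mul0r.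
rewrite mulrDl -mulrA ['X * r]mulrC mulrA !pevalD !pevalMX IH mul_polyC pevalZ pevalC.
by rewrite mulrDl -ctens2_scaleAl mul1r -!mulrA peval_comm.
Qed.

Lemma pevalX x : peval x 'X = x.
Proof. by rewrite -['X]mul1r pevalMX peval1 mul1r. Qed.

Lemma pevalXn x n : peval x 'X^n = x ^+ n.
Proof. by elim: n => [|n IH]; rewrite ?expr0 ?peval1 // !exprSr pevalMX IH. Qed.

Lemma peval_sum x n (q : nat -> {poly k}) :
  peval x (\sum_(i < n) q i) = \sum_(i < n) peval x (q i).
Proof. exact: (big_morph _ (pevalD x) (peval0 x)). Qed.

Lemma peval_comp x q r : peval x (q \Po r) = peval (peval x r) q.
Proof.
elim/poly_ind: q => [|q c IH]; first by rewrite comp_poly0 !peval0.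
by rewrite comp_polyD comp_polyM comp_polyX comp_polyC !pevalD pevalMX (pevalM x) IH !pevalC.
Qed.

Lemma hcong_peval n x y q : hcong n x y -> hcong n (peval x q) (peval y q).
Proof.
move=> xy; pose u (z : C) (i : nat) : C := fpsC q`_i *: z ^+ i.
by rewrite /peval; apply: (@hcong_sum n (size q) (u x) (u y)) => i _; apply/hcongZ/hcong_exp.
Qed.

Lemma peval_Xn_hcong0 n f q : hcong n (peval (hbar *: f) ('X^n * q)) 0.
Proof.
rewrite pevalM pevalXn ctens2_exprZ -ctens2_scaleAl.
by eexists; rewrite subr0.
Qed.

Lemma hseries_sum (u : nat -> C) : (forall i, hcong i (u i) 0) ->
  exists2 s, has_hsum u s & forall n, hcong n s (\sum_(i < n) u i).
Proof.
move=> u0; have [s sE] : exists s : C, forall n, hcong n s (\sum_(i < n) u i).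
  apply: hcompl_complete => n; rewrite big_ord_recr /=.
  have := hcongD (hcong_refl n (\sum_(i < n) u i)) (u0 n).
  by rewrite addr0.
exists s => // n; exists n => m nm.
exact/hcong_sym/(hcong_le nm)/sE.
Qed.

Lemma has_hsum_uniq (u : nat -> C) s t : has_hsum u s -> has_hsum u t -> s = t.
Proof.
move=> us ut; apply: hcompl_separated => n.
have [N1 E1] := us n; have [N2 E2] := ut n.
apply: hcong_trans (hcong_sym (E1 (maxn N1 N2) _)) (E2 _ _); first exact: leq_maxl.
exact: leq_maxr.
Qed.

Lemma hsumE (u : nat -> C) s : has_hsum u s -> hsum u = s.
Proof. by move=> us; apply: (has_hsum_uniq _ us); apply: (@xgetPex _ 0 (has_hsum u)); exists s. Qed.

Lemma hbar_divE x : hbar_div (hbar *: x) = x.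
Proof.
apply: hbar_inj; exact: (@xgetPex _ 0 [set y : C | hbar *: y = hbar *: x] (ex_intro _ x erefl)).
Qed.

Lemma log_termE x n :
  log_term (1 + x) n = fpsC ((-1) ^+ n / n.+1%:R) *: x ^+ n.+1.
Proof. by rewrite /log_term addrC addKr. Qed.

Lemma exp_term_sum x n : \sum_(i < n) exp_term x i = peval x (exp_poly k n).
Proof.
rewrite /exp_poly (peval_sum _ _ (fun i => (i`!%:R^-1 : k) *: 'X^i)).
by apply: eq_bigr => i _; rewrite pevalZ pevalXn.
Qed.

Lemma log_term_sum x n : \sum_(i < n) log_term (1 + x) i = peval x (log_poly k n).
Proof.
rewrite /log_poly (peval_sum _ _ (fun i => ((-1) ^+ i / i.+1%:R : k) *: 'X^(i.+1))).
apply: eq_bigr => i _; rewrite pevalZ pevalXn.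
exact: log_termE.
Qed.

Lemma exp_sum x : exists2 s, has_hsum (exp_term (hbar *: x)) s
  & forall n, hcong n s (\sum_(i < n) exp_term (hbar *: x) i).
Proof.
apply: hseries_sum => i; rewrite /exp_term ctens2_exprZ scalerA mulrC -scalerA.
by eexists; rewrite subr0.
Qed.

Lemma log_sum f : exists2 s, has_hsum (log_term (1 + hbar *: f)) s
  & forall n, hcong n s (\sum_(i < n) log_term (1 + hbar *: f) i).
Proof.
apply: hseries_sum => i; rewrite log_termE ctens2_exprZ scalerA mulrC -scalerA.
by rewrite exprS mulrC -scalerA; eexists; rewrite subr0.
Qed.

Lemma has_exp_hcong x F n : has_hsum (exp_term x) F ->
  exists N, forall m, (N <= m)%N -> hcong n F (peval x (exp_poly k m)).
Proof.
move=> us; have [N E] := us n; exists N => m /E /hcong_sym.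
by rewrite exp_term_sum.
Qed.

Lemma hlog_exp F f : F = 1 + hbar *: f ->
  let kappa := hbar_div (hlog F) in
  [/\ has_hsum (log_term F) (hbar *: kappa),
      has_hsum (exp_term (hbar *: kappa)) F & hcong 1 kappa f].
Proof.
move=> ->; have [s slog sE] := log_sum f.
rewrite /hlog (hsumE slog).
(* Only the linear term of the logarithm survives modulo hbar^2; after division by hbar, kappa = f
   modulo hbar. *)
have sf : hcong 2 s (hbar *: f).
  apply: hcong_trans (sE 2%N) _; rewrite big_ord_recl big_ord1 !log_termE /=.
  rewrite expr0 divr1 fpsC1 scale1r expr1.
  rewrite -[X in hcong _ _ X]addr0; apply: hcongD; first exact: hcong_refl.
  rewrite ctens2_exprZ scalerA mulrC -scalerA; by eexists; rewrite subr0.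
(* Since s = hbar f + hbar^2 z, this is s divided by hbar. *)
have [z zE] := sf; set kap := f + hbar *: z.
have sk : s = hbar *: kap.
  by rewrite /kap scalerDr scalerA -expr2 -zE; abelian.
rewrite sk in slog sE *.
have sE' n : hcong n (hbar *: kap) (peval (hbar *: f) (log_poly k n)).
  by rewrite -log_term_sum; apply: sE.
rewrite hbar_divE; split; [exact: slog| |by exists z; rewrite addrC addKr expr1].
(* The bound n + 2, rather than n, brings the truncation order into the form N + 2 of
   [exp_poly_log_poly]. *)
move=> n; exists n.+2 => m nm.
case: m nm => [|[|m]] // nm.
rewrite exp_term_sum; apply: (@hcong_le _ _ _ m.+2); first exact: ltnW (ltnW nm).
apply: hcong_trans (hcong_peval _ (sE' m.+2)) _.
have [q Eq] := exp_poly_log_poly char0 m.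
rewrite -peval_comp Eq !pevalD peval1 pevalX -[X in hcong _ _ X]addr0.
exact: hcongD (hcong_refl _ _) (peval_Xn_hcong0 _ _ _).
Qed.

Lemma hexpN x F G : has_hsum (exp_term (hbar *: x)) F ->
  has_hsum (exp_term (hbar *: - x)) G -> F * G = 1.
Proof.
(* With - y as the value at y of the polynomial - X, both exponentials become limits of polynomials
   in the same y. *)
move=> eF; have -> : hbar *: - x = peval (hbar *: x) (- 'X).
  have C1 : fpsC (-1 : k) = -1.
    by apply: (addrI 1); rewrite -fpsC1 -fpsCD !subrr.
  by rewrite -[- 'X]scaleN1r pevalZ pevalX C1 scaleN1r scalerN.
move: (hbar *: x) (peval_Xn_hcong0^~ x) eF => y yn eF eG.
apply: hcompl_separated => n.
have [N1 E1] := has_exp_hcong n eF; have [N2 E2] := has_exp_hcong n eG.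
pose m := maxn n (maxn N1 N2).
have nm : (n <= m.+1)%N by apply: leqW; apply: leq_maxl.
have N1m : (N1 <= m.+1)%N by apply: leqW; rewrite leq_max leq_maxl orbT.
have N2m : (N2 <= m.+1)%N by apply: leqW; rewrite leq_max leq_maxr orbT.
apply: hcong_trans (hcong_mul (E1 m.+1 N1m) (E2 m.+1 N2m)) _.
have [q Eq] := exp_polyN char0 m.
rewrite -peval_comp -pevalM Eq pevalD peval1.
have := hcongD (hcong_refl n (1 : C)) (hcong_le nm (yn m.+1 q)).
by rewrite addr0.
Qed.

(** If x = y modulo hbar^n, the terms of exp(hbar x) and exp(hbar y) of degree at least two agree
    modulo hbar^(n+2), as they carry hbar^2. Comparing the linear terms and dividing by hbar gives x
    = y modulo hbar^(n+1). *)
Lemma hexp_inj x y F : has_hsum (exp_term (hbar *: x)) F ->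
  has_hsum (exp_term (hbar *: y)) F -> x = y.
Proof.
move=> ex ey; apply: hcompl_separated; elim=> [|n IH].
  by exists (x - y); rewrite expr0 scale1r.
apply: hcong_hbar.
have [N1 E1] := has_exp_hcong n.+2 ex; have [N2 E2] := has_exp_hcong n.+2 ey.
pose m := maxn N1 N2.
have N1m : (N1 <= m.+2)%N by do 2!apply: leqW; apply: leq_maxl.
have N2m : (N2 <= m.+2)%N by do 2!apply: leqW; apply: leq_maxr.
have [q Eq] := exp_poly_split k m.
have expE z : peval (hbar *: z) (exp_poly k m.+2)
    = 1 + hbar *: z + hbar ^+ 2 *: (z ^+ 2 * peval (hbar *: z) q).
  by rewrite Eq !pevalD peval1 pevalX pevalM pevalXn ctens2_exprZ -ctens2_scaleAl.
have := hcong_trans (hcong_sym (E1 _ N1m)) (E2 _ N2m); rewrite !expE => E.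
have quad : hcong n.+2 (hbar ^+ 2 *: (x ^+ 2 * peval (hbar *: x) q))
                       (hbar ^+ 2 *: (y ^+ 2 * peval (hbar *: y) q)).
  apply: (@hcong_scale _ _ 2 n); apply: hcong_mul (hcong_exp _ IH) _.
  exact/hcong_peval/hcongZ.
exact: hcong_cancel E quad.
Qed.
End ExpLogSeries.

(** * Completed tensor powers *)

Section CompletedMaps.
Variables (K : comNzRingType).
Implicit Types T M N P : lmodType (fps K).

Definition hmap (T T' : lmodType (fps K)) (L : T -> T') : hcompl T -> hcompl T' := hext (fun t => hin (L t)).

Section HMap.
Variables (T T' : lmodType (fps K)) (L : T -> T').
Hypothesis lL : linear L.

Lemma hin_comp_linear : linear (fun t => hin (L t)).
Proof. exact: linear_comp lL (@hin_linear _ _). Qed.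
Lemma hmap_linear : linear (hmap L).
Proof. exact: hext_linear hin_comp_linear. Qed.
Lemma hmap_hin t : hmap L (hin t) = hin (L t).
Proof. exact: hext_hin hin_comp_linear _. Qed.
End HMap.

Lemma clift_linear M N P (f : M -> N -> hcompl P) : bilinear_map f -> linear (clift f).
Proof. by move=> bf; apply/hext_linear/tlift_is_linear. Qed.

Lemma hcompl2_ext M N (S : lmodType (fps K)) (h1 h2 : hcompl (tens M N) -> S) :
  hseparated S -> linear h1 -> linear h2 ->
  (forall x y, h1 (hin (x ⊗ y)) = h2 (hin (x ⊗ y))) -> forall t, h1 t = h2 t.
Proof.
move=> sS l1 l2 E; apply: hcompl_linear_ext => //.
have lh := @hin_linear K (tens M N).
by apply: tens_linear_ext; [exact: linear_comp lh l1 | exact: linear_comp lh l2 |].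
Qed.

Lemma hcompl3_ext M N P (S : lmodType (fps K)) (h1 h2 : hcompl (tens M (tens N P)) -> S) :
  hseparated S -> linear h1 -> linear h2 ->
  (forall x y z, h1 (hin (x ⊗ (y ⊗ z))) = h2 (hin (x ⊗ (y ⊗ z)))) -> forall t, h1 t = h2 t.
Proof.
move=> sS l1 l2 E; apply: hcompl_linear_ext => //.
have lh := @hin_linear K (tens M (tens N P)).
by apply: tens3_linear_ext; [exact: linear_comp lh l1 | exact: linear_comp lh l2 |].
Qed.

Lemma hcompl2_bilinear_ext M N (S : lmodType (fps K))
    (B1 B2 : hcompl (tens M N) -> hcompl (tens M N) -> S) :
  hseparated S -> bilinear_map B1 -> bilinear_map B2 ->
  (forall x y x' y', B1 (hin (x ⊗ y)) (hin (x' ⊗ y')) = B2 (hin (x ⊗ y)) (hin (x' ⊗ y'))) ->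
  forall s t, B1 s t = B2 s t.
Proof.
move=> sS [l1 r1] [l2 r2] E s t; move: s.
apply: (hcompl2_ext sS); [exact: l1 | exact: l2 | move=> x y].
by move: t; apply: (hcompl2_ext sS); [exact: r1 | exact: r2 |].
Qed.
End CompletedMaps.

Section CompletedSquare.
Variables (K : comNzRingType) (U : algType (fps K)).
Local Notation C2 := (ctens2 U).
Local Notation C3 := (ctens3 U).
Implicit Types (x y z : U) (s t : C2) (u v : C3).

Let sep2 : hseparated C2. Proof. exact: hcompl_separated. Qed.
Let sep3 : hseparated C3. Proof. exact: hcompl_separated. Qed.

Definition ccyc : C3 -> C3 := hmap (@cyc3 _ U).
Definition cswap23 : C3 -> C3 := hmap (@swap23 _ U).
Definition cswap12 : C3 -> C3 := hmap (@swap12 _ U).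
Definition crcons y : C2 -> C3 := clift (fun a b => hin (a ⊗ (b ⊗ y))).
Definition clcons x : C2 -> C3 := clift (fun a b => hin (x ⊗ (a ⊗ b))).

Lemma ccyc_linear : linear ccyc. Proof. exact: hmap_linear (@cyc3_linear _ U). Qed.
Lemma cswap23_linear : linear cswap23. Proof. exact: hmap_linear (@swap23_linear _ U). Qed.
Lemma cswap12_linear : linear cswap12. Proof. exact: hmap_linear (@swap12_linear _ U). Qed.
Lemma ccyc_hin x y z : ccyc (hin (x ⊗ (y ⊗ z))) = hin (y ⊗ (z ⊗ x)).
Proof. by rewrite /ccyc (hmap_hin (@cyc3_linear _ U)) cyc3_pure. Qed.
Lemma cswap23_hin x y z : cswap23 (hin (x ⊗ (y ⊗ z))) = hin (x ⊗ (z ⊗ y)).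
Proof. by rewrite /cswap23 (hmap_hin (@swap23_linear _ U)) swap23_pure. Qed.
Lemma cswap12_hin x y z : cswap12 (hin (x ⊗ (y ⊗ z))) = hin (y ⊗ (x ⊗ z)).
Proof. by rewrite /cswap12 (hmap_hin (@swap12_linear _ U)) swap12_pure. Qed.

Let hin3_bilinear_r y : bilinear_map (fun a b : U => hin (a ⊗ (b ⊗ y)) : C3).
Proof. exact: linear_bilinear (@hin_linear _ _) (tcons_r_bilinear2 y). Qed.
Let hin3_bilinear_l x : bilinear_map (fun a b : U => hin (x ⊗ (a ⊗ b)) : C3).
Proof.
exact: linear_bilinear (linear_comp (tpure_linear_r x) (@hin_linear _ _)) (tpure_bilinear U U).
Qed.
Let hin2_flip_bilinear : bilinear_map (fun a b : U => hin (b ⊗ a) : C2).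
Proof. exact: linear_bilinear (@hin_linear _ _) (bilinear_swap (tpure_bilinear U U)). Qed.

Lemma crcons_linear y : linear (crcons y). Proof. exact/clift_linear/hin3_bilinear_r. Qed.
Lemma clcons_linear x : linear (clcons x). Proof. exact/clift_linear/hin3_bilinear_l. Qed.
Lemma cflip_linear : linear (@cflip K U). Proof. exact/clift_linear/hin2_flip_bilinear. Qed.
Lemma crcons_hin y a b : crcons y (hin (a ⊗ b)) = hin (a ⊗ (b ⊗ y)).
Proof. exact: (clift_pure _ _ (hin3_bilinear_r y)). Qed.
Lemma clcons_hin x a b : clcons x (hin (a ⊗ b)) = hin (x ⊗ (a ⊗ b)).
Proof. exact: (clift_pure _ _ (hin3_bilinear_l x)). Qed.
Lemma cflip_hin a b : cflip (hin (a ⊗ b)) = hin (b ⊗ a) :> C2.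
Proof. exact: (clift_pure _ _ hin2_flip_bilinear). Qed.

Lemma crcons_linear_l s : linear (fun y => crcons y s).
Proof.
move=> c y y'; move: s; apply: (hcompl2_ext sep3) => [||a b].
- exact: crcons_linear.
- exact: linear_addf (linear_comp (crcons_linear y) (scale_linear c)) (crcons_linear y').
by rewrite !crcons_hin tpureDr tpureZr tpureDr tpureZr hin_linear.
Qed.
Lemma clcons_linear_l s : linear (fun x => clcons x s).
Proof.
move=> c x x'; move: s; apply: (hcompl2_ext sep3) => [||a b].
- exact: clcons_linear.
- exact: linear_addf (linear_comp (clcons_linear x) (scale_linear c)) (clcons_linear x').
by rewrite !clcons_hin tpureDl tpureZl hin_linear.
Qed.

Lemma ccycK u : ccyc (ccyc (ccyc u)) = u.
Proof.
move: u; apply: (hcompl3_ext sep3) => [||x y z]; rewrite ?ccyc_hin //.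
exact: linear_comp ccyc_linear (linear_comp ccyc_linear ccyc_linear).
Qed.
Lemma cswap12_ccyc u : cswap12 (ccyc u) = ccyc (ccyc (cswap12 u)).
Proof.
move: u; apply: (hcompl3_ext sep3) => [||x y z]; rewrite ?(ccyc_hin, cswap12_hin) //.
  exact: linear_comp ccyc_linear cswap12_linear.
exact: linear_comp cswap12_linear (linear_comp ccyc_linear ccyc_linear).
Qed.
Lemma cswap12E u : cswap12 u = ccyc (ccyc (cswap23 u)).
Proof.
move: u; apply: (hcompl3_ext sep3) => [||x y z].
- exact: cswap12_linear.
- exact: linear_comp cswap23_linear (linear_comp ccyc_linear ccyc_linear).
by rewrite cswap12_hin cswap23_hin !ccyc_hin.
Qed.
Lemma ccyc_cons x s : ccyc (clcons x s) = crcons x s.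
Proof.
move: s; apply: (hcompl2_ext sep3) => [||a b].
- exact: linear_comp (clcons_linear x) ccyc_linear.
- exact: crcons_linear.
by rewrite clcons_hin ccyc_hin crcons_hin.
Qed.
Lemma cswap12_cons y s : cswap12 (crcons y s) = crcons y (cflip s).
Proof.
move: s; apply: (hcompl2_ext sep3) => [||a b].
- exact: linear_comp (crcons_linear y) cswap12_linear.
- exact: linear_comp cflip_linear (crcons_linear y).
by rewrite crcons_hin cswap12_hin cflip_hin crcons_hin.
Qed.
Lemma cswap23_cons x s : cswap23 (clcons x s) = clcons x (cflip s).
Proof.
move: s; apply: (hcompl2_ext sep3) => [||a b].
- exact: linear_comp (clcons_linear x) cswap23_linear.
- exact: linear_comp cflip_linear (clcons_linear x).
by rewrite clcons_hin cswap23_hin cflip_hin clcons_hin.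
Qed.

Definition plus_ccp u : C3 := u + ccyc u + ccyc (ccyc u).
Lemma plus_ccp_linear : linear plus_ccp.
Proof.
apply: linear_addf; first exact: linear_addf (@id_linear _ _) ccyc_linear.
exact: linear_comp ccyc_linear ccyc_linear.
Qed.
Lemma plus_ccp_cyc u : plus_ccp (ccyc u) = plus_ccp u.
Proof. by rewrite /plus_ccp ccycK; abelian. Qed.
Lemma plus_ccp_cons x s : plus_ccp (clcons x s) = plus_ccp (crcons x s).
Proof. by rewrite -ccyc_cons plus_ccp_cyc. Qed.
Lemma plus_ccp_swap u : plus_ccp (cswap12 u) = plus_ccp (cswap23 u).
Proof. by rewrite cswap12E !plus_ccp_cyc. Qed.

Section Cobracket.
Variable phi : U -> C2.
Hypothesis lphi : linear phi.

Definition cdelta_id : C2 -> C3 := clift (fun x y => crcons y (phi x)).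
Definition cid_delta : C2 -> C3 := clift (fun x y => clcons x (phi y)).

Lemma cdelta_id_bilinear : bilinear_map (fun x y => crcons y (phi x)).
Proof.
split=> [y|x]; last exact: crcons_linear_l.
exact: linear_comp lphi (crcons_linear y).
Qed.
Lemma cid_delta_bilinear : bilinear_map (fun x y => clcons x (phi y)).
Proof.
split=> [y|x]; first exact: clcons_linear_l.
exact: linear_comp lphi (clcons_linear x).
Qed.
Lemma cdelta_id_linear : linear cdelta_id. Proof. exact/clift_linear/cdelta_id_bilinear. Qed.
Lemma cid_delta_linear : linear cid_delta. Proof. exact/clift_linear/cid_delta_bilinear. Qed.
Lemma cdelta_id_hin x y : cdelta_id (hin (x ⊗ y)) = crcons y (phi x).
Proof. exact/clift_pure/cdelta_id_bilinear. Qed.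
Lemma cid_delta_hin x y : cid_delta (hin (x ⊗ y)) = clcons x (phi y).
Proof. exact/clift_pure/cid_delta_bilinear. Qed.

Lemma cdelta_id_flip s : cdelta_id (cflip s) = ccyc (cid_delta s).
Proof.
move: s; apply: (hcompl2_ext sep3) => [||a b].
- exact: linear_comp cflip_linear cdelta_id_linear.
- exact: linear_comp cid_delta_linear ccyc_linear.
by rewrite cflip_hin cdelta_id_hin cid_delta_hin ccyc_cons.
Qed.
End Cobracket.

Lemma cswap12_delta_id phi s : linear phi ->
  cswap12 (cdelta_id phi s) = cdelta_id (fun x => cflip (phi x)) s.
Proof.
move=> lphi; have lop := linear_comp lphi cflip_linear.
move: s; apply: (hcompl2_ext sep3) => [||a b].
- exact: linear_comp (cdelta_id_linear lphi) cswap12_linear.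
- exact: cdelta_id_linear lop.
by rewrite (cdelta_id_hin lphi) (cdelta_id_hin lop) cswap12_cons.
Qed.
Lemma cswap23_id_delta phi s : linear phi ->
  cswap23 (cid_delta phi s) = cid_delta (fun x => cflip (phi x)) s.
Proof.
move=> lphi; have lop := linear_comp lphi cflip_linear.
move: s; apply: (hcompl2_ext sep3) => [||a b].
- exact: linear_comp (cid_delta_linear lphi) cswap23_linear.
- exact: cid_delta_linear lop.
by rewrite (cid_delta_hin lphi) (cid_delta_hin lop) cswap23_cons.
Qed.
Lemma cdelta_id_sub phi psi s : linear phi -> linear psi ->
  cdelta_id (fun x => phi x - psi x) s = cdelta_id phi s - cdelta_id psi s.
Proof.
move=> lp lq; have l := linear_subf lp lq; move: s; apply: (hcompl2_ext sep3) => [||a b].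
- exact: cdelta_id_linear l.
- exact: linear_subf (cdelta_id_linear lp) (cdelta_id_linear lq).
rewrite (cdelta_id_hin l) (cdelta_id_hin lp) (cdelta_id_hin lq).
exact: lin_sub (crcons_linear b) _ _.
Qed.
Lemma cid_delta_sub phi psi s : linear phi -> linear psi ->
  cid_delta (fun x => phi x - psi x) s = cid_delta phi s - cid_delta psi s.
Proof.
move=> lp lq; have l := linear_subf lp lq; move: s; apply: (hcompl2_ext sep3) => [||a b].
- exact: cid_delta_linear l.
- exact: linear_subf (cid_delta_linear lp) (cid_delta_linear lq).
rewrite (cid_delta_hin l) (cid_delta_hin lp) (cid_delta_hin lq).
exact: lin_sub (clcons_linear a) _ _.
Qed.
Lemma cdelta_id_scale phi c s : linear phi ->
  cdelta_id (fun x => c *: phi x) s = c *: cdelta_id phi s.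
Proof.
move=> lp; have l := linear_comp lp (scale_linear c); move: s.
apply: (hcompl2_ext sep3) => [||a b].
- exact: cdelta_id_linear l.
- exact: linear_comp (cdelta_id_linear lp) (scale_linear c).
rewrite (cdelta_id_hin l) (cdelta_id_hin lp).
exact: lin_scale (crcons_linear b) _ _.
Qed.

(** Put T = (Delta (x) id) Delta(x) and let S be T with its first two factors exchanged. By
    coassociativity the four terms of (d (x) id)(d(x)) are T minus a cyclic permutation of T, less S
    minus a cyclic permutation of S; the cyclic sum kills both differences. *)
Lemma cojacobi_of_coassoc (Delta : U -> C2) : linear Delta ->
  (forall x, cdelta_id Delta (Delta x) = cid_delta Delta (Delta x)) ->
  let d x := Delta x - cflip (Delta x) in
  forall x, plus_ccp (cdelta_id d (d x)) = 0.
Proof.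
move=> lD coassoc d x; have lop := linear_comp lD cflip_linear.
set T := cdelta_id Delta (Delta x).
have flipE : cdelta_id Delta (cflip (Delta x)) = ccyc T.
  by rewrite (cdelta_id_flip lD) /T coassoc.
have e1 : cdelta_id Delta (d x) = T - ccyc T.
  by rewrite -flipE; apply: lin_sub (cdelta_id_linear lD) _ _.
have e2 : cdelta_id (fun y => cflip (Delta y)) (d x)
    = cswap12 T - ccyc (ccyc (cswap12 T)).
  rewrite -cswap12_ccyc -(cswap12_delta_id (d x) lD) e1.
  exact: lin_sub cswap12_linear _ _.
have pB u v : plus_ccp (u - v) = plus_ccp u - plus_ccp v.
  exact: lin_sub plus_ccp_linear u v.
have c1 u : plus_ccp (u - ccyc u) = 0 by rewrite pB plus_ccp_cyc subrr.
have c2 u : plus_ccp (u - ccyc (ccyc u)) = 0 by rewrite pB !plus_ccp_cyc subrr.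
move: (cdelta_id_sub (d x) lD lop); rewrite {}e1 {}e2 => ->.
move: (cswap12 T) => S; move: (T - ccyc T) (S - ccyc (ccyc S)) (c1 T) (c2 S) => a b a0 b0.
by apply: etrans (pB a b) _; rewrite a0 b0 subrr.
Qed.
End CompletedSquare.

Lemma hin_mul (K : comNzRingType) (A : lmodType (fps K)) (sA : alg_struct A) (a b : A) :
  hin (alg_mul sA a b) = hcompl_mul sA (hin a) (hin b).
Proof.
apply: hcompl_ext => n; apply: hcong_trans (happrox_in _ _) _.
apply/hcong_sym/(hcong_trans (happrox_mul _ _ _ _)).
exact: hcong_bilinear (alg_bilinear sA) (happrox_in _ _) (happrox_in _ _).
Qed.

Section CompletedSquareRing.
Variables (K : comNzRingType) (U : algType (fps K)).
Local Notation C2 := (ctens2 U).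
Local Notation C3 := (ctens3 U).
Implicit Types (x y z : U) (s t : C2) (u v : C3).

Let sep2 : hseparated C2. Proof. exact: hcompl_separated. Qed.
Let sep3 : hseparated C3. Proof. exact: hcompl_separated. Qed.
Let mul2 := ctens2_mul_bilinear U.
Let mul3 := ctens3_mul_bilinear U.

Lemma hin2M a b a' b' :
  (hin (a ⊗ b) : C2) * (hin (a' ⊗ b') : C2) = hin ((a * a') ⊗ (b * b')).
Proof.
rewrite -atens2_mulE; symmetry; exact: (hin_mul (tens_alg (alg_of U) (alg_of U))).
Qed.

Lemma hin3M a b c a' b' c' :
  (hin (a ⊗ (b ⊗ c)) : C3) * (hin (a' ⊗ (b' ⊗ c')) : C3)
  = hin ((a * a') ⊗ ((b * b') ⊗ (c * c'))).
Proof.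
rewrite -atens3_mulE; symmetry.
exact: (hin_mul (tens_alg (alg_of U) (tens_alg (alg_of U) (alg_of U)))).
Qed.

Lemma cflipM s t : cflip (s * t) = cflip s * cflip t.
Proof.
have lf := @cflip_linear K U.
have B1 := linear_bilinear lf mul2; have B2 := bilinear_comp lf lf mul2.
move: s t; apply: (hcompl2_bilinear_ext sep2 B1 B2) => a b a' b'.
have -> := hin2M a b a' b'; rewrite !cflip_hin.
by have -> := hin2M b a b' a'.
Qed.

Lemma crconsM y y' s t : crcons (y * y') (s * t) = crcons y s * crcons y' t.
Proof.
have B1 := linear_bilinear (crcons_linear (y * y')) mul2.
have B2 := bilinear_comp (crcons_linear y) (crcons_linear y') mul3.
move: s t; apply: (hcompl2_bilinear_ext sep3 B1 B2) => a b a' b'.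
have -> := hin2M a b a' b'; rewrite !crcons_hin.
by have -> := hin3M a b y a' b' y'.
Qed.

Lemma clconsM x x' s t : clcons (x * x') (s * t) = clcons x s * clcons x' t.
Proof.
have B1 := linear_bilinear (clcons_linear (x * x')) mul2.
have B2 := bilinear_comp (clcons_linear x) (clcons_linear x') mul3.
move: s t; apply: (hcompl2_bilinear_ext sep3 B1 B2) => a b a' b'.
have -> := hin2M a b a' b'; rewrite !clcons_hin.
by have -> := hin3M x a b x' a' b'.
Qed.

Lemma leg12E s : leg12 s = crcons 1 s. Proof. by []. Qed.
Lemma leg23E s : leg23 s = clcons 1 s. Proof. by []. Qed.
Lemma cop_idE (H : hopf_ops U) s : cop_id H s = cdelta_id (cop H) s. Proof. by []. Qed.
Lemma id_copE (H : hopf_ops U) s : id_cop H s = cid_delta (cop H) s. Proof. by []. Qed.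
Lemma cswap12_leg12 s : cswap12 (leg12 s) = leg12 (cflip s).
Proof. exact: cswap12_cons. Qed.
Lemma cswap23_leg23 s : cswap23 (leg23 s) = leg23 (cflip s).
Proof. exact: cswap23_cons. Qed.
Lemma plus_ccp_leg23 s : plus_ccp (leg23 s) = plus_ccp (leg12 s).
Proof. exact: plus_ccp_cons. Qed.
Lemma leg12_linear : linear (@leg12 K U). Proof. exact: crcons_linear. Qed.
Lemma leg23_linear : linear (@leg23 K U). Proof. exact: clcons_linear. Qed.
Lemma leg12M s t : leg12 (s * t) = leg12 s * leg12 t.
Proof. by rewrite leg12E -{1}[1]mulr1 crconsM. Qed.
Lemma leg23M s t : leg23 (s * t) = leg23 s * leg23 t.
Proof. by rewrite leg23E -{1}[1]mulr1 clconsM. Qed.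
Lemma leg12_1 : leg12 1 = 1 :> C3.
Proof. exact: (crcons_hin 1 1 1). Qed.
Lemma leg23_1 : leg23 1 = 1 :> C3.
Proof. exact: (clcons_hin 1 1 1). Qed.

Section Morphism.
Variable phi : U -> C2.
Hypotheses (lphi : linear phi) (phiM : monoid_morphism phi).

Lemma cdelta_idM s t : cdelta_id phi (s * t) = cdelta_id phi s * cdelta_id phi t.
Proof.
have ld := cdelta_id_linear lphi.
have B1 := linear_bilinear ld mul2; have B2 := bilinear_comp ld ld mul3.
move: s t; apply: (hcompl2_bilinear_ext sep3 B1 B2) => a b a' b'.
have -> := hin2M a b a' b'; rewrite !(cdelta_id_hin lphi).
by rewrite (phiM.2 a a') crconsM.
Qed.

Lemma cid_deltaM s t : cid_delta phi (s * t) = cid_delta phi s * cid_delta phi t.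
Proof.
have ld := cid_delta_linear lphi.
have B1 := linear_bilinear ld mul2; have B2 := bilinear_comp ld ld mul3.
move: s t; apply: (hcompl2_bilinear_ext sep3 B1 B2) => a b a' b'.
have -> := hin2M a b a' b'; rewrite !(cid_delta_hin lphi).
by rewrite (phiM.2 b b') clconsM.
Qed.

Lemma cdelta_id_1 : cdelta_id phi 1 = 1.
Proof.
have -> := cdelta_id_hin lphi 1 1; rewrite phiM.1.
exact: (crcons_hin 1 1 1).
Qed.
Lemma cid_delta_1 : cid_delta phi 1 = 1.
Proof.
have -> := cid_delta_hin lphi 1 1; rewrite phiM.1.
exact: (clcons_hin 1 1 1).
Qed.

End Morphism.

Lemma cdelta_id_conj (phi : U -> C2) F G s : linear phi ->
  cdelta_id (fun x => F * phi x * G) s = leg12 F * cdelta_id phi s * leg12 G.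
Proof.
move=> lphi; have lF : linear (fun x => F * phi x * G).
  exact: linear_comp (linear_comp lphi (mul2.2 F)) (mul2.1 G).
have ld := cdelta_id_linear lphi.
have l2 : linear (fun s => leg12 F * cdelta_id phi s * leg12 G).
  exact: linear_comp (linear_comp ld (mul3.2 _)) (mul3.1 _).
move: s; apply: (hcompl2_ext sep3 (cdelta_id_linear lF) l2) => a b.
rewrite (cdelta_id_hin lF) (cdelta_id_hin lphi) !leg12E.
by rewrite -(crconsM 1 b F (phi a)) -(crconsM (1 * b) 1) mul1r mulr1.
Qed.

Lemma cid_delta_conj (phi : U -> C2) F G s : linear phi ->
  cid_delta (fun x => F * phi x * G) s = leg23 F * cid_delta phi s * leg23 G.
Proof.
move=> lphi; have lF : linear (fun x => F * phi x * G).
  exact: linear_comp (linear_comp lphi (mul2.2 F)) (mul2.1 G).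
have ld := cid_delta_linear lphi.
have l2 : linear (fun s => leg23 F * cid_delta phi s * leg23 G).
  exact: linear_comp (linear_comp ld (mul3.2 _)) (mul3.1 _).
move: s; apply: (hcompl2_ext sep3 (cid_delta_linear lF) l2) => a b.
rewrite (cid_delta_hin lF) (cid_delta_hin lphi) !leg23E.
by rewrite -(clconsM 1 a F (phi b)) -(clconsM (1 * a) 1) mul1r mulr1.
Qed.
End CompletedSquareRing.

(** * Reduction modulo hbar of completed tensors *)

Section Reduction.
Variables (K : comNzRingType) (U : algType (fps K)) (A : algType K) (p : U -> A).
Hypothesis free : hfree p.
Hypothesis pM : monoid_morphism p.
Local Notation C2 := (ctens2 U).
Local Notation C3 := (ctens3 U).
Implicit Types (x y z : U) (s t : C2) (u v : C3).

Definition tred2 : tens U U -> tens A A := tlift (fun x y => p x ⊗ p y).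
Definition tred3 : tens U (tens U U) -> tens A (tens A A) := tlift (fun x w => p x ⊗ tred2 w).
(** For A = U(g) this is convertible to [red2 p], with values in a type that carries a ring
    structure. *)
Definition cred2 : C2 -> atens2 A := hred tred2.
Definition cred3 : C3 -> atens3 A := hred tred3.

Lemma free2 : hfree tred2. Proof. exact: hfree_tens. Qed.
Lemma free3 : hfree tred3. Proof. exact: hfree_tens free free2. Qed.

Lemma tred2_pure x y : tred2 (x ⊗ y) = p x ⊗ p y.
Proof. exact: hfree_tens_pure. Qed.
Lemma tred3_pure x y z : tred3 (x ⊗ (y ⊗ z)) = p x ⊗ (p y ⊗ p z).
Proof. by rewrite -tred2_pure; apply: hfree_tens_pure free2. Qed.
Lemma cred2_hin x y : cred2 (hin (x ⊗ y)) = p x ⊗ p y.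
Proof. by rewrite -tred2_pure; apply: hred_hin free2 _. Qed.
Lemma cred3_hin x y z : cred3 (hin (x ⊗ (y ⊗ z))) = p x ⊗ (p y ⊗ p z).
Proof. by rewrite -tred3_pure; apply: hred_hin free3 _. Qed.
Lemma cred2D s t : cred2 (s + t) = cred2 s + cred2 t. Proof. exact: (hredD free2). Qed.
Lemma cred3D u v : cred3 (u + v) = cred3 u + cred3 v. Proof. exact: (hredD free3). Qed.
Lemma cred2N s : cred2 (- s) = - cred2 s. Proof. exact: (hredN free2). Qed.
Lemma cred3N u : cred3 (- u) = - cred3 u. Proof. exact: (hredN free3). Qed.
Lemma cred2B s t : cred2 (s - t) = cred2 s - cred2 t. Proof. by rewrite cred2D cred2N. Qed.
Lemma cred3B u v : cred3 (u - v) = cred3 u - cred3 v. Proof. by rewrite cred3D cred3N. Qed.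
Lemma cred2_hbar s : cred2 (hbar *: s) = 0. Proof. exact: (hred_hbar free2). Qed.
Lemma cred3_hbar u : cred3 (hbar *: u) = 0. Proof. exact: (hred_hbar free3). Qed.
Lemma cred2Z a s : cred2 (a *: s) = a 0%N *: cred2 s. Proof. exact: (hredZ free2). Qed.
Lemma cred2_kernel s : cred2 s = 0 <-> exists t, s = hbar *: t.
Proof. exact: hred_kernel free2 s. Qed.
Lemma cred2_hcong s t : hcong 1 s t -> cred2 s = cred2 t. Proof. exact: (hred_hcong free2). Qed.
Lemma torsionfree2 s : hbar *: s = 0 -> s = 0.
Proof. exact: (hcompl_torsionfree free2). Qed.
Lemma torsionfree3 u : hbar *: u = 0 -> u = 0.
Proof. exact: (hcompl_torsionfree free3). Qed.

Section Ext.
Variable V : zmodType.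

Lemma cred2_ext (h1 h2 : C2 -> V) :
  {morph h1 : x y / x + y} -> {morph h2 : x y / x + y} ->
  (forall s, h1 (hbar *: s) = 0) -> (forall s, h2 (hbar *: s) = 0) ->
  (forall x y, h1 (hin (x ⊗ y)) = h2 (hin (x ⊗ y))) -> forall s, h1 s = h2 s.
Proof.
move=> a1 a2 k1 k2 E; apply: (hcompl_additive_ext a1 a2 k1 k2).
elim/tens_ind => [|x y t IH].
  by rewrite (lin_zero (@hin_linear _ _)) -(scaler0 _ hbar) k1 k2.
rewrite (lin_add (@hin_linear _ _)); have -> := a1 (hin (x ⊗ y)) (hin t).
by have -> := a2 (hin (x ⊗ y)) (hin t); rewrite IH E.
Qed.

Lemma cred3_ext (h1 h2 : C3 -> V) :
  {morph h1 : x y / x + y} -> {morph h2 : x y / x + y} ->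
  (forall u, h1 (hbar *: u) = 0) -> (forall u, h2 (hbar *: u) = 0) ->
  (forall x y z, h1 (hin (x ⊗ (y ⊗ z))) = h2 (hin (x ⊗ (y ⊗ z)))) -> forall u, h1 u = h2 u.
Proof.
move=> a1 a2 k1 k2 E; apply: (hcompl_additive_ext a1 a2 k1 k2).
elim/tens_ind => [|x s t IH].
  by rewrite (lin_zero (@hin_linear _ _)) -(scaler0 _ hbar) k1 k2.
rewrite (lin_add (@hin_linear _ _)); have -> := a1 (hin (x ⊗ s)) (hin t).
have -> := a2 (hin (x ⊗ s)) (hin t); rewrite IH; congr (_ + _).
elim/tens_ind: s => [|y z s IHs].
  by rewrite tpure0r (lin_zero (@hin_linear _ _)) -(scaler0 _ hbar) k1 k2.
rewrite tpureDr (lin_add (@hin_linear _ _)); have -> := a1 (hin (x ⊗ (y ⊗ z))) (hin (x ⊗ s)).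
by have -> := a2 (hin (x ⊗ (y ⊗ z))) (hin (x ⊗ s)); rewrite IHs E.
Qed.
End Ext.

Lemma cred22_natural (L : C2 -> C2) (l : tens A A -> tens A A) : linear L -> linear l ->
  (forall x y, cred2 (L (hin (x ⊗ y))) = l (p x ⊗ p y)) ->
  forall s, cred2 (L s) = l (cred2 s).
Proof.
move=> lL ll E; apply: cred2_ext => [s t|s t|s|s|x y].
- by have -> := lin_add lL s t; apply: cred2D.
- by rewrite cred2D (lin_add ll).
- by have -> := lin_scale lL hbar s; apply: cred2_hbar.
- by rewrite cred2_hbar (lin_zero ll).
by rewrite E cred2_hin.
Qed.

Lemma cred23_natural (L : C2 -> C3) (l : tens A A -> atens3 A) : linear L -> linear l ->
  (forall x y, cred3 (L (hin (x ⊗ y))) = l (p x ⊗ p y)) ->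
  forall s, cred3 (L s) = l (cred2 s).
Proof.
move=> lL ll E; apply: cred2_ext => [s t|s t|s|s|x y].
- by have -> := lin_add lL s t; apply: cred3D.
- by rewrite cred2D (lin_add ll).
- by have -> := lin_scale lL hbar s; apply: cred3_hbar.
- by rewrite cred2_hbar (lin_zero ll).
by rewrite E cred2_hin.
Qed.

Lemma cred33_natural (L : C3 -> C3) (l : atens3 A -> atens3 A) : linear L -> linear l ->
  (forall x y z, cred3 (L (hin (x ⊗ (y ⊗ z)))) = l (p x ⊗ (p y ⊗ p z))) ->
  forall u, cred3 (L u) = l (cred3 u).
Proof.
move=> lL ll E; apply: cred3_ext => [s t|s t|s|s|x y z].
- by have -> := lin_add lL s t; apply: cred3D.
- by rewrite cred3D (lin_add ll).
- by have -> := lin_scale lL hbar s; apply: cred3_hbar.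
- by rewrite cred3_hbar (lin_zero ll).
by rewrite E cred3_hin.
Qed.

Lemma cred2_flip s : cred2 (cflip s) = tflip (cred2 s).
Proof.
apply: cred22_natural => [||x y]; [exact: cflip_linear | exact: tflip_linear |].
by rewrite cflip_hin cred2_hin tflip_pure.
Qed.
Lemma cred3_cyc u : cred3 (ccyc u) = cyc3 (cred3 u).
Proof.
apply: cred33_natural => [||x y z]; [exact: ccyc_linear | exact: cyc3_linear |].
by rewrite ccyc_hin cred3_hin cyc3_pure.
Qed.
Lemma cred3_swap12 u : cred3 (cswap12 u) = swap12 (cred3 u).
Proof.
apply: cred33_natural => [||x y z]; [exact: cswap12_linear | exact: swap12_linear |].
by rewrite cswap12_hin cred3_hin swap12_pure.
Qed.
Lemma cred3_plus_ccp u : cred3 (plus_ccp u) = plus_cp (cred3 u).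
Proof. by rewrite /plus_ccp !cred3D !cred3_cyc. Qed.
Lemma cred3_crcons y s : cred3 (crcons y s) = tcons_r (p y) (cred2 s).
Proof.
apply: cred23_natural => [||a b]; [exact: crcons_linear | exact: tcons_r_linear |].
by rewrite crcons_hin cred3_hin tcons_r_pure.
Qed.
Lemma cred3_clcons x s : cred3 (clcons x s) = p x ⊗ cred2 s.
Proof.
apply: (cred23_natural (l := fun s : tens A A => p x ⊗ s)) => [||a b].
- exact: clcons_linear.
- exact: tpure_linear_r.
by rewrite clcons_hin cred3_hin.
Qed.
Lemma cred3_leg12 s : cred3 (leg12 s) = aleg12 (cred2 s).
Proof. by rewrite leg12E cred3_crcons pM.1. Qed.
Lemma cred3_leg23 s : cred3 (leg23 s) = aleg23 (cred2 s).
Proof. by rewrite leg23E cred3_clcons pM.1. Qed.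

Section Cobracket.
Variables (phi : U -> C2) (phi0 : A -> tens A A).
Hypotheses (lphi : linear phi) (lphi0 : linear phi0).
Hypothesis phiE : forall x, cred2 (phi x) = phi0 (p x).

Lemma cred3_delta_id s : cred3 (cdelta_id phi s) = delta_id phi0 (cred2 s).
Proof.
apply: cred23_natural => [||x y]; [exact: cdelta_id_linear | exact: delta_id_linear |].
by rewrite (cdelta_id_hin lphi) cred3_crcons phiE delta_id_pure.
Qed.
Lemma cred3_id_delta s : cred3 (cid_delta phi s) = id_delta phi0 (cred2 s).
Proof.
apply: cred23_natural => [||x y]; [exact: cid_delta_linear | exact: id_delta_linear |].
by rewrite (cid_delta_hin lphi) cred3_clcons phiE id_delta_pure.
Qed.
End Cobracket.

Lemma cred2M s t : cred2 (s * t) = cred2 s * cred2 t.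
Proof.
have [ml mr] := ctens2_mul_bilinear U.
move: s; apply: cred2_ext => [s s'|s s'|s|s|x y].
- by rewrite mulrDl cred2D.
- by rewrite cred2D mulrDl.
- by have -> := lin_scale (ml t) hbar s; apply: cred2_hbar.
- by rewrite cred2_hbar mul0r.
move: t; apply: cred2_ext => [t t'|t t'|t|t|x' y'].
- by rewrite mulrDr cred2D.
- by rewrite cred2D mulrDr.
- by have -> := lin_scale (mr (hin (x ⊗ y))) hbar t; apply: cred2_hbar.
- by rewrite cred2_hbar mulr0.
by have -> := hin2M x y x' y'; rewrite !cred2_hin !pM.2 atens2_mulE.
Qed.

Lemma cred2_1 : cred2 1 = 1.
Proof. by have := cred2_hin 1 1; rewrite pM.1. Qed.

Lemma cred3M u v : cred3 (u * v) = cred3 u * cred3 v.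
Proof.
have [ml mr] := ctens3_mul_bilinear U.
move: u; apply: cred3_ext => [s s'|s s'|s|s|x y z].
- by rewrite mulrDl cred3D.
- by rewrite cred3D mulrDl.
- by have -> := lin_scale (ml v) hbar s; apply: cred3_hbar.
- by rewrite cred3_hbar mul0r.
move: v; apply: cred3_ext => [t t'|t t'|t|t|x' y' z'].
- by rewrite mulrDr cred3D.
- by rewrite cred3D mulrDr.
- by have -> := lin_scale (mr (hin (x ⊗ (y ⊗ z)))) hbar t; apply: cred3_hbar.
- by rewrite cred3_hbar mulr0.
by have -> := hin3M x y z x' y' z'; rewrite !cred3_hin !pM.2 atens3_mulE.
Qed.
End Reduction.

(** * Twisting a complete topological Hopf algebra *)

Lemma ring_invE (A : pzRingType) (x y : A) : x * y = 1 -> y * x = 1 -> ring_inv x = y.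
Proof.
move=> xy yx; have [xi _] := @xgetPex A 0 [set z | x * z = 1 /\ z * x = 1] (ex_intro _ y (conj xy yx)).
by rewrite -[LHS]mul1r -yx -mulrA [x * _]xi mulr1.
Qed.

(** Both sides are the conjugate of x by the common product ab = cd. The case of interest is the
    twist equation, with x an iterated coproduct. *)
Lemma conj_quotient (R : pzRingType) (a a' b b' c c' d d' x : R) :
  a * a' = 1 -> b * b' = 1 -> c' * c = 1 -> d' * d = 1 -> a * b = c * d ->
  a * (b * x * b') * a' = c * (d * x * d') * c'.
Proof.
move=> aa bb cc dd E; have -> : a * (b * x * b') * a' = (a * b) * x * (b' * a').
  by rewrite !mulrA.
have -> : c * (d * x * d') * c' = (c * d) * x * (d' * c') by rewrite !mulrA.
rewrite E; congr (_ * _).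
have l : d' * c' * (a * b) = 1 by rewrite E mulrA -[d' * c' * c]mulrA cc mulr1.
have r : a * b * (b' * a') = 1 by rewrite mulrA -[a * b * b']mulrA bb mulr1.
by rewrite -[LHS]mul1r -l -mulrA r mulr1.
Qed.

Section CompleteAlgebra.
Variables (K : comNzRingType) (U : algType (fps K)).
Local Notation C2 := (ctens2 U).
Local Notation C3 := (ctens3 U).
Hypothesis sepU : hseparated U.
Hypothesis complU : forall x : hcompl U, exists t, hin t = x.
Implicit Types (x y z : U) (s t : C2).

Lemma hin_inj : injective (@hin K U).
Proof. by move=> x y xy; apply: sepU => n; apply/hcong_hin; rewrite xy; apply: hcong_refl. Qed.
Lemma houtK (x : hcompl U) : hin (hout x) = x.
Proof. exact: (@xgetPex U 0 [set t | hin t = x] (complU x)). Qed.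
Lemma hinK x : hout (hin x) = x. Proof. exact/hin_inj/houtK. Qed.
Lemma hout_linear : linear (@hout K U).
Proof. by move=> a x y; apply: hin_inj; rewrite hin_linear !houtK. Qed.

(** Geometric series in 1 - x, summed in the completion and brought back to U by completeness. *)
Lemma inv_near_1 x : hcong 1 x 1 -> exists2 y, x * y = 1 & y * x = 1.
Proof.
move=> x1; set e := 1 - x; have [z ez] : exists z, e = hbar *: z.
  by have [z] := hcong_sym x1; exists z; rewrite -[hbar]expr1.
have en n : hcong n (e ^+ n) 0.
  exists (z ^+ n); rewrite subr0 ez; elim: n => [|n IH]; first by rewrite !expr0 scale1r.
  by rewrite !exprS IH -scalerAl -scalerAr scalerA.
have [Y YE] : exists Y : hcompl U, forall n, hcong n Y (hin (\sum_(i < n) e ^+ i)).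
  apply: hcompl_complete => n; apply/hcong_hin; rewrite big_ord_recr /=.
  by have := hcongD (hcong_refl n (\sum_(i < n) e ^+ i)) (en n); rewrite addr0.
have yE n : hcong n (hout Y) (\sum_(i < n) e ^+ i).
  by apply/hcong_hin; rewrite houtK.
have [Ml Mr] := mul_bilinear U.
have xE : x = - (e - 1) by rewrite /e opprB opprB addrC subrK.
exists (hout Y); apply: sepU => n.
  apply: hcong_trans (hcong_linear (Mr x) (yE n)) _.
  rewrite /= xE mulNr -subrX1 -[X in hcong _ _ X]subr0 opprB.
  exact: hcongB (hcong_refl _ _) (en n).
apply: hcong_trans (hcong_linear (Ml x) (yE n)) _.
have cE : GRing.comm (\sum_(i < n) e ^+ i) x.
  apply/commr_sym/commr_sum => i _; apply/commrX.
  exact: commrB (commr1 x) (commr_refl x).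
rewrite /= cE xE mulNr -subrX1 -[X in hcong _ _ X]subr0 opprB.
exact: hcongB (hcong_refl _ _) (en n).
Qed.

Section Contraction.
Variable f : U -> U -> U.
Hypothesis bf : bilinear_map f.

Definition cmul2 : C2 -> U := fun s => hout (clift (fun x y => hin (f x y)) s).

Let bhf : bilinear_map (fun x y => hin (f x y)).
Proof. exact: linear_bilinear (@hin_linear _ _) bf. Qed.
Lemma cmul2_linear : linear cmul2.
Proof. exact: linear_comp (clift_linear bhf) hout_linear. Qed.
Lemma cmul2_hin x y : cmul2 (hin (x ⊗ y)) = f x y.
Proof. by rewrite /cmul2 (clift_pure _ _ bhf) hinK. Qed.
Lemma hin_cmul2 s : hin (cmul2 s) = clift (fun x y => hin (f x y)) s.
Proof. exact: houtK. Qed.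
End Contraction.

Lemma cmul2_param (V : lmodType (fps K)) (f : V -> U -> U -> U) s :
  (forall v, bilinear_map (f v)) -> (forall x y, linear (fun v => f v x y)) ->
  linear (fun v => cmul2 (f v) s).
Proof.
move=> bf lf c v w.
have lv := cmul2_linear (bf v); have lw := cmul2_linear (bf w).
move: s; apply: (hcompl2_ext sepU) => [||x y]; first exact: cmul2_linear.
  exact: linear_addf (linear_comp lv (scale_linear c)) lw.
by rewrite !cmul2_hin ?lf.
Qed.

(** * Convolution inverses of the identity *)

Section Convolution.
Variables (Delta : U -> C2) (eps : U -> fps K).
Hypothesis lD : linear Delta.
Hypothesis lE : linear (eps : U -> (fps K)^o).
Hypothesis coassoc : forall x, cdelta_id Delta (Delta x) = cid_delta Delta (Delta x).
Let mulU := mul_bilinear U.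

Let beps_l (phi : U -> U) : linear phi -> bilinear_map (fun x y => eps x *: phi y).
Proof.
move=> lp; split=> [y c x x'|x c y y'] /=; first by rewrite lE scalerDl scalerA.
by rewrite lp scalerDr !scalerA mulrC.
Qed.
Hypothesis counit_l : forall x, cmul2 (fun a b => eps a *: b) (Delta x) = x.
Hypothesis counit_r : forall x, cmul2 (fun a b => eps b *: a) (Delta x) = x.

Variables phi psi : U -> U.
Hypotheses (lphi : linear phi) (lpsi : linear psi).

(** The convolution products of phi with the identity and of the identity with psi. *)
Definition conv_id (x : U) : U := cmul2 (fun a b => phi a * b) (Delta x).
Definition id_conv (x : U) : U := cmul2 (fun a b => a * psi b) (Delta x).

Let bl : bilinear_map (fun a b : U => phi a * b).
Proof. exact: bilinear_comp lphi (@id_linear _ U) mulU. Qed.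
Let br : bilinear_map (fun a b : U => a * psi b).
Proof. exact: bilinear_comp (@id_linear _ U) lpsi mulU. Qed.
Let lconv_id : linear conv_id. Proof. exact: linear_comp lD (cmul2_linear bl). Qed.
Let lid_conv : linear id_conv. Proof. exact: linear_comp lD (cmul2_linear br). Qed.

(** Both sides are the triple convolution of phi, the identity and psi, computed by one trilinear
    map [W] on the two equal iterated coproducts. *)
Lemma conv_assoc x : cmul2 (fun a b => conv_id a * psi b) (Delta x)
  = cmul2 (fun a b => phi a * id_conv b) (Delta x).
Proof.
pose w a := tlift (fun b c : U => phi a * b * psi c).
have w2 a : bilinear_map (fun b c : U => phi a * b * psi c).
  exact: bilinear_comp (mulU.2 (phi a)) lpsi mulU.
have bw : bilinear_map w.
  apply: tlift2_bilinear => // b c.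
  exact: linear_comp (linear_comp lphi (mulU.1 b)) (mulU.1 (psi c)).
have lw := tlift_is_linear bw.
pose W (u : C3) : U := hout (hmap (tlift w) u).
have lW : linear W by exact: linear_comp (hmap_linear lw) hout_linear.
have WE a b c : W (hin (a ⊗ (b ⊗ c))) = phi a * b * psi c.
  rewrite /W (hmap_hin lw) hinK; rewrite (tlift_pure _ _ bw).
  exact: (tlift_pure _ _ (w2 a)).
have b1 : bilinear_map (fun a b => conv_id a * psi b) by exact: bilinear_comp lconv_id lpsi mulU.
have b2 : bilinear_map (fun a b => phi a * id_conv b) by exact: bilinear_comp lphi lid_conv mulU.
have E1 s : cmul2 (fun a b => conv_id a * psi b) s = W (cdelta_id Delta s).
  move: s; apply: (hcompl2_ext sepU) => [||a b]; first exact: cmul2_linear.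
    exact: linear_comp (cdelta_id_linear lD) lW.
  rewrite (cmul2_hin b1) (cdelta_id_hin lD) /conv_id.
  move: (Delta a); apply: (hcompl2_ext sepU) => [||c d].
  - exact: linear_comp (cmul2_linear bl) (mulU.1 (psi b)).
  - exact: linear_comp (crcons_linear b) lW.
  by rewrite (cmul2_hin bl) crcons_hin WE.
have E2 s : cmul2 (fun a b => phi a * id_conv b) s = W (cid_delta Delta s).
  move: s; apply: (hcompl2_ext sepU) => [||a b]; first exact: cmul2_linear.
    exact: linear_comp (cid_delta_linear lD) lW.
  rewrite (cmul2_hin b2) (cid_delta_hin lD) /id_conv.
  move: (Delta b); apply: (hcompl2_ext sepU) => [||c d].
  - exact: linear_comp (cmul2_linear br) (mulU.2 (phi a)).
  - exact: linear_comp (clcons_linear a) lW.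
  by rewrite (cmul2_hin br) clcons_hin WE mulrA.
by rewrite E1 E2 coassoc.
Qed.

Hypothesis right_inv : forall x, id_conv x = eps x *: 1.

Lemma conv_eps_r x : cmul2 (fun a b => phi a * id_conv b) (Delta x) = phi x.
Proof.
have -> : (fun a b => phi a * id_conv b) = (fun a b => eps b *: phi a).
  by apply/funext => a; apply/funext => b; rewrite right_inv -scalerAr mulr1.
rewrite -[in RHS](counit_r x).
have b1 := bilinear_swap (beps_l lphi).
have b2 := bilinear_swap (beps_l (@id_linear _ U)).
move: (Delta x); apply: (hcompl2_ext sepU) => [||a b]; first exact: cmul2_linear.
  exact: linear_comp (cmul2_linear b2) lphi.
by rewrite (cmul2_hin b1) (cmul2_hin b2) (lin_scale lphi).
Qed.

(** Convolution with the identity can be undone on the right by convolution with its inverse psi. *)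
Lemma conv_id_inj : (forall x, conv_id x = 0) -> forall x, phi x = 0.
Proof.
move=> c0 x; rewrite -conv_eps_r -conv_assoc.
have -> : (fun a b => conv_id a * psi b) = (fun a b => 0 * psi b).
  by apply/funext => a; apply/funext => b; rewrite c0.
have b0 : bilinear_map (fun a b : U => 0 * psi b).
  by split=> [y c a a'|a c b b'] /=; rewrite !mul0r scaler0 addr0.
move: (Delta x); apply: (hcompl2_ext sepU) => [||a b]; first exact: cmul2_linear.
  by move=> c a b; rewrite scaler0 addr0.
by rewrite (cmul2_hin b0) mul0r.
Qed.

Lemma conv_inverse_uniq : (forall x, conv_id x = eps x *: 1) -> forall x, phi x = psi x.
Proof.
move=> left_inv x; rewrite -conv_eps_r -conv_assoc.
have -> : (fun a b => conv_id a * psi b) = (fun a b => eps a *: psi b).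
  by apply/funext => a; apply/funext => b; rewrite left_inv -scalerAl mul1r.
rewrite -[in RHS](counit_l x).
have b1 := beps_l lpsi; have b2 := beps_l (@id_linear _ U).
move: (Delta x); apply: (hcompl2_ext sepU) => [||a b]; first exact: cmul2_linear.
  exact: linear_comp (cmul2_linear b2) lpsi.
by rewrite (cmul2_hin b1) (cmul2_hin b2) (lin_scale lpsi).
Qed.
End Convolution.

(** * The antipode and its twist *)

Section Antipode.
Variable H : hopf_ops U.
Hypothesis hopfH : is_top_hopf H.
Local Notation Delta := (cop H).
Local Notation ep := (eps H).
Local Notation S := (antip H).
Let mulU := mul_bilinear U.
Let mul2 := ctens2_mul_bilinear U.

Let lD : linear Delta. Proof. by case: hopfH => -[]. Qed.
Let DM : monoid_morphism Delta. Proof. by case: hopfH => -[]. Qed.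
Let lE : linear (ep : U -> (fps K)^o). Proof. by case: hopfH => _ []. Qed.
Let EM : monoid_morphism ep. Proof. by case: hopfH => _ []. Qed.
Let lS : linear S. Proof. by case: hopfH => _ _ _ _ []. Qed.

Lemma hopf_coassoc x : cdelta_id Delta (Delta x) = cid_delta Delta (Delta x).
Proof. by case: hopfH => _ _ coassoc _ _; apply: coassoc. Qed.

Lemma hopf_counit_l x : cmul2 (fun a b => ep a *: b) (Delta x) = x.
Proof. by case: hopfH => _ _ _ counit _; apply: hin_inj; rewrite hin_cmul2 -(counit x).1. Qed.
Lemma hopf_counit_r x : cmul2 (fun a b => ep b *: a) (Delta x) = x.
Proof. by case: hopfH => _ _ _ counit _; apply: hin_inj; rewrite hin_cmul2 -(counit x).2. Qed.
Lemma hopf_antip_l x : cmul2 (fun a b => S a * b) (Delta x) = ep x *: 1.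
Proof. by case: hopfH => _ _ _ _ [_ anti]; apply: hin_inj; rewrite hin_cmul2 -(anti x).1. Qed.
Lemma hopf_antip_r x : cmul2 (fun a b => a * S b) (Delta x) = ep x *: 1.
Proof. by case: hopfH => _ _ _ _ [_ anti]; apply: hin_inj; rewrite hin_cmul2 -(anti x).2. Qed.

(** Once S is known to be antimultiplicative, the maps u -> S(a) u b form a right action of the
    completed square on U, and the maps u -> a u S(b) a left action. The elements v and w of the
    twist are the images of 1 under F^-1 and F. *)
Definition sandwich_l (u : U) : C2 -> U := cmul2 (fun a b => S a * u * b).
Definition sandwich_r (u : U) : C2 -> U := cmul2 (fun a b => a * u * S b).

Let bl u : bilinear_map (fun a b => S a * u * b).
Proof. exact: bilinear_comp (linear_comp lS (mulU.1 u)) (@id_linear _ U) mulU. Qed.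
Let br u : bilinear_map (fun a b => a * u * S b).
Proof. exact: bilinear_comp (mulU.1 u) lS mulU. Qed.

Lemma sandwich_l_linear u : linear (sandwich_l u). Proof. exact: cmul2_linear. Qed.
Lemma sandwich_r_linear u : linear (sandwich_r u). Proof. exact: cmul2_linear. Qed.
Lemma sandwich_l_hin u a b : sandwich_l u (hin (a ⊗ b)) = S a * u * b.
Proof. exact: (cmul2_hin (bl u)). Qed.
Lemma sandwich_r_hin u a b : sandwich_r u (hin (a ⊗ b)) = a * u * S b.
Proof. exact: (cmul2_hin (br u)). Qed.
Lemma sandwich_l_param s : linear (fun u => sandwich_l u s).
Proof.
apply: cmul2_param => // a b.
exact: linear_comp (mulU.2 (S a)) (mulU.1 b).
Qed.
Lemma sandwich_r_param s : linear (fun u => sandwich_r u s).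
Proof.
apply: cmul2_param => // a b.
exact: linear_comp (mulU.2 a) (mulU.1 (S b)).
Qed.

Lemma sandwich_l_cop x : sandwich_l 1 (Delta x) = ep x *: 1.
Proof.
rewrite -hopf_antip_l; congr (cmul2 _ _).
by apply/funext => a; apply/funext => b; rewrite mulr1.
Qed.
Lemma sandwich_r_cop x : sandwich_r 1 (Delta x) = ep x *: 1.
Proof.
rewrite -hopf_antip_r; congr (cmul2 _ _).
by apply/funext => a; apply/funext => b; rewrite mulr1.
Qed.

Lemma antip1 : S 1 = 1.
Proof.
have E := sandwich_l_cop 1; rewrite DM.1 EM.1 scale1r in E; rewrite -[RHS]E.
by symmetry; apply: etrans (sandwich_l_hin 1 1 1) _; rewrite !mulr1.
Qed.

(* S(y) S(x) and S(xy) are both convolution inverse to multiplication. *)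
Lemma antipM x y : S (x * y) = S y * S x.
Proof.
pose D x y := S (x * y) - S y * S x.
have lDl z : linear (D^~ z).
  exact: linear_subf (linear_comp (mulU.1 z) lS) (linear_comp lS (mulU.2 (S z))).
have lDr z : linear (D z).
  exact: linear_subf (linear_comp (mulU.2 z) lS) (linear_comp lS (mulU.1 (S z))).
have bD z : bilinear_map (fun a b => D a z * b).
  exact: bilinear_comp (lDl z) (@id_linear _ U) mulU.
pose G z := fun t => cmul2 (fun a b => D a z * b) t.
have lGp t : linear (fun z => G z t).
  apply: cmul2_param => // a b; exact: linear_comp (lDr a) (mulU.1 b).
have bG t : bilinear_map (fun c d => G c t * d).
  exact: bilinear_comp (lGp t) (@id_linear _ U) mulU.
(* [B] is the defect [D] convolved with the identity in both arguments. It vanishes on coproducts,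
   and [conv_id_inj] then removes the two convolutions one at a time. *)
pose B s t := cmul2 (fun c d => G c s * d) t.
have BE s t : B s t = sandwich_l 1 (s * t) - sandwich_l (sandwich_l 1 s) t.
  have b1 : bilinear_map B.
    split=> [t'|s']; last exact: cmul2_linear.
    apply: cmul2_param => // c d.
    exact: linear_comp (cmul2_linear (bD c)) (mulU.1 d).
  have b2 : bilinear_map (fun s t => sandwich_l 1 (s * t) - sandwich_l (sandwich_l 1 s) t).
    split=> [t'|s'].
      apply: linear_subf; first exact: linear_comp (mul2.1 t') (sandwich_l_linear 1).
      exact: linear_comp (sandwich_l_linear 1) (sandwich_l_param t').
    apply: linear_subf; last exact: sandwich_l_linear.
    exact: linear_comp (mul2.2 s') (sandwich_l_linear 1).
  move: s t; apply: (hcompl2_bilinear_ext sepU b1 b2) => a b c d.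
  rewrite /B (cmul2_hin (bG _)) /G (cmul2_hin (bD c)).
  have -> := hin2M a b c d; rewrite !sandwich_l_hin !mulr1 /D.
  by rewrite !mulrBl !mulrA.
have B0 z z' : B (Delta z) (Delta z') = 0.
  rewrite BE -(DM.2 z z') !sandwich_l_cop (lin_scale (sandwich_l_param _)).
  by rewrite sandwich_l_cop scalerA EM.2 subrr.
have G0 z z' : G z (Delta z') = 0.
  move: z; apply: (conv_id_inj lD lE hopf_coassoc hopf_counit_r (lGp _) lS hopf_antip_r).
  by move=> z; apply: B0.
apply/eqP; rewrite -subr_eq0; apply/eqP; rewrite -/(D x y).
move: x; apply: (conv_id_inj lD lE hopf_coassoc hopf_counit_r (lDl y) lS hopf_antip_r).
by move=> x; apply: G0.
Qed.

Lemma sandwich_lM u s t : sandwich_l u (s * t) = sandwich_l (sandwich_l u s) t.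
Proof.
have b1 := linear_bilinear (sandwich_l_linear u) mul2.
have b2 : bilinear_map (fun s t => sandwich_l (sandwich_l u s) t).
  split=> [t'|s']; last exact: sandwich_l_linear.
  exact: linear_comp (sandwich_l_linear u) (sandwich_l_param t').
move: s t; apply: (hcompl2_bilinear_ext sepU b1 b2) => a b a' b'.
by have -> := hin2M a b a' b'; rewrite !sandwich_l_hin antipM !mulrA.
Qed.

Lemma sandwich_rM u s t : sandwich_r u (s * t) = sandwich_r (sandwich_r u t) s.
Proof.
have b1 := linear_bilinear (sandwich_r_linear u) mul2.
have b2 : bilinear_map (fun s t => sandwich_r (sandwich_r u t) s).
  split=> [t'|s']; first exact: sandwich_r_linear.
  exact: linear_comp (sandwich_r_linear u) (sandwich_r_param s').
move: s t; apply: (hcompl2_bilinear_ext sepU b1 b2) => a b a' b'.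
by have -> := hin2M a b a' b'; rewrite !sandwich_r_hin antipM !mulrA.
Qed.

Lemma sandwich_l_1 : sandwich_l 1 1 = 1.
Proof. by apply: etrans (sandwich_l_hin 1 1 1) _; rewrite antip1 !mulr1. Qed.
Lemma sandwich_r_1 : sandwich_r 1 1 = 1.
Proof. by apply: etrans (sandwich_r_hin 1 1 1) _; rewrite antip1 !mulr1. Qed.

Section Twist.
Variables (F G : C2).
Hypotheses (FG : F * G = 1) (GF : G * F = 1).
Hypotheses (epF : eps_id H F = hin 1) (Fep : id_eps H F = hin 1).
Hypothesis twF : leg12 F * cop_id H F = leg23 F * id_cop H F.
Hypothesis F1 : hcong 1 F 1.

Let inv_F : ring_inv F = G. Proof. exact: ring_invE. Qed.

Definition twist_cop x : C2 := F * Delta x * G.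
Let lT : linear twist_cop.
Proof. exact: linear_comp (linear_comp lD (mul2.2 F)) (mul2.1 G). Qed.

(** The two iterated coproducts are conjugates of (Delta (x) id) Delta(x) by the two sides of the
    twist equation. *)
Lemma twist_coassoc x : cdelta_id twist_cop (twist_cop x) = cid_delta twist_cop (twist_cop x).
Proof.
have dM := cdelta_idM lD DM; have iM := cid_deltaM lD DM.
rewrite (cdelta_id_conj F G (twist_cop x) lD) (cid_delta_conj F G (twist_cop x) lD).
rewrite /twist_cop !dM !iM -hopf_coassoc.
apply: conj_quotient; last exact: twF.
- exact: etrans (esym (leg12M F G)) (etrans (congr1 _ FG) (leg12_1 U)).
- exact: etrans (esym (dM F G)) (etrans (congr1 _ FG) (cdelta_id_1 lD DM)).
- exact: etrans (esym (leg23M G F)) (etrans (congr1 _ GF) (leg23_1 U)).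
- exact: etrans (esym (iM G F)) (etrans (congr1 _ GF) (cid_delta_1 lD DM)).
Qed.

Let counit_bil_l : bilinear_map (fun a b : U => ep a *: b).
Proof.
split=> [y c x x'|x c y y'] /=; first by rewrite lE scalerDl scalerA.
by rewrite scalerDr !scalerA mulrC.
Qed.
Let counit_bil_r : bilinear_map (fun a b : U => ep b *: a).
Proof. exact: bilinear_swap counit_bil_l. Qed.

Let counit_lM s t : cmul2 (fun a b => ep a *: b) (s * t)
  = cmul2 (fun a b => ep a *: b) s * cmul2 (fun a b => ep a *: b) t.
Proof.
have lc := cmul2_linear counit_bil_l.
have B1 := linear_bilinear lc mul2; have B2 := bilinear_comp lc lc mulU.
move: s t; apply: (hcompl2_bilinear_ext sepU B1 B2) => a b a' b'.
have -> := hin2M a b a' b'; rewrite !(cmul2_hin counit_bil_l) EM.2.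
by rewrite -scalerAl -scalerAr scalerA.
Qed.
Let counit_rM s t : cmul2 (fun a b => ep b *: a) (s * t)
  = cmul2 (fun a b => ep b *: a) s * cmul2 (fun a b => ep b *: a) t.
Proof.
have lc := cmul2_linear counit_bil_r.
have B1 := linear_bilinear lc mul2; have B2 := bilinear_comp lc lc mulU.
move: s t; apply: (hcompl2_bilinear_ext sepU B1 B2) => a b a' b'.
have -> := hin2M a b a' b'; rewrite !(cmul2_hin counit_bil_r) EM.2.
by rewrite -scalerAl -scalerAr scalerA.
Qed.

Lemma twist_counit_l x : cmul2 (fun a b => ep a *: b) (twist_cop x) = x.
Proof.
have EF : cmul2 (fun a b => ep a *: b) F = 1 by apply: hin_inj; rewrite hin_cmul2.
have E1 : cmul2 (fun a b => ep a *: b) 1 = 1.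
  by apply: etrans (cmul2_hin counit_bil_l 1 1) _; rewrite EM.1 scale1r.
have EG : cmul2 (fun a b => ep a *: b) G = 1.
  by rewrite -[LHS]mul1r -{1}EF -counit_lM FG.
by rewrite /twist_cop !counit_lM EF EG mul1r mulr1 hopf_counit_l.
Qed.
Lemma twist_counit_r x : cmul2 (fun a b => ep b *: a) (twist_cop x) = x.
Proof.
have EF : cmul2 (fun a b => ep b *: a) F = 1 by apply: hin_inj; rewrite hin_cmul2.
have E1 : cmul2 (fun a b => ep b *: a) 1 = 1.
  by apply: etrans (cmul2_hin counit_bil_r 1 1) _; rewrite EM.1 scale1r.
have EG : cmul2 (fun a b => ep b *: a) G = 1.
  by rewrite -[LHS]mul1r -{1}EF -counit_rM FG.
by rewrite /twist_cop !counit_rM EF EG mul1r mulr1 hopf_counit_r.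
Qed.

Let G1 : hcong 1 G 1.
Proof.
have := hcong_linear (mul2.1 G) F1; rewrite /= FG mul1r.
exact: hcong_sym.
Qed.

Let v := sandwich_l 1 G.
Let w := sandwich_r 1 F.

Lemma twist_elt_near_1 : hcong 1 v 1.
Proof. by rewrite -sandwich_l_1; apply: hcong_linear (sandwich_l_linear 1) G1. Qed.
Let w1 : hcong 1 w 1.
Proof. by rewrite -sandwich_r_1; apply: hcong_linear (sandwich_r_linear 1) F1. Qed.

Lemma twist_eltE : twist_elt H F = v.
Proof.
rewrite /twist_elt inv_F /v; congr (hout (clift _ _)).
by apply/funext => a; apply/funext => b; rewrite mulr1.
Qed.

Section Inverses.
Variables (vi wi : U).
Hypotheses (vvi : v * vi = 1) (viv : vi * v = 1) (wwi : w * wi = 1) (wiw : wi * w = 1).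

(** Two candidates for the twisted antipode: the left axiom is easy for [S1], the right one for
    [S2]. *)
Let S1 x := vi * S x * v.
Let S2 x := w * S x * wi.
Let lS1 : linear S1. Proof. exact: linear_comp (linear_comp lS (mulU.2 vi)) (mulU.1 v). Qed.
Let lS2 : linear S2. Proof. exact: linear_comp (linear_comp lS (mulU.2 w)) (mulU.1 wi). Qed.

Lemma twist_antip_l x : cmul2 (fun a b => S1 a * b) (twist_cop x) = ep x *: 1.
Proof.
have -> : cmul2 (fun a b => S1 a * b) (twist_cop x) = vi * sandwich_l v (twist_cop x).
  have b1 : bilinear_map (fun a b => S1 a * b).
    exact: bilinear_comp lS1 (@id_linear _ U) mulU.
  move: (twist_cop x); apply: (hcompl2_ext sepU) => [||a b]; first exact: cmul2_linear.
    exact: linear_comp (sandwich_l_linear v) (mulU.2 vi).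
  by rewrite (cmul2_hin b1) sandwich_l_hin !mulrA.
have vF : sandwich_l v F = 1 by rewrite /v -sandwich_lM GF sandwich_l_1.
rewrite /twist_cop !sandwich_lM vF sandwich_l_cop.
by rewrite (lin_scale (sandwich_l_param G)) -/v -scalerAr viv.
Qed.

Lemma twist_antip_r x : cmul2 (fun a b => a * S2 b) (twist_cop x) = ep x *: 1.
Proof.
have -> : cmul2 (fun a b => a * S2 b) (twist_cop x) = sandwich_r w (twist_cop x) * wi.
  have b1 : bilinear_map (fun a b => a * S2 b).
    exact: bilinear_comp (@id_linear _ U) lS2 mulU.
  move: (twist_cop x); apply: (hcompl2_ext sepU) => [||a b]; first exact: cmul2_linear.
    exact: linear_comp (sandwich_r_linear w) (mulU.1 wi).
  by rewrite (cmul2_hin b1) sandwich_r_hin !mulrA.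
have wG : sandwich_r w G = 1 by rewrite /w -sandwich_rM GF sandwich_r_1.
rewrite /twist_cop !sandwich_rM wG sandwich_r_cop.
by rewrite (lin_scale (sandwich_r_param F)) -/w -scalerAl wwi.
Qed.

(** With respect to the twisted coproduct, [S1] is a left and [S2] a right convolution inverse of
    the identity. *)
Lemma twist_antipE x : S1 x = S2 x.
Proof.
exact: (conv_inverse_uniq lT lE twist_coassoc twist_counit_l twist_counit_r
          lS1 lS2 twist_antip_r twist_antip_l).
Qed.
End Inverses.

Lemma twist_is_top_hopf : is_top_hopf (twist_hopf H F).
Proof.
have [vi vvi viv] := inv_near_1 twist_elt_near_1.
have [wi wwi wiw] := inv_near_1 w1.
have copE : cop (twist_hopf H F) = twist_cop by rewrite /twist_hopf inv_F.
have antipE x : antip (twist_hopf H F) x = vi * S x * v.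
  by rewrite /= twist_eltE (ring_invE vvi viv).
have lS1 : linear (antip (twist_hopf H F)).
  by move=> c x y; rewrite !antipE lS mulrDr mulrDl -scalerAr -scalerAl.
have tw_r := twist_antip_r wwi.
split.
- rewrite copE; split; first exact: lT.
  split=> [|x y]; rewrite /twist_cop.
    by rewrite DM.1 mulr1 FG.
  rewrite DM.2 -!mulrA; congr (_ * (_ * _)).
  by rewrite [G * (F * _)]mulrA GF mul1r.
- exact: conj lE EM.
- move=> x; rewrite copE; have := twist_coassoc x.
  by rewrite /cdelta_id /cid_delta /cop_id /id_cop copE.
- move=> x; rewrite copE -{2}(twist_counit_l x) -{4}(twist_counit_r x).
  by rewrite !hin_cmul2.
split; first exact: lS1.
move=> x; rewrite copE; split.
  rewrite -(twist_antip_l viv x) hin_cmul2 /mul_antip_id; congr (clift _ _).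
  by apply/funext => a; apply/funext => b; rewrite antipE.
rewrite -(tw_r x) hin_cmul2 /mul_id_antip; congr (clift _ _).
apply/funext => a; apply/funext => b; rewrite antipE.
by rewrite (twist_antipE viv wwi).
Qed.
End Twist.
End Antipode.
End CompleteAlgebra.

(** * Topologically free algebras *)

Section TopFree.
Variables (K : comNzRingType) (M : lmodType (fps K)).
Hypothesis free : top_free M.

Lemma top_free_separated : hseparated M.
Proof.
have [V [f [lf bf]]] := free; move=> x y xy; apply: (bij_inj bf); apply/funext => n.
by have /vps_hcong := hcong_linear lf (xy n.+1); apply.
Qed.

Lemma top_free_complete (x : hcompl M) : exists t, hin t = x.
Proof.
have [V [f [lf [h fK hK]]]] := free.
have lh : linear h by move=> a v w; apply: (can_inj fK); rewrite lf !hK.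
exists (h (fun n => f (happrox x n.+1) n)); apply: hcompl_ext => n.
apply: hcong_trans (happrox_in _ _) _; rewrite -[X in hcong _ _ X]fK.
apply: (hcong_linear lh); apply/vps_hcong => i ni.
have /vps_hcong := hcong_linear lf (coherent_le (happrox_coherent x) ni).
by move/(_ i (ltnSn i)).
Qed.

Variables (A : lmodType K) (p : M -> A).
Hypothesis pL : forall a x y, p (a *: x + y) = a 0%N *: p x + p y.
Hypothesis pS : forall u, exists x, p x = u.
Hypothesis pK : forall x, p x = 0 <-> exists y, x = hbar *: y.

(** Topological freeness provides series over an unknown V. The map [theta] from V to A induced by
    p, with inverse [tau], transports them to series over the given reduction A. *)
Lemma top_free_hfree : hfree p.
Proof.
have [V [f [lf [h fK hK]]]] := free.
have lh : linear h by move=> a v w; apply: (can_inj fK); rewrite lf !hK.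
have [s sE] := choice pS.
have pN x y : p x = p y -> exists z, x - y = hbar *: z.
  by move=> xy; apply/pK; rewrite addrC -scaleN1r pL xy -[(-1 : fps K) 0%N]/(-1) scaleN1r addNr.
have hcst (v : V) a w : vcst (a *: v + w) = fpsC a *: vcst v + vcst w.
  by apply/funext => n; rewrite vpsD vps_fpsC; case: n => //= n; rewrite scaler0 addr0.
have fhbar x : f (hbar *: x) 0%N = 0 by rewrite (lin_scale lf) vps_hbar.
pose theta v := p (h (vcst v)).
have ltheta : linear theta by move=> a v w; rewrite /theta hcst lh pL.
have pE x : p x = theta (f x 0%N).
  have [z xz] : exists z, x - h (vcst (f x 0%N)) = hbar *: z.
    exists (h (fun n => f x n.+1)); rewrite -{1}[x]fK -(lin_sub lh) -(lin_scale lh).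
    congr h; apply/funext => n; rewrite vpsD vpsN vps_hbar.
    by case: n => [|n] /=; rewrite ?subrr ?subr0.
  rewrite /theta -{1}[x](subrK (h (vcst (f x 0%N)))) xz pL.
  by rewrite hbarE scale0r add0r.
pose tau u : V := f (s u) 0%N.
have tauE x : tau (p x) = f x 0%N.
  have [z xz] := pN _ _ (sE (p x)).
  by apply/eqP; rewrite -subr_eq0 -vpsN -vpsD -(lin_sub lf) xz fhbar.
have ltau : linear tau.
  move=> a u v; rewrite -(sE u) -(sE v).
  have -> : a *: p (s u) + p (s v) = p (fpsC a *: s u + s v) by rewrite pL.
  by rewrite !tauE lf vpsD vps_fpsC.
exists (fun x n => theta (f x n)), (fun u => h (vcst (tau u)) : restr M); split.
- move=> a x y; apply/funext => n; rewrite lf vpsD (lin_add ltheta); congr (_ + _).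
  by rewrite !vpsZ (lin_sum ltheta); apply: eq_bigr => i _; rewrite (lin_scale ltheta).
- by move=> a u v; rewrite ltau hcst lh.
- by move=> x; rewrite -pE.
move=> x; rewrite tauE; exists (h (fun n => f x n.+1)).
rewrite expr1 -{1}[x]fK -(lin_sub lh) -(lin_scale lh).
congr h; apply/funext => n; rewrite vpsD vpsN vps_hbar.
by case: n => [|n] /=; rewrite ?subrr ?subr0.
Qed.
End TopFree.

(** * The classical limit of a coassociative coproduct *)

(** The bookkeeping of the alternated twist equation: P is the cyclic sum, s the transposition of
    the first two factors, a and c are the legs of f, b and d its two partial coproducts. *)
Lemma alternated_sum (V W : zmodType) (P : V -> W) (s : V -> V) (a b c d b' d' : V) :
  {morph P : x y / x - y} -> {morph s : x y / x - y} ->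
  P a = P c -> P (s a) = P (s c) -> s b = b' -> P (s d) = P d' ->
  let X := a + b - (c + d) in P (X - s X) = P (b - b') - P (d - d').
Proof.
move=> PB sB ac sac <- sd X.
have P0 : P 0 = 0 by rewrite -[in LHS](subrr 0) PB subrr.
have s0 : s 0 = 0 by rewrite -[in LHS](subrr 0) sB subrr.
have PN x : P (- x) = - P x by rewrite -sub0r PB P0 sub0r.
have sN x : s (- x) = - s x by rewrite -sub0r sB s0 sub0r.
have PD x y : P (x + y) = P x + P y by rewrite -[y in LHS]opprK PB PN opprK.
have sD x y : s (x + y) = s x + s y by rewrite -[y in LHS]opprK sB sN opprK.
by rewrite /X !(PD, PN, sD, sN) ac sac sd; abelian.
Qed.

Lemma scale_cancel (R : pzRingType) (V : lmodType R) (h : R) (a b c d : V) :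
  (forall x : V, h *: x = 0 -> x = 0) ->
  - (h *: a) = h *: b - h *: c -> d = b - c -> d = - a.
Proof.
move=> inj E ->; apply/eqP; rewrite -subr_eq0 opprK; apply/eqP/inj.
by rewrite scalerDr scalerBr -E addNr.
Qed.

Section ClassicalLimit.
Variables (k : fieldType) (U : algType (fps k)) (A : algType k) (p : U -> A).
Hypotheses (free : hfree p) (pS : forall u, exists x, p x = u).
Local Notation C2 := (ctens2 U).
Local Notation C3 := (ctens3 U).
Local Notation red2 := (cred2 p).

Variable Delta : U -> C2.
Hypothesis lD : linear Delta.
Hypothesis cocomm : forall x, tflip (red2 (Delta x)) = red2 (Delta x).

(** Cocommutativity modulo hbar makes Delta - Delta^op divisible by hbar, and torsion freeness makes
    the quotient linear. Its reduction does not depend on the lift, so it descends to a linear map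
    on all of A. *)
Lemma quantum_cobracket : exists dh : U -> C2, exists2 d0 : A -> tens A A,
  linear dh /\ (forall x, hbar *: dh x = Delta x - cflip (Delta x))
  & linear d0 /\ (forall x, red2 (dh x) = d0 (p x)).
Proof.
have dE x : exists y, Delta x - cflip (Delta x) = hbar *: y.
  by apply/(cred2_kernel free); rewrite (cred2B free) (cred2_flip free) cocomm subrr.
have [dh dhE] := choice dE; have [s sE] := choice pS.
have inj := hbar_inj (torsionfree2 free).
have ld : linear (fun x => Delta x - cflip (Delta x)).
  exact: linear_subf lD (linear_comp lD (@cflip_linear _ U)).
have ldh : linear dh.
  move=> a x y; apply: inj; rewrite -dhE ld !dhE.
  by rewrite scalerDr !scalerA mulrC.
have redE x y : p x = p y -> red2 (dh x) = red2 (dh y).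
  move=> xy; have [z E] : exists z, x = hbar *: z + y.
    have : p (x - y) = 0.
      rewrite addrC -scaleN1r (hfree_semilinear free) xy.
      by rewrite -[(-1 : fps k) 0%N]/(-1) scaleN1r addNr.
    by move/(hfree_kernel free) => [z]; rewrite subr0 expr1 => E; exists z; rewrite -E subrK.
  by rewrite E ldh (cred2D free) (cred2_hbar free) add0r.
exists dh, (fun u => red2 (dh (s u))); first by split.
split=> [a u v|x]; last by apply: redE; rewrite sE.
have -> : red2 (dh (s (a *: u + v))) = red2 (dh (fpsC a *: s u + s v)).
  by apply: redE; rewrite (hfree_semilinear free) !sE.
by rewrite ldh (cred2D free) (cred2Z free).
Qed.

Variables (dh : U -> C2) (d0 : A -> tens A A).
Hypotheses (ldh : linear dh) (dhE : forall x, hbar *: dh x = Delta x - cflip (Delta x)).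
Hypotheses (ld0 : linear d0) (d0E : forall x, red2 (dh x) = d0 (p x)).

Lemma cdelta_id_commutator s :
  cdelta_id (fun x => Delta x - cflip (Delta x)) s = hbar *: cdelta_id dh s.
Proof.
rewrite -(cdelta_id_scale hbar s ldh); congr (cdelta_id _ s).
by apply/funext => x; rewrite dhE.
Qed.

Lemma classical_cojacobi : 
  (forall x, cdelta_id Delta (Delta x) = cid_delta Delta (Delta x)) ->
  forall u, plus_cp (delta_id d0 (d0 u)) = 0.
Proof.
move=> coassoc u; have [x <-] := pS u; rewrite -d0E.
rewrite -(cred3_delta_id free ldh ld0 d0E) -(cred3_plus_ccp free).
suff -> : plus_ccp (cdelta_id dh (dh x)) = 0.
  by rewrite -(scaler0 _ hbar) (cred3_hbar free).
have := cojacobi_of_coassoc lD coassoc x.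
rewrite /= cdelta_id_commutator -dhE.
have -> := lin_scale (cdelta_id_linear ldh) hbar (dh x).
have -> := lin_scale (@plus_ccp_linear _ U) hbar (hbar *: cdelta_id dh (dh x)).
have -> := lin_scale (@plus_ccp_linear _ U) hbar (cdelta_id dh (dh x)).
by move/(torsionfree3 free)/(torsionfree3 free).
Qed.

Variable f : C2.
Local Notation q := (leg12 f * cdelta_id Delta f - leg23 f * cid_delta Delta f).

(* Antisymmetrizing cancels the legs of [f] and turns [Delta] into
   [Delta - Delta^op], so that both sides become divisible by hbar. *)
Lemma twist_equation_alternated :
  leg12 f + cdelta_id Delta f - (leg23 f + cid_delta Delta f) = - (hbar *: q) ->
  plus_ccp (cdelta_id dh (f - cflip f)) = - plus_ccp (q - cswap12 q).
Proof.
have lP := @plus_ccp_linear _ U; have lS := @cswap12_linear _ U.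
have ld : linear (fun x => Delta x - cflip (Delta x)).
  exact: linear_subf lD (linear_comp lD (@cflip_linear _ U)).
have lop := linear_comp lD (@cflip_linear _ U).
have PB : {morph @plus_ccp _ U : u v / u - v} := lin_sub lP.
have SB : {morph @cswap12 _ U : u v / u - v} := lin_sub lS.
have Peq (u v : C3) (e : u = v) := congr1 (@plus_ccp _ U) e.
have x12 := etrans (Peq _ _ (cswap12_leg12 f)) (esym (plus_ccp_leg23 (cflip f))).
have x34 := etrans (plus_ccp_swap (leg23 f)) (Peq _ _ (cswap23_leg23 f)).
have x43 := esym x34.
have s12 := etrans x12 x43.
have sid := etrans (plus_ccp_swap (cid_delta Delta f)) (Peq _ _ (cswap23_id_delta f lD)).
have leg := esym (plus_ccp_leg23 f).
have altE := alternated_sum PB SB leg s12 (cswap12_delta_id f lD) sid.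
have E11 := Peq _ _ (cdelta_id_sub f lD lop).
have E12 := Peq _ _ (cdelta_id_commutator f).
have E13 := lin_scale lP hbar (cdelta_id dh f).
have E1 := etrans (esym E11) (etrans E12 E13).
have E21 := Peq _ _ (cid_delta_sub f lD lop).
(* Up to cyclic permutation (id (x) d)(f) is (d (x) id)(f_21); this is the origin of f - f_21. *)
have E22 := esym (plus_ccp_cyc (cid_delta (fun x => Delta x - cflip (Delta x)) f)).
have E23 := Peq _ _ (esym (cdelta_id_flip ld f)).
have E24 := Peq _ _ (cdelta_id_commutator (cflip f)).
have E25 := lin_scale lP hbar (cdelta_id dh (cflip f)).
have E2 := etrans (esym E21) (etrans E22 (etrans E23 (etrans E24 E25))).
have lPS := linear_comp (linear_subf (@id_linear _ _) lS) lP.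
have E31 := lin_opp lPS (hbar *: q).
have E32 := lin_scale lPS hbar q.
have E3 := etrans E31 (congr1 -%R E32).
have lPd := linear_comp (cdelta_id_linear ldh) lP.
have E4 := lin_sub lPd f (cflip f).
have E5 := congr2 (fun u v => u - v) E1 E2.
have altE' := etrans altE E5.
move=> XE.
have E6 := etrans (esym E3) (etrans (congr1 (fun u => plus_ccp (u - cswap12 u)) (esym XE)) altE').
exact: scale_cancel (torsionfree3 free) E6 E4.
Qed.
End ClassicalLimit.

(** * Antisymmetry of kappa and orthogonality of F *)

Section Orthogonality.
Variables (k : fieldType) (char0 : [pchar k] =i pred0) (U : algType (fps k)).
Local Notation C2 := (ctens2 U).
Hypothesis torsionfree : forall x : C2, hbar *: x = 0 -> x = 0.

Lemma cflip_1 : cflip (1 : C2) = 1.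
Proof. exact: (cflip_hin (1 : U) 1). Qed.

Lemma cflip_exp (x : C2) n : cflip (x ^+ n) = cflip x ^+ n.
Proof.
elim: n => [|n IH]; first exact: cflip_1.
have e1 := exprS x n; have e2 := exprS (cflip x) n.
have e3 := cflipM x (x ^+ n).
by rewrite e1 e2 e3 IH.
Qed.

Lemma exp_flip (x F : C2) : has_hsum (exp_term (hbar *: x)) F ->
  has_hsum (exp_term (hbar *: cflip x)) (cflip F).
Proof.
have lf := @cflip_linear _ U.
have E n : cflip (exp_term (hbar *: x) n) = exp_term (hbar *: cflip x) n.
  have e1 := lin_scale lf (fpsC (n`!%:R^-1)) ((hbar *: x) ^+ n).
  have e2 := cflip_exp (hbar *: x) n.
  have e3 := lin_scale lf hbar x.
  by rewrite /exp_term e1 e2 e3.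
move=> s n; have [N sN] := s n; exists N => m /sN /(hcong_linear lf).
rewrite (lin_sum lf); suff -> : \sum_(i < m) cflip (exp_term (hbar *: x) i)
    = \sum_(i < m) exp_term (hbar *: cflip x) i by [].
by apply: eq_bigr => i _; apply: E.
Qed.

(** The flip is a continuous algebra automorphism, so F_21 = exp(hbar x_21), while F^-1 = exp(- hbar
    x). The converse is the injectivity of the exponential. *)
Lemma exp_antisym_orthogonal (x F : C2) : has_hsum (exp_term (hbar *: x)) F ->
  cflip x = - x <-> cflip F = ring_inv F.
Proof.
move=> eF; have efF := exp_flip eF; have [G eG _] := exp_sum (- x).
have eF' : has_hsum (exp_term (hbar *: - - x)) F by rewrite opprK.
have FG := hexpN char0 eF eG; have GF := hexpN char0 eG eF'.
have invF : ring_inv F = G := ring_invE FG GF.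
rewrite invF; split=> [xN|fF].
  rewrite xN in efF; exact: has_hsum_uniq efF eG.
rewrite fF in efF; have e := hexp_inj torsionfree efF eG.
exact e.
Qed.
End Orthogonality.

(** * Twists of Lie bialgebras *)

Section ClassicalTwist.
Variables (K : fieldType) (g : lmodType K) (br : g -> g -> g) (delta : g -> tens g g).
Variable c : tens g g.
Hypotheses (bialg : is_lie_bialg br delta) (flipc : tflip c = - c).
Local Notation delta_c := (delta_twist br delta c).
Let lie : is_lie br. Proof. by case: bialg. Qed.
Let lbr : bilinear_map br. Proof. by case: lie. Qed.

Lemma lie_twist_of_mc : plus_cp (delta_id delta c) + schouten br c c = 0 ->
  is_lie_twist br delta c.
Proof.
move=> mc x; rewrite mc flipc subrr; split.
  exact: lin_zero (ad3_linear lbr x).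
exact: lin_zero (ad2_linear lbr x).
Qed.

Lemma delta_twist_linear : linear delta_c.
Proof.
have ld : linear delta by case: bialg.
exact: linear_subf ld (ad2_linear_l lbr c).
Qed.

Lemma delta_twist_bialg : (forall x, plus_cp (delta_id delta_c (delta_c x)) = 0) ->
  is_lie_bialg br delta_c.
Proof.
have [_ ld anti _ cocycle] := bialg; move=> coJ.
split=> //; first exact: delta_twist_linear.
- move=> x; rewrite /delta_twist tflipD tflipN anti (ad2_flip lbr) flipc.
  by rewrite (lin_opp (ad2_linear lbr x)) opprB opprK addrC.
- move=> x y; rewrite /delta_twist cocycle ad2_lie //.
  rewrite !(lin_sub (ad2_linear lbr _)).
  by abelian.
Qed.
End ClassicalTwist.

Lemma first_order_cancel (R : pzRingType) (V : lmodType R) (h : R) (a b u v : V) :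
  (forall x : V, h *: x = 0 -> x = 0) ->
  h *: (a + h *: u) = h *: (b + h *: v) -> a - b = - (h *: (u - v)).
Proof.
move=> inj E; have e : a + h *: u = b + h *: v.
  by apply/eqP; rewrite -subr_eq0; apply/eqP/inj; rewrite scalerBr E subrr.
rewrite scalerBr; have -> : a = b + h *: v - h *: u by rewrite -e addrK.
abelian.
Qed.

Lemma mul_near_1 (K : comNzRingType) (U : algType (fps K)) (x y : ctens3 U) :
  (1 + hbar *: x) * (1 + hbar *: y) = 1 + hbar *: (x + y + hbar *: (x * y)).
Proof.
have [ml mr] := ctens3_mul_bilinear U.
have e1 : (hbar *: x) * (hbar *: y) = hbar *: (x * (hbar *: y)).
  exact: lin_scale (ml (hbar *: y)) hbar x.
have e2 : x * (hbar *: y) = hbar *: (x * y) := lin_scale (mr x) hbar y.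
have e3 : (1 + hbar *: x) * (1 + hbar *: y)
    = 1 + hbar *: x + (hbar *: y + (hbar *: x) * (hbar *: y)).
  by rewrite mulrDr mulr1 mulrDl mul1r.
have e4 := scalerDr hbar (x + y) (hbar *: (x * y)).
have e5 := scalerDr hbar x y.
rewrite e3 e1 e2 e4 e5; abelian.
Qed.

Lemma twist_equation_first_order (K : comNzRingType) (U : algType (fps K)) (a b c d : ctens3 U) :
  (forall x : ctens3 U, hbar *: x = 0 -> x = 0) ->
  (1 + hbar *: a) * (1 + hbar *: b) = (1 + hbar *: c) * (1 + hbar *: d) ->
  a + b - (c + d) = - (hbar *: (a * b - c * d)).
Proof.
move=> tf; have e1 := mul_near_1 a b; have e2 := mul_near_1 c d.
move=> E; have e3 := addrI _ (etrans (esym e1) (etrans E e2)).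
exact: first_order_cancel tf e3.
Qed.

(** * From the quantum twist to the Lie twist *)

Section QuantumCobracket.
Variables (k : fieldType) (g : lmodType k) (br : g -> g -> g) (delta : g -> tens g g).
Variables (U : algType (fps k)) (p : U -> uea br) (Delta : U -> ctens2 U).
Hypotheses (free : hfree p) (pS : forall u, exists x, p x = u) (lD : linear Delta).
Hypothesis copE : forall x, cred2 p (Delta x) = uea_cop (p x).
Hypothesis compat : forall x x', p x' = uea_in br x ->
  exists2 y, Delta x' - cflip (Delta x') = hbar *: y
  & cred2 p y = tmap (uea_in br) (uea_in br) (delta x).

(** Division by hbar being unique, the reduction [d0] on U(g) extends the cobracket prescribed on
    g. *)
Lemma cobracket_reduction : exists dh : U -> ctens2 U, exists2 d0 : uea br -> tens (uea br) (uea br),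
  linear dh /\ (forall x, hbar *: dh x = Delta x - cflip (Delta x))
  & [/\ linear d0, forall x, cred2 p (dh x) = d0 (p x)
      & forall x, d0 (uea_in br x) = tmap (uea_in br) (uea_in br) (delta x)].
Proof.
have cocomm x : tflip (cred2 p (Delta x)) = cred2 p (Delta x).
  by rewrite copE uea_cop_cocomm.
have [dh [d0 [ldh dhE] [ld0 d0E]]] := quantum_cobracket free pS lD cocomm.
exists dh, d0; split=> // x; have [x' px] := pS (uea_in br x).
have [y yE <-] := compat px; rewrite -px -d0E.
have e := hbar_inj (torsionfree2 free) (etrans (dhE x') yE).
by rewrite e.
Qed.
End QuantumCobracket.

Section QuantumTwist.
Variables (k : fieldType) (char0 : [pchar k] =i pred0).
Variables (g : lmodType k) (br : g -> g -> g) (delta : g -> tens g g).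
Variables (U : algType (fps k)) (H : hopf_ops U) (p : U -> uea br).
Hypotheses (bialg : is_lie_bialg br delta) (hopfH : is_top_hopf H).
Hypotheses (free : hfree p) (pM : monoid_morphism p) (pS : forall u, exists x, p x = u).
Local Notation C2 := (ctens2 U).
Local Notation C3 := (ctens3 U).
Local Notation Ug := (uea br).
Local Notation iota := (uea_in br).
Local Notation iota2 := (tmap iota iota).
Local Notation Delta := (cop H).
Hypothesis copE : forall x, cred2 p (Delta x) = uea_cop (p x).
Hypothesis compat : forall x x', p x' = iota x ->
  exists2 y, Delta x' - cflip (Delta x') = hbar *: y & cred2 p y = iota2 (delta x).

Let lie : is_lie br. Proof. by case: bialg. Qed.
Let lbr : bilinear_map br. Proof. by case: lie. Qed.
Let lD : linear Delta. Proof. by case: hopfH => -[]. Qed.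
Let DM : monoid_morphism Delta. Proof. by case: hopfH => -[]. Qed.

Variables (f F G : C2).
Hypotheses (FE : F = 1 + hbar *: f) (FG : F * G = 1) (GF : G * F = 1).
Hypothesis twF : leg12 F * cop_id H F = leg23 F * id_cop H F.

Local Notation q := (leg12 f * cdelta_id Delta f - leg23 f * cid_delta Delta f).
Local Notation K := (cred2 p f).
Local Notation t := (cred2 p (f - cflip f)).

(** All four maps send 1 to 1, so the terms free of hbar cancel; one factor hbar is divided out, and
    the quadratic part keeps the other. *)
Lemma twist_equation_linearized :
  leg12 f + cdelta_id Delta f - (leg23 f + cid_delta Delta f) = - (hbar *: q).
Proof.
have near (L : C2 -> C3) : linear L -> L 1 = 1 -> L F = 1 + hbar *: L f.
  by move=> lL L1; rewrite FE (lin_add lL) L1 (lin_scale lL).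
have e1 := near _ (@leg12_linear _ U) (@leg12_1 _ U).
have e2 := near _ (@leg23_linear _ U) (@leg23_1 _ U).
have e3 := near _ (cdelta_id_linear lD) (cdelta_id_1 lD DM).
have e4 := near _ (cid_delta_linear lD) (cid_delta_1 lD DM).
apply: twist_equation_first_order; first exact: (torsionfree3 free).
have e5 := cop_idE H F; have e6 := id_copE H F.
have e7 := congr2 *%R e1 (etrans e5 e3); have e8 := congr2 *%R e2 (etrans e6 e4).
have e9 := etrans (esym e7) (etrans twF e8).
exact e9.
Qed.

Lemma twist_cocycle : aleg12 K + delta_id (@uea_cop _ _ br) K = aleg23 K + id_delta (@uea_cop _ _ br) K.
Proof.
have lC := @uea_cop_linear _ _ br.
have e1 := cred3_leg12 free pM f; have e2 := cred3_leg23 free pM f.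
have e3 := cred3_delta_id free lD lC copE f.
have e4 := cred3_id_delta free lD lC copE f.
have e5 := congr1 (cred3 p) twist_equation_linearized.
have e6 := cred3B free (leg12 f + cdelta_id Delta f) (leg23 f + cid_delta Delta f).
have e7 := cred3D free (leg12 f) (cdelta_id Delta f).
have e8 := cred3D free (leg23 f) (cid_delta Delta f).
have e9 := cred3N free (hbar *: q).
have e10 := cred3_hbar free q.
have e11 := etrans (esym e6) (etrans e5 (etrans e9 (congr1 -%R e10))).
have e12 := subr0_eq (etrans e11 (oppr0 _)).
have e13 := etrans e7 (congr2 +%R e1 e3); have e14 := etrans e8 (congr2 +%R e2 e4).
have e15 := etrans (esym e13) (etrans e12 e14).
exact e15.
Qed.

Lemma tE : t = K - tflip K.
Proof. by rewrite (cred2B free) (cred2_flip free). Qed.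

(** Antisymmetry is first known for the image of c in U(g) (x) U(g); the retraction onto g transfers
    it to c. *)
Lemma twist_classical : exists2 c, t = iota2 c & tflip c = - c.
Proof.
have [e le eK] := uea_in_retraction char0 lie.
have li := @uea_in_linear _ _ br.
have prim := cocycle_antisym_primitive (@uea_cop_linear _ _ br) (@uea_cop_cocomm _ _ br) twist_cocycle.
have anti : tflip (K - tflip K) = - (K - tflip K) by rewrite tflipD tflipN tflipK opprB addrC.
have [c cE] := bi_primitive_lie2 char0 prim anti.
exists c; first by rewrite tE.
rewrite -[LHS](tmap2_retract li le eK) -[RHS](tmap2_retract li le eK).
by rewrite -(tflip_tmap li) -cE anti cE (lin_opp (tmap2_linear li)).
Qed.

(** The alternated equation is reduced modulo hbar in the cube of U(g), where [d0] extends delta and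
    commutators of legs are images of Lie brackets; the retraction then brings it down to g. *)
Lemma twist_maurer_cartan c : t = iota2 c -> plus_cp (delta_id delta c) + schouten br c c = 0.
Proof.
move=> tc; have [e le eK] := uea_in_retraction char0 lie.
have li := @uea_in_linear _ _ br; have lC := @uea_cop_linear _ _ br.
have ld : linear delta by case: bialg.
have [dh [d0 [ldh dhE] [ld0 d0E d0i]]] := cobracket_reduction free pS lD copE compat.
have e1 := congr1 (cred3 p) (twist_equation_alternated free lD ldh dhE twist_equation_linearized).
have e2 := cred3_plus_ccp free (cdelta_id dh (f - cflip f)).
have e3 := cred3_delta_id free ldh ld0 d0E (f - cflip f).
have e4 := cred3N free (plus_ccp (q - cswap12 q)).
have e5 := cred3_plus_ccp free (q - cswap12 q).
have e6 := cred3B free q (cswap12 q).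
have e7 := cred3_swap12 free q.
have e8 := cred3B free (leg12 f * cdelta_id Delta f) (leg23 f * cid_delta Delta f).
have e9 := cred3M free pM (leg12 f) (cdelta_id Delta f).
have e10 := cred3M free pM (leg23 f) (cid_delta Delta f).
have e11 := congr2 *%R (cred3_leg12 free pM f) (cred3_delta_id free lD lC copE f).
have e12 := congr2 *%R (cred3_leg23 free pM f) (cred3_id_delta free lD lC copE f).
have e13 := etrans e8 (congr2 (fun u v => u - v) (etrans e9 e11) (etrans e10 e12)).
have e14 := etrans e6 (congr2 (fun u v => u - v) e13 (etrans e7 (congr1 (@swap12 _ _) e13))).
have e15 := etrans e4 (congr1 -%R (etrans e5 (congr1 (@plus_cp _ _) e14))).
have e16 := cocycle_second_order lC (@uea_cop_cocomm _ _ br) twist_cocycle.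
have e17 := etrans e15 (congr1 -%R e16).
have e18 := etrans (esym e2) (etrans e1 e17).
have e19 := etrans (esym (congr1 (@plus_cp _ _) e3)) e18.
have tK : K - tflip K = iota2 c by rewrite -tE.
have e20 : plus_cp (delta_id d0 t) = - tmap iota iota2 (schouten br c c).
  by rewrite e19 tK (schouten_uea_in lbr).
have e21 : plus_cp (delta_id d0 t) = tmap iota iota2 (plus_cp (delta_id delta c)).
  by rewrite tc (delta_id_tmap li c ld ld0 d0i) (plus_cp_tmap li).
have e22 := lin_opp (tmap3_linear li) (schouten br c c).
have e23 := tmap3_inj li le eK (etrans (esym e21) (etrans e20 (esym e22))).
by rewrite e23 addNr.
Qed.

Local Notation DF := (twist_cop H F G).

Lemma twist_cop_linear : linear DF.
Proof.
have [ml mr] := ctens2_mul_bilinear U.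
exact: linear_comp (linear_comp lD (mr F)) (ml G).
Qed.

Lemma cred2_near_1 : cred2 p F = 1.
Proof.
have e1 := cred2D free 1 (hbar *: f); have e2 := cred2_1 free pM.
have e3 := cred2_hbar free f.
by rewrite FE e1 e2 e3 addr0.
Qed.

Lemma cred2_inv_near_1 : cred2 p G = 1.
Proof.
have e1 := congr1 (cred2 p) FG; have e2 := cred2M free pM F G.
have e3 := cred2_1 free pM; have e4 := etrans (esym e2) (etrans e1 e3).
by rewrite cred2_near_1 mul1r in e4.
Qed.

Lemma cred2_twist_cop x : cred2 p (DF x) = uea_cop (p x).
Proof.
have e1 := cred2M free pM (F * Delta x) G; have e2 := cred2M free pM F (Delta x).
rewrite /twist_cop e1 e2 cred2_near_1 cred2_inv_near_1 copE mul1r.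
exact: mulr1.
Qed.

Lemma twist_copE x : DF x = Delta x + hbar *: ((f * Delta x - Delta x * f) * G).
Proof.
have [ml mr] := ctens2_mul_bilinear U; set D := Delta x.
have e1 : F * D = D * F + hbar *: (f * D - D * f).
  have l1 : (hbar *: f) * D = hbar *: (f * D) := lin_scale (ml D) hbar f.
  have l2 : D * (hbar *: f) = hbar *: (D * f) := lin_scale (mr D) hbar f.
  rewrite FE mulrDl mulrDr mul1r mulr1 l1 l2 scalerBr; abelian.
have e2 : (hbar *: (f * D - D * f)) * G = hbar *: ((f * D - D * f) * G).
  exact: lin_scale (ml G) hbar (f * D - D * f).
have e3 := mulrDl (D * F) (hbar *: (f * D - D * f)) G.
have e4 : D * F * G = D := etrans (esym (mulrA D F G)) (etrans (congr1 (fun z => D * z) FG) (mulr1 D)).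
have e5 := etrans (congr1 (fun z => z * G) e1) (etrans e3 (congr2 +%R e4 e2)).
exact e5.
Qed.

Lemma twist_compat c : t = iota2 c -> forall x x', p x' = iota x ->
  exists2 y, DF x' - cflip (DF x') = hbar *: y & cred2 p y = iota2 (delta_twist br delta c x).
Proof.
move=> tc x x' px; have [y yE ry] := compat px.
have li := @uea_in_linear _ _ br; have lf := @cflip_linear _ U.
pose D : atens2 Ug := uea_cop (iota x).
pose e := (f * Delta x' - Delta x' * f) * G.
have re : cred2 p e = K * D - D * K.
  have e1 := cred2M free pM (f * Delta x' - Delta x' * f) G.
  have e2 := cred2B free (f * Delta x') (Delta x' * f).
  have e3 := cred2M free pM f (Delta x'); have e4 := cred2M free pM (Delta x') f.
  by rewrite /e e1 e2 e3 e4 cred2_inv_near_1 copE px mulr1.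
have flipD : tflip D = D by exact: uea_cop_cocomm.
have re' : cred2 p (cflip e) = (tflip K : atens2 Ug) * D - D * (tflip K : atens2 Ug).
  have e1 := cred2_flip free e.
  by rewrite e1 re tflipD tflipN !tflipM flipD.
(* The twisted coproduct is Delta + hbar e, so the correction to y is e - e_21; it reduces to the
   commutator of t with Delta(x), which is - ad_x(c). *)
exists (y + (e - cflip e)).
  have e1 := twist_copE x'; have e2 := lin_add lf (Delta x') (hbar *: e).
  have e3 := lin_scale lf hbar e.
  have e4 := scalerDr hbar y (e - cflip e); have e5 := scalerBr hbar e (cflip e).
  have e6 := congr1 (@cflip _ U) e1.
  rewrite e6 e2 e3 e1 e4 e5 -yE -/e; abelian.
have e1 := cred2D free y (e - cflip e); have e2 := cred2B free e (cflip e).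
have e3 : K - tflip K = iota2 c by rewrite -tE.
have e4 : K * D - D * K - ((tflip K : atens2 Ug) * D - D * (tflip K : atens2 Ug)) = (K - tflip K) * D - D * (K - tflip K).
  by rewrite mulrBl mulrBr; abelian.
rewrite e1 e2 re re' ry e4 e3 /delta_twist (lin_sub (tmap2_linear li)) (ad2_uea_in lbr).
by rewrite -/D opprB.
Qed.

(** Only co-Jacobi needs the quantum side: delta^c is the classical limit of the coassociative
    coproduct [twist_cop H F G], to which [classical_cojacobi] applies. *)
Lemma twist_bialg c : t = iota2 c -> tflip c = - c -> is_lie_bialg br (delta_twist br delta c).
Proof.
move=> tc flipc; apply: (delta_twist_bialg bialg flipc) => x.
have [e le eK] := uea_in_retraction char0 lie.
have li := @uea_in_linear _ _ br; have ld := delta_twist_linear c bialg.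
have lDF := twist_cop_linear.
have [dh [d0 [ldh dhE] [ld0 d0E d0i]]] :=
  cobracket_reduction free pS lDF cred2_twist_cop (twist_compat tc).
have coassoc := twist_coassoc hopfH FG GF twF.
have e1 := classical_cojacobi free pS lDF ldh dhE ld0 d0E coassoc (iota x).
rewrite d0i (delta_id_tmap li _ ld ld0 d0i) (plus_cp_tmap li) in e1.
have e2 := etrans e1 (esym (lin_zero (tmap3_linear li))).
have e3 := tmap3_inj li le eK e2.
exact e3.
Qed.
End QuantumTwist.

Lemma conj_near_1 (K : comNzRingType) (U : algType (fps K)) (A : algType K) (p : U -> A) (v x : U) :
  hfree p -> monoid_morphism p -> hseparated U -> (forall x : hcompl U, exists t, hin t = x) ->
  hcong 1 v 1 -> p (ring_inv v * x * v) = p x.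
Proof.
move=> free pM sepU complU v1; have pv : p v = 1 by rewrite (hfree_cong free v1) pM.1.
have [w vw wv] := inv_near_1 sepU complU v1.
have pw : p w = 1.
  by have := congr1 p wv; rewrite pM.2 pv mulr1 pM.1.
by rewrite (ring_invE vw wv) !pM.2 pv pw mul1r mulr1.
Qed.

Theorem theorem3p1p2 (k : fieldType) (char0 : [pchar k] =i pred0)
    (g : lmodType k) (br : g -> g -> g) (delta : g -> tens g g)
    (U : algType (fps k)) (H : hopf_ops U) (p : U -> uea br)
    (hU : is_quea_over H delta p)
    (F : ctens2 U) (twF : is_hopf_twist H F) (F1 : hcong 1 F 1) :
  let kappa := hbar_div (hlog F) in
  let kappa_a := kappa - cflip kappa in
  [/\ has_hsum (log_term F) (hbar *: kappa),
      has_hsum (exp_term (hbar *: kappa)) F,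
      (cflip kappa = - kappa <-> cflip F = ring_inv F)
    & exists c : tens g g,
        [/\ red2 p kappa_a = tmap (uea_in br) (uea_in br) c,
            tflip c = - c,
            is_lie_twist br delta c
          & is_quea_over (twist_hopf H F) (delta_twist br delta c) p]].
Proof.
have [[lie hopfH topfree [[pL pM] [pS pK] copE epE SE]] bialg compat] := hU.
have [[G [FG GF]] epF Fep twE] := twF.
have free := top_free_hfree topfree pL pS pK.
have sepU := top_free_separated topfree; have complU := top_free_complete topfree.
have tf2 := torsionfree2 free.
have [f fE] := F1; rewrite expr1 in fE.
have FE : F = 1 + hbar *: f by rewrite -fE addrC subrK.
have [slog sexp kf] := hlog_exp char0 tf2 FE.
move=> kappa kappa_a; split; [exact slog | exact sexp | |].
  have e := exp_antisym_orthogonal char0 tf2 sexp.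
  exact e.
have copE' x : cred2 p (cop H x) = uea_cop (p x) := copE x.
have lf := linear_subf (@id_linear _ _) (@cflip_linear _ U).
(* kappa and f agree modulo hbar, so f stands for kappa from here on. *)
have redk : cred2 p kappa_a = cred2 p (f - cflip f) := cred2_hcong free (hcong_linear lf kf).
have [c tc flipc] := twist_classical char0 bialg hopfH free pM copE' FE twE.
have mc := twist_maurer_cartan char0 bialg hopfH free pM pS copE' compat FE twE tc.
have invF : ring_inv F = G := ring_invE FG GF.
exists c; split; [exact (etrans redk tc) | exact flipc | exact: lie_twist_of_mc bialg flipc mc |].
have copF x : cop (twist_hopf H F) x = twist_cop H F G x by rewrite /= invF.
split; last 2 first.
- have e := twist_bialg char0 bialg hopfH free pM pS copE' compat FE FG GF twE tc flipc.
  exact e.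
- move=> x x' px; rewrite !copF.
  have e := twist_compat bialg free pM copE' compat FE FG tc px.
  exact e.
have hopfF := twist_is_top_hopf sepU complU hopfH FG GF epF Fep twE F1.
split; [exact lie | exact hopfF | exact topfree |].
split; [exact (conj pL pM) | exact (conj pS pK) | | exact epE |].
- move=> x; rewrite copF; have e := cred2_twist_cop free pM copE' FE FG x.
  exact e.
(* As v = 1 modulo hbar, conjugation by v is invisible in U(g), and p is compatible with the twisted
   antipode as well. *)
- move=> x; rewrite -SE; apply: (conj_near_1 _ free pM sepU complU).
  rewrite (twist_eltE H FG GF); have e := twist_elt_near_1 sepU complU hopfH FG F1.
  exact e.
Qed.
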